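(* Let $(X,r)$ be an involutive (non-degenerate, set-theoretic) solution to the Yang--Baxter equation with $|X|\leq 8$ that is not a multipermutation solution. Then the structure group $G(X,r)$ contains a subgroup isomorphic to the Promislow group $P=\langle x,y\mid x^{-1}y^2x=y^{-2},\ y^{-1}x^2y=x^{-2}\rangle$ if and only if $(X,r)$ is not isomorphic to any of the eight solutions $S_1,\dots,S_8$ on the set $\{1,\dots,8\}$ listed in the context.
   Context: A solution is a pair $(X,r)$ where $X$ is a non-empty set and $r\colon X\times X\to X\times X$ is a bijective map, written $r(x,y)=(\sigma_x(y),\tau_y(x))$, such that $(r\times\mathrm{id})(\mathrm{id}\times r)(r\times\mathrm{id})=(\mathrm{id}\times r)(r\times\mathrm{id})(\mathrm{id}\times r)$ and all maps $\sigma_x,\tau_x\colon X\to X$ are permutations (non-degeneracy). It is involutive if $r^2=\mathrm{id}$. Solutions $(X,r)$ and $(Y,s)$ are isomorphic if there is a bijection $f\colon X\to Y$ with $(f\times f)r=s(f\times f)$. The structure group $G(X,r)$ is the group with generators the elements $x\in X$ and relations $x\circ y=u\circ v$ whenever $r(x,y)=(u,v)$. For an involutive solution $(X,r)$, write $x\sim y$ if and only if $\sigma_x=\sigma_y$. This equivalence relation induces a solution $\operatorname{Ret}(X,r)$ on the set $X/{\sim}$, given by $([x],[y])\mapsto([\sigma_x(y)],[\tau_y(x)])$. Define $\operatorname{Ret}^1(X,r)=\operatorname{Ret}(X,r)$ and $\operatorname{Ret}^{n+1}(X,r)=\operatorname{Ret}(\operatorname{Ret}^n(X,r))$ for $n\geq1$.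 The solution $(X,r)$ is a multipermutation solution if there exists $n$ such that $\operatorname{Ret}^n(X,r)$ has only one element. The eight solutions $S_1,\dots,S_8$ on $\{1,\dots,8\}$ are $r(x,y)=(\sigma_x(y),\tau_y(x))$ with the following permutations, in cycle notation ($(abc\cdots)$ sends $a$ to $b$, $b$ to $c$, and so on). $S_1$: $\sigma_1=\sigma_2=(3745)$, $\tau_1=\tau_2=(3648)$; $\sigma_3=\sigma_4=(1826)$, $\tau_3=\tau_4=(1527)$; $\sigma_5=\sigma_7=(13872465)$, $\tau_5=\tau_7=(16542873)$; $\sigma_6=\sigma_8=(17842563)$, $\tau_6=\tau_8=(13562478)$. $S_2$: $\sigma_1=\sigma_2=(3745)(68)$, $\tau_1=\tau_2=(3648)(57)$; $\sigma_3=\sigma_4=(1826)(57)$, $\tau_3=\tau_4=(1527)(68)$; $\sigma_5=\sigma_7=(1465)(2387)$, $\tau_5=\tau_7=(1654)(2873)$; $\sigma_6=\sigma_8=(1784)(2563)$, $\tau_6=\tau_8=(1478)(2356)$. $S_3$: $\sigma_1=\sigma_2=(12)(4675)$, $\tau_1=\tau_2=(12)(3685)$; $\sigma_3=\sigma_8=(1435)(2786)$, $\tau_3=\tau_8=(1578)(2643)$; $\sigma_4=\sigma_7=(1587)(2634)$, $\tau_4=\tau_7=(1345)(2876)$; $\sigma_5=\sigma_6=(1823)(56)$, $\tau_5=\tau_6=(1724)(56)$. $S_4$: $\sigma_1=\sigma_2=(12)(35)(4867)$, $\tau_1=\tau_2=(12)(3857)(46)$; $\sigma_3=\sigma_5=(16582437)$,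 $\tau_3=\tau_5=(17652843)$; $\sigma_4=\sigma_6=(17562834)$, $\tau_4=\tau_6=(15682347)$; $\sigma_7=\sigma_8=(1325)(46)(78)$, $\tau_7=\tau_8=(1426)(35)(78)$. $S_5$: $\sigma_1=\sigma_7=(12)(78)$, $\tau_1=\tau_7=(14)(67)$; $\sigma_2=\sigma_8=(1584)(2673)$, $\tau_2=\tau_8=(1265)(3784)$; $\sigma_3=\sigma_5=(34)(56)$, $\tau_3=\tau_5=(23)(58)$; $\sigma_4=\sigma_6=(1485)(2376)$, $\tau_4=\tau_6=(1562)(3487)$. $S_6$: $\sigma_1=\sigma_7=(12)(35)(46)(78)$, $\tau_1=\tau_7=(14)(28)(35)(67)$; $\sigma_2=\sigma_8=(1324)(5867)$, $\tau_2=\tau_8=(1243)(5786)$; $\sigma_3=\sigma_5=(17)(28)(34)(56)$, $\tau_3=\tau_5=(17)(23)(46)(58)$; $\sigma_4=\sigma_6=(1423)(5768)$, $\tau_4=\tau_6=(1342)(5687)$. $S_7$: $\sigma_1=\sigma_7=(13687542)$, $\tau_1=\tau_7=(13867524)$; $\sigma_2=\sigma_8=(17)(2583)(46)$, $\tau_2=\tau_8=(1278)(35)(46)$; $\sigma_3=\sigma_5=(18657243)$, $\tau_3=\tau_5=(16857423)$; $\sigma_4=\sigma_6=(1476)(28)(35)$, $\tau_4=\tau_6=(17)(28)(3456)$. $S_8$: $\sigma_1=\sigma_5=(1652)$, $\tau_1=\tau_5=(1854)$; $\sigma_2=\sigma_6=(17645328)$, $\tau_2=\tau_6=(12835647)$;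 $\sigma_3=\sigma_7=(3874)$, $\tau_3=\tau_7=(2367)$; $\sigma_4=\sigma_8=(14635827)$, $\tau_4=\tau_8=(17825346)$. *)

(* Defs.v *)
From HB Require Import structures.
From mathcomp Require Import all_boot.
From mathcomp Require Import boolp.

Set Implicit Arguments.
Unset Strict Implicit.
Unset Printing Implicit Defensive.

Local Open Scope quotient_scope.

(* The letter (x, false) stands for x and (x, true) for its formal inverse. *)
Definition word (T : Type) := seq (T * bool).

Definition inv_letter T (a : T * bool) : T * bool := (a.1, ~~ a.2).
Definition inv_word T (u : word T) : word T := rev (map (@inv_letter T) u).

(* The least congruence on words that contains the relations [R] and makes
   adjacent inverse letters cancel. *)
Inductive word_cong T (R : word T -> word T -> Prop) : word T -> word T -> Prop :=
| WCrefl u : word_cong R u u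
| WCsym u v : word_cong R u v -> word_cong R v u
| WCtrans u v w : word_cong R u v -> word_cong R v w -> word_cong R u w
| WCcat u u' v v' :
    word_cong R u u' -> word_cong R v v' -> word_cong R (u ++ v) (u' ++ v')
| WCcancel a : word_cong R [:: a; inv_letter a] [::]
| WCrel u v : R u v -> word_cong R u v.

Section PresentedGroup.
Variables (T : choiceType) (R : word T -> word T -> Prop).

Definition word_congb (u v : word T) : bool := `[< word_cong R u v >].

Lemma word_congb_refl : reflexive word_congb.
Proof. by move=> u; apply/asboolP; exact: WCrefl. Qed.

Lemma word_congb_sym : symmetric word_congb.
Proof. by move=> u v; apply/asboolP/asboolP; exact: WCsym. Qed.

Lemma word_congb_trans : transitive word_congb.
Proof.
by move=> v u w /asboolP uv /asboolP vw; apply/asboolP; exact: WCtrans uv vw.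
Qed.

Canonical word_congb_equiv :=
  EquivRel word_congb word_congb_refl word_congb_sym word_congb_trans.

Definition presented := {eq_quot word_congb_equiv}.

HB.instance Definition _ := Choice.on presented.

Definition pclass (u : word T) : presented := \pi_presented u.

Lemma pclassP u v : pclass u = pclass v <-> word_cong R u v.
Proof.
split=> [/eqmodP/asboolP //|uv].
by apply/eqmodP/asboolP.
Qed.

Lemma pclass_surj (a : presented) : exists u, a = pclass u.
Proof. by exists (repr a); rewrite /pclass reprK. Qed.

Lemma word_cong_reprE u : word_cong R (repr (pclass u)) u.
Proof. by apply/pclassP; rewrite /pclass reprK. Qed.

Lemma word_cong_invV u : word_cong R (inv_word u ++ u) [::].
Proof.
elim: u => [|a u IHu]; first exact: WCrefl.
rewrite /inv_word /= rev_cons -/(inv_word u) -cats1 -catA -(cat1s a) (catA _ [:: a]).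
apply: WCtrans IHu; apply: WCcat; first exact: WCrefl.
rewrite -{2}(cat0s u); apply: WCcat; last exact: WCrefl.
have -> : [:: inv_letter a] ++ [:: a] = [:: inv_letter a; inv_letter (inv_letter a)].
  by case: a => x b; rewrite /inv_letter /= negbK.
exact: WCcancel.
Qed.

Lemma inv_wordK : involutive (@inv_word T).
Proof.
move=> u; rewrite /inv_word map_rev revK -map_comp map_id_in //.
by case=> x b _; rewrite /inv_letter /= negbK.
Qed.

Lemma word_cong_inv u v :
  word_cong R u v -> word_cong R (inv_word u) (inv_word v).
Proof.
move=> uv; have h : word_cong R (inv_word u ++ v ++ inv_word v) (inv_word u).
  rewrite -{2}(cats0 (inv_word u)); apply: WCcat; first exact: WCrefl.
  by rewrite -{1}(inv_wordK v); exact: word_cong_invV.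
apply: WCtrans (WCsym h) _; rewrite catA -{2}(cat0s (inv_word v)).
apply: WCcat; last exact: WCrefl.
apply: WCtrans (word_cong_invV u).
by apply: WCcat; [exact: WCrefl | exact: WCsym].
Qed.

Definition presented_one : presented := pclass [::].
Definition presented_mul (a b : presented) : presented := pclass (repr a ++ repr b).
Definition presented_inv (a : presented) : presented := pclass (inv_word (repr a)).

Lemma presented_mulE u v : presented_mul (pclass u) (pclass v) = pclass (u ++ v).
Proof. by apply/pclassP/WCcat; exact: word_cong_reprE. Qed.

Lemma presented_invE u : presented_inv (pclass u) = pclass (inv_word u).
Proof. exact/pclassP/word_cong_inv/word_cong_reprE. Qed.

Lemma presented_mulA : associative presented_mul.
Proof.
move=> a b c; have [[[u ->] [v ->]] [w ->]] :=
  (pclass_surj a, pclass_surj b, pclass_surj c).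
by rewrite !presented_mulE catA.
Qed.

Lemma presented_mul1 : left_id presented_one presented_mul.
Proof. by move=> a; have [u ->] := pclass_surj a; rewrite presented_mulE. Qed.

Lemma presented_mulr1 : right_id presented_one presented_mul.
Proof.
by move=> a; have [u ->] := pclass_surj a; rewrite presented_mulE cats0.
Qed.

Lemma presented_mulV : left_inverse presented_one presented_inv presented_mul.
Proof.
move=> a; have [u ->] := pclass_surj a; rewrite presented_invE presented_mulE.
exact/pclassP/word_cong_invV.
Qed.

Lemma presented_mulrV : right_inverse presented_one presented_inv presented_mul.
Proof.
move=> a; have [u ->] := pclass_surj a; rewrite presented_invE presented_mulE.
by apply/pclassP; rewrite -{1}(inv_wordK u); exact: word_cong_invV.
Qed.

HB.instance Definition _ := isGroup.Build presented
  presented_mulA presented_mul1 presented_mulr1 presented_mulV presented_mulrV.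

End PresentedGroup.

Definition contains_copy (G P : groupType) : Prop :=
  exists H : {pred G}, group_closed H /\
    exists2 f : {multiplicative P -> G},
      injective f & forall g : G, g \in H <-> exists p : P, f p = g.

(* The generators x and y are the booleans false and true. *)
Definition px : bool * bool := (false, false).
Definition py : bool * bool := (true, false).
Definition px' := inv_letter px.
Definition py' := inv_letter py.

(* x^-1 y^2 x = y^-2 and y^-1 x^2 y = x^-2 *)
Inductive promislow_rel : word bool -> word bool -> Prop :=
| PromislowX : promislow_rel [:: px'; py; py; px] [:: py'; py']
| PromislowY : promislow_rel [:: py'; px; px; py] [:: px'; px'].

Definition promislow : groupType := presented promislow_rel.

Section YangBaxter.
Variables (X : Type) (r : X * X -> X * X).

(* r (x, y) = (sigma x y, tau y x) *)
Definition sigma (x y : X) : X := (r (x, y)).1.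
Definition tau (y x : X) : X := (r (x, y)).2.

Definition r_id (t : X * X * X) : X * X * X := (r t.1, t.2).
Definition id_r (t : X * X * X) : X * X * X :=
  let p := r (t.1.2, t.2) in (t.1.1, p.1, p.2).

Record is_solution : Prop := IsSolution {
  sol_nonempty : inhabited X;
  sol_bij : bijective r;
  sol_braid : r_id \o id_r \o r_id =1 id_r \o r_id \o id_r;
  sol_sigma_bij : forall x, bijective (sigma x);
  sol_tau_bij : forall x, bijective (tau x) }.

End YangBaxter.

Definition isomorphic X Y (r : X * X -> X * X) (s : Y * Y -> Y * Y) : Prop :=
  exists2 f : X -> Y, bijective f &
    forall x y : X, (f (r (x, y)).1, f (r (x, y)).2) = s (f x, f y).

Inductive structure_rel X (r : X * X -> X * X) : word X -> word X -> Prop :=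
| StructureRel x y u v : r (x, y) = (u, v) ->
    structure_rel r [:: (x, false); (y, false)] [:: (u, false); (v, false)].

Definition structure_group (X : choiceType) (r : X * X -> X * X) : groupType :=
  presented (structure_rel r).

Section Retraction.
Variables (X : choiceType) (r : X * X -> X * X).

Definition ret_rel (x y : X) : bool := `[< sigma r x = sigma r y >].

Lemma ret_rel_refl : reflexive ret_rel.
Proof. by move=> x; apply/asboolP. Qed.

Lemma ret_rel_sym : symmetric ret_rel.
Proof. by move=> x y; apply/asboolP/asboolP. Qed.

Lemma ret_rel_trans : transitive ret_rel.
Proof. by move=> y x z /asboolP xy /asboolP yz; apply/asboolP; rewrite xy. Qed.

Canonical ret_rel_equiv := EquivRel ret_rel ret_rel_refl ret_rel_sym ret_rel_trans.

Definition ret_set := {eq_quot ret_rel_equiv}.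

Definition ret_class (x : X) : ret_set := \pi_ret_set x.

(* Computed on representatives; [ret_mapE] below shows that the choice of
   representatives is irrelevant when [r] is an involutive solution. *)
Definition ret_map (p : ret_set * ret_set) : ret_set * ret_set :=
  (ret_class (sigma r (repr p.1) (repr p.2)),
   ret_class (tau r (repr p.2) (repr p.1))).

Lemma ret_classP x y : ret_class x = ret_class y <-> sigma r x = sigma r y.
Proof.
split=> [/eqmodP/asboolP //|xy].
by apply/eqmodP/asboolP.
Qed.

Lemma ret_class_surj (a : ret_set) : exists x, a = ret_class x.
Proof. by exists (repr a); rewrite /ret_class reprK. Qed.

Lemma sigma_repr x : sigma r (repr (ret_class x)) = sigma r x.
Proof. by apply/ret_classP; rewrite /ret_class reprK. Qed.

Hypotheses (rP : is_solution r) (rK : involutive r).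

Let s_inj x : injective (sigma r x).
Proof. exact: bij_inj (sol_sigma_bij rP x). Qed.

Let t_inj x : injective (tau r x).
Proof. exact: bij_inj (sol_tau_bij rP x). Qed.

Let rE x y : r (x, y) = (sigma r x y, tau r y x).
Proof. by rewrite /sigma /tau -surjective_pairing. Qed.

Let inv_s x y : sigma r (sigma r x y) (tau r y x) = x.
Proof. by rewrite /sigma /tau -surjective_pairing rK. Qed.

Let inv_t x y : tau r (tau r y x) (sigma r x y) = y.
Proof. by rewrite /sigma /tau -surjective_pairing rK. Qed.

Let ss x y z :
  sigma r x (sigma r y z) = sigma r (sigma r x y) (sigma r (tau r y x) z).
Proof.
have /(congr1 (fun t => t.1.1)) := sol_braid rP (x, y, z).
by rewrite /= => h; exact: esym h.
Qed.

Lemma sigma_tau y y' : sigma r y = sigma r y' -> tau r y = tau r y'.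
Proof.
have bs x := sol_sigma_bij rP x.
pose g x := projT1 (cid (let: Bijective h _ hK := bs x in ex_intro _ h hK)).
have gK x : cancel (g x) (sigma r x) by rewrite /g; case: cid.
have sK x : cancel (sigma r x) (g x) by move=> z; apply: (s_inj (x := x)); rewrite gK.
pose D x := g x x.
have tauE x w : tau r (g x w) x = g w x.
  by apply: (s_inj (x := w)); rewrite gK -{1}(gK x w) inv_s.
have D_inj : injective D.
  move=> u v Duv; apply: (t_inj (x := D u)).
  by rewrite {2}Duv /D !tauE.
have cyc x w v : g (g x w) (g x v) = g (g w x) (g w v).
  apply: (s_inj (x := g x w)); rewrite gK; apply: (s_inj (x := x)); rewrite gK.
  by rewrite ss gK tauE gK gK.
have DE z u : D (tau r z u) = g z (D u).
  have -> : z = g u (sigma r u z) by rewrite sK.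
  by rewrite tauE /D cyc.
move=> yy'; apply/funext => u; apply: D_inj; rewrite !DE.
by apply: (s_inj (x := y)); rewrite gK yy' gK.
Qed.

Lemma ret_mapE x y :
  ret_map (ret_class x, ret_class y) =
  (ret_class (sigma r x y), ret_class (tau r y x)).
Proof.
rewrite /ret_map /= sigma_repr (sigma_tau (sigma_repr y)).
set y' := repr _; set x' := repr _.
have sx : sigma r x' = sigma r x by exact: sigma_repr.
have sy : sigma r y' = sigma r y by exact: sigma_repr.
have e1 : sigma r (sigma r x y') = sigma r (sigma r x y).
  apply/funext => z; have [h _ hK] := sol_sigma_bij rP (tau r y x).
  by rewrite -(hK z) -{1}(sigma_tau sy) -!ss sy.
congr (_, _); apply/ret_classP => //; apply/funext => z.
apply: (s_inj (x := sigma r x y)); rewrite -ss -sx.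
have e2 : sigma r (sigma r x' y) = sigma r (sigma r x y) by rewrite sx.
by rewrite e2 -e2 -ss.
Qed.

Lemma ret_involutive : involutive ret_map.
Proof.
case=> a b; have [[x ->] [y ->]] := (ret_class_surj a, ret_class_surj b).
by rewrite !ret_mapE inv_s inv_t.
Qed.

Let ret_sigmaE x y :
  sigma ret_map (ret_class x) (ret_class y) = ret_class (sigma r x y).
Proof. by rewrite {1}/sigma ret_mapE. Qed.

Let ret_tauE x y :
  tau ret_map (ret_class x) (ret_class y) = ret_class (tau r x y).
Proof. by rewrite {1}/tau ret_mapE. Qed.

Lemma ret_solution : is_solution ret_map.
Proof.
split.
- by have [x] := sol_nonempty rP; exists; exact: (ret_class x).
- exact: (inv_bij ret_involutive).
- case=> [[a b] c]; have [[[x ->] [y ->]] [z ->]] :=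
    (ret_class_surj a, ret_class_surj b, ret_class_surj c).
  have := sol_braid rP (x, y, z); move: ret_map ret_mapE => m mE.
  rewrite /= /r_id /id_r /=; do ![rewrite !(mE, rE) /=].
  by case=> -> -> ->.
- move=> a; have [x ->] := ret_class_surj a.
  have [h hK Kh] := sol_sigma_bij rP x.
  have hE w w' : sigma r w = sigma r w' -> sigma r (h w) = sigma r (h w').
    move=> ww'; have tE : tau r (h w) x = tau r (h w') x.
      have e v : sigma r v (tau r (h v) x) = x by rewrite -{1}(Kh v) inv_s.
      by apply: (s_inj (x := w)); rewrite e ww' e.
    apply/funext => z; apply: (s_inj (x := x)).
    by rewrite ss [RHS]ss !Kh ww' tE.
  exists (fun c => ret_class (h (repr c))) => c;
    have [y ->] := ret_class_surj c.
  + rewrite ret_sigmaE -{2}(hK y); apply/ret_classP/hE; exact: sigma_repr.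
  + by rewrite ret_sigmaE Kh /ret_class reprK.
- move=> a; have [y ->] := ret_class_surj a.
  have [h hK Kh] := sol_tau_bij rP y.
  have hE w w' : sigma r w = sigma r w' -> sigma r (h w) = sigma r (h w').
    move=> ww'; have sE : sigma r (h w) y = sigma r (h w') y.
      have e v : tau r v (sigma r (h v) y) = y by rewrite -{1}(Kh v) inv_t.
      by apply: (t_inj (x := w)); rewrite e (sigma_tau ww') e.
    apply/funext => z; have [k _ kK] := sol_sigma_bij rP y.
    by rewrite -(kK z) ss [RHS]ss !Kh ww' sE.
  exists (fun c => ret_class (h (repr c))) => c;
    have [x ->] := ret_class_surj c.
  + rewrite ret_tauE -{2}(hK x); apply/ret_classP/hE; exact: sigma_repr.
  + by rewrite ret_tauE Kh /ret_class reprK.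
Qed.

End Retraction.

(* [Ret] changes the underlying set, so it is iterated on pairs (X, r). *)
Record ybmap := YbMap {
  yb_set : choiceType;
  yb_map : yb_set * yb_set -> yb_set * yb_set }.

Definition Ret (S : ybmap) : ybmap := YbMap (@ret_map _ (@yb_map S)).

Definition multipermutation (X : choiceType) (r : X * X -> X * X) : Prop :=
  exists2 n, 0 < n &
    exists c : yb_set (iter n Ret (YbMap r)), forall d, d = c.

Local Open Scope nat_scope.

(* A row (A, s, t) says that sigma_x = s and tau_x = t for every x in A, where
   s and t are products of disjoint cycles, [:: a; b; c] being a |-> b |-> c. *)
Definition cycle_row : Type := seq nat * seq (seq nat) * seq (seq nat).

Definition cycle_perm (cs : seq (seq nat)) (a : nat) : nat :=
  foldr (fun c => next c) a cs.

Definition row_of (t : seq cycle_row) (x : nat) : cycle_row :=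
  nth ([::], [::], [::]) t (find (fun row : cycle_row => x \in row.1.1) t).

Definition nat_sigma (t : seq cycle_row) (x y : nat) := cycle_perm (row_of t x).1.2 y.
Definition nat_tau (t : seq cycle_row) (y x : nat) := cycle_perm (row_of t y).2 x.

(* {1, ..., 8} is encoded as 'I_8, with i : 'I_8 standing for i.+1. *)
Definition table_map (t : seq cycle_row) (p : 'I_8 * 'I_8) : 'I_8 * 'I_8 :=
  (inord (nat_sigma t p.1.+1 p.2.+1).-1, inord (nat_tau t p.2.+1 p.1.+1).-1).

Definition S1_table : seq cycle_row :=
 [:: ([:: 1; 2], [:: [:: 3; 7; 4; 5]],
    [:: [:: 3; 6; 4; 8]]);
     ([:: 3; 4], [:: [:: 1; 8; 2; 6]],
    [:: [:: 1; 5; 2; 7]]);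
     ([:: 5; 7], [:: [:: 1; 3; 8; 7; 2; 4; 6; 5]],
    [:: [:: 1; 6; 5; 4; 2; 8; 7; 3]]);
     ([:: 6; 8], [:: [:: 1; 7; 8; 4; 2; 5; 6; 3]],
    [:: [:: 1; 3; 5; 6; 2; 4; 7; 8]])].

Definition S2_table : seq cycle_row :=
 [:: ([:: 1; 2], [:: [:: 3; 7; 4; 5]; [:: 6; 8]],
    [:: [:: 3; 6; 4; 8]; [:: 5; 7]]);
     ([:: 3; 4], [:: [:: 1; 8; 2; 6]; [:: 5; 7]],
    [:: [:: 1; 5; 2; 7]; [:: 6; 8]]);
     ([:: 5; 7], [:: [:: 1; 4; 6; 5]; [:: 2; 3; 8; 7]],
    [:: [:: 1; 6; 5; 4]; [:: 2; 8; 7; 3]]);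
     ([:: 6; 8], [:: [:: 1; 7; 8; 4]; [:: 2; 5; 6; 3]],
    [:: [:: 1; 4; 7; 8]; [:: 2; 3; 5; 6]])].

Definition S3_table : seq cycle_row :=
 [:: ([:: 1; 2], [:: [:: 1; 2]; [:: 4; 6; 7; 5]],
    [:: [:: 1; 2]; [:: 3; 6; 8; 5]]);
     ([:: 3; 8], [:: [:: 1; 4; 3; 5]; [:: 2; 7; 8; 6]],
    [:: [:: 1; 5; 7; 8]; [:: 2; 6; 4; 3]]);
     ([:: 4; 7], [:: [:: 1; 5; 8; 7]; [:: 2; 6; 3; 4]],
    [:: [:: 1; 3; 4; 5]; [:: 2; 8; 7; 6]]);
     ([:: 5; 6], [:: [:: 1; 8; 2; 3]; [:: 5; 6]],
    [:: [:: 1; 7; 2; 4]; [:: 5; 6]])].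

Definition S4_table : seq cycle_row :=
 [:: ([:: 1; 2], [:: [:: 1; 2]; [:: 3; 5]; [:: 4; 8; 6; 7]],
    [:: [:: 1; 2]; [:: 3; 8; 5; 7]; [:: 4; 6]]);
     ([:: 3; 5], [:: [:: 1; 6; 5; 8; 2; 4; 3; 7]],
    [:: [:: 1; 7; 6; 5; 2; 8; 4; 3]]);
     ([:: 4; 6], [:: [:: 1; 7; 5; 6; 2; 8; 3; 4]],
    [:: [:: 1; 5; 6; 8; 2; 3; 4; 7]]);
     ([:: 7; 8], [:: [:: 1; 3; 2; 5]; [:: 4; 6]; [:: 7; 8]],
    [:: [:: 1; 4; 2; 6]; [:: 3; 5]; [:: 7; 8]])].

Definition S5_table : seq cycle_row :=
 [:: ([:: 1; 7], [:: [:: 1; 2]; [:: 7; 8]],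
    [:: [:: 1; 4]; [:: 6; 7]]);
     ([:: 2; 8], [:: [:: 1; 5; 8; 4]; [:: 2; 6; 7; 3]],
    [:: [:: 1; 2; 6; 5]; [:: 3; 7; 8; 4]]);
     ([:: 3; 5], [:: [:: 3; 4]; [:: 5; 6]],
    [:: [:: 2; 3]; [:: 5; 8]]);
     ([:: 4; 6], [:: [:: 1; 4; 8; 5]; [:: 2; 3; 7; 6]],
    [:: [:: 1; 5; 6; 2]; [:: 3; 4; 8; 7]])].

Definition S6_table : seq cycle_row :=
 [:: ([:: 1; 7], [:: [:: 1; 2]; [:: 3; 5]; [:: 4; 6]; [:: 7; 8]],
    [:: [:: 1; 4]; [:: 2; 8]; [:: 3; 5]; [:: 6; 7]]);
     ([:: 2; 8], [:: [:: 1; 3; 2; 4]; [:: 5; 8; 6; 7]],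
    [:: [:: 1; 2; 4; 3]; [:: 5; 7; 8; 6]]);
     ([:: 3; 5], [:: [:: 1; 7]; [:: 2; 8]; [:: 3; 4]; [:: 5; 6]],
    [:: [:: 1; 7]; [:: 2; 3]; [:: 4; 6]; [:: 5; 8]]);
     ([:: 4; 6], [:: [:: 1; 4; 2; 3]; [:: 5; 7; 6; 8]],
    [:: [:: 1; 3; 4; 2]; [:: 5; 6; 8; 7]])].

Definition S7_table : seq cycle_row :=
 [:: ([:: 1; 7], [:: [:: 1; 3; 6; 8; 7; 5; 4; 2]],
    [:: [:: 1; 3; 8; 6; 7; 5; 2; 4]]);
     ([:: 2; 8], [:: [:: 1; 7]; [:: 2; 5; 8; 3]; [:: 4; 6]],
    [:: [:: 1; 2; 7; 8]; [:: 3; 5]; [:: 4; 6]]);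
     ([:: 3; 5], [:: [:: 1; 8; 6; 5; 7; 2; 4; 3]],
    [:: [:: 1; 6; 8; 5; 7; 4; 2; 3]]);
     ([:: 4; 6], [:: [:: 1; 4; 7; 6]; [:: 2; 8]; [:: 3; 5]],
    [:: [:: 1; 7]; [:: 2; 8]; [:: 3; 4; 5; 6]])].

Definition S8_table : seq cycle_row :=
 [:: ([:: 1; 5], [:: [:: 1; 6; 5; 2]],
    [:: [:: 1; 8; 5; 4]]);
     ([:: 2; 6], [:: [:: 1; 7; 6; 4; 5; 3; 2; 8]],
    [:: [:: 1; 2; 8; 3; 5; 6; 4; 7]]);
     ([:: 3; 7], [:: [:: 3; 8; 7; 4]],
    [:: [:: 2; 3; 6; 7]]);
     ([:: 4; 8], [:: [:: 1; 4; 6; 3; 5; 8; 2; 7]],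
    [:: [:: 1; 7; 8; 2; 5; 3; 4; 6]])].

Definition exceptional_tables : seq (seq cycle_row) :=
  [:: S1_table; S2_table; S3_table; S4_table;
      S5_table; S6_table; S7_table; S8_table].

(* Main.v *)
Require Import Defs.
From HB Require Import structures.
From mathcomp Require Import all_boot all_order all_algebra all_fingroup all_solvable.
From mathcomp Require Import boolp ring.
Set Implicit Arguments.
Unset Strict Implicit.
Unset Printing Implicit Defensive.
Import Order.TTheory GRing.Theory Num.Theory.

(** The structure group of an involutive solution on [X] is the set of integer
    vectors indexed by [X], with the product [v + vact (rho v) w] for a map
    [rho] to permutations that is multiplicative for this product. It is
    torsion-free, so a copy of the Promislow group is the same as a nontrivial
    pair of vectors satisfying its relations ([structure_group_promislow]).

    Multiplying vectors by an integer [k] embeds the group of the cabled map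
    [v |-> rho (v *~ k)], so Promislow pairs may be looked for in cablings; they
    also pass along injective morphisms. A solution that is not a
    multipermutation solution maps onto an irretractable one with at least two
    points. Let [p] be an odd prime dividing the class of the latter. For a
    suitable [k], cabling kills the [p]-part of its permutation group, and the
    retraction of the result is again irretractable with at least two points
    ([cabled_retract_irretractable], [cabled_retract_nontrivial]); this uses
    that there are at most eight points. After finitely many steps only a
    2-power class is left ([reduction_exists]).

    The permutation group is then a 2-group, so by Sylow's theorem its rows
    respect blocks of sizes 2 and 4. An exhaustive search over such tables
    finds a Promislow pair on eight points, or one of two cycle sets on four
    points, each of which has a Promislow pair ([small_irretractable]). The
    fibres over four such points have the same size. If they are points, the
    four-point cycle set embeds in the cabling of [X]. Otherwise [X] has eight
    points and its table is one of finitely many coverings, each of which has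
    a Promislow pair or is exceptional ([double_cover]). In the last case
    cabling changes nothing, since the permutations by which it could differ
    would form a group of odd order that the exceptional tables do not admit
    ([exceptional_uncable]); so [X] itself is exceptional.

    Conversely, the permutation of a vector of an exceptional solution depends
    on a few linear functionals modulo 4. For each pair of possible
    permutations the Promislow relations become linear equations in the
    coordinates, and a combination of these modulo 8 contradicts the values of
    the functionals, unless both permutations are trivial and the pair is 0
    ([no_promislow]). *)

(** * Integer vectors twisted by permutations *)

Local Open Scope ring_scope.

Definition vec (X : finType) := {ffun X -> int}.

Definition unitv (X : finType) (x : X) : vec X := [ffun y => (y == x)%:Z].

(** Permutations act on the indices, so that [vact (g * h)] is [vact g] after [vact h]. *)
Definition vact (X : finType) (g : {perm X}) (v : vec X) : vec X :=
  [ffun y => v (g y)].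

Section Action.
Variable X : finType.
Implicit Types (v w : vec X) (g h : {perm X}).

Lemma vact0 g : vact g 0 = 0 :> vec X.
Proof. by apply/ffunP=> y; rewrite !ffunE. Qed.

Lemma vactD g v w : vact g (v + w) = vact g v + vact g w.
Proof. by apply/ffunP=> y; rewrite !ffunE. Qed.

Lemma vactN g v : vact g (- v) = - vact g v.
Proof. by apply/ffunP=> y; rewrite !ffunE. Qed.

Lemma vactB g v w : vact g (v - w) = vact g v - vact g w.
Proof. by rewrite vactD vactN. Qed.

Lemma vact_mulz g v k : vact g (v *~ k) = vact g v *~ k.
Proof. by apply/ffunP=> y; rewrite !(ffunMzE, ffunE). Qed.

Lemma vact1 v : vact 1 v = v.
Proof. by apply/ffunP=> y; rewrite ffunE perm1. Qed.

Lemma vactM g h v : vact (g * h)%g v = vact g (vact h v).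
Proof. by apply/ffunP=> y; rewrite !ffunE permM. Qed.

Lemma vact_unitv g x : vact g (unitv x) = unitv (g^-1%g x).
Proof. by apply/ffunP=> y; rewrite !ffunE (canF_eq (permK g)). Qed.

Lemma vact_unitv_perm g x : vact g (unitv (g x)) = unitv x.
Proof. by rewrite vact_unitv permK. Qed.

Lemma unitvE (x y : X) : unitv x y = (y == x)%:Z.
Proof. by rewrite ffunE. Qed.

Lemma vec_sum v : v = \sum_x unitv x *~ v x.
Proof.
apply/ffunP=> y; rewrite sum_ffunE (bigD1 y) //= ffunMzE unitvE eqxx.
rewrite big1 ?addr0 ?intz // => x xy.
by rewrite ffunMzE unitvE eq_sym (negbTE xy) mul0rz.
Qed.

(** The step is an equivalence because coordinates may have to decrease. *)
Lemma vec_ind (P : vec X -> Prop) :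
  P 0 -> (forall v x, P v <-> P (v + unitv x)) -> forall v, P v.
Proof.
move=> P0 PS v.
have Pn x n w : P w <-> P (w + unitv x *+ n).
  elim: n => [|n IHn]; first by rewrite mulr0n addr0.
  by rewrite IHn (PS _ x) -addrA -mulrSr.
have Pk x k w : P w <-> P (w + unitv x *~ k).
  case: (intP k) => [|n|n]; first by rewrite mulr0z addr0.
    by rewrite -pmulrn.
  by rewrite mulrNz -pmulrn (Pn x n.+1 (w - _)) subrK.
rewrite (vec_sum v); apply: big_rec => // x w _ Pw.
by rewrite addrC -Pk.
Qed.

End Action.

(** The group of integer vectors twisted by a map [rho] to permutations; it is
    the multiplicative group of a left brace with additive group [vec X]. *)
Definition vmul (X : finType) (rho : vec X -> {perm X}) (v w : vec X) : vec X :=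
  v + vact (rho v) w.

Definition vinv (X : finType) (rho : vec X -> {perm X}) (v : vec X) : vec X :=
  - vact (rho v)^-1 v.

(** Together with [vmul] this makes [vec X] a left brace whose lambda map is
    given by permutations of the basis. *)
Definition brace_map (X : finType) (rho : vec X -> {perm X}) : Prop :=
  forall v w, rho (vmul rho v w) = (rho v * rho w)%g.

(** The identity satisfied by the inverses [p x] of the permutations [sigma x]
    of an involutive solution. *)
Definition cycle_set (X : finType) (p : X -> {perm X}) : Prop :=
  forall x y, (p x * p (p x y))%g = (p y * p (p y x))%g.

Section BraceMap.
Variables (X : finType) (rho : vec X -> {perm X}).
Hypothesis rhoM : brace_map rho.
Implicit Types v w u : vec X.

Lemma vmulA v w u : vmul rho (vmul rho v w) u = vmul rho v (vmul rho w u).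
Proof. by rewrite {1}/vmul rhoM vactM /vmul vactD addrA. Qed.

Lemma vmul0r v : vmul rho v 0 = v.
Proof. by rewrite /vmul vact0 addr0. Qed.

Lemma rho0 : rho 0 = 1%g.
Proof. by have := rhoM 0 0; rewrite vmul0r -{1}(mulg1 (rho 0)) => /mulgI. Qed.

Lemma vmulV v : vmul rho v (vinv rho v) = 0.
Proof. by rewrite /vmul /vinv vactN -vactM mulgV vact1 subrr. Qed.

Lemma rhoV v : rho (vinv rho v) = (rho v)^-1%g.
Proof. by apply/(mulgI (rho v)); rewrite -rhoM vmulV rho0 mulgV. Qed.

(** The conjugate of a kernel element [w] by [v] is the permuted vector
    [vact (rho v) w]: the kernel is an ideal of the brace. *)
Lemma rho_conj v w : rho w = 1%g -> rho (vact (rho v) w) = 1%g.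
Proof.
move=> w1; have -> : vact (rho v) w = vmul rho (vmul rho v w) (vinv rho v).
  rewrite {1}/vmul rhoM w1 mulg1 /vmul /vinv vactN -vactM mulgV vact1.
  by rewrite addrAC subrr add0r.
by rewrite !rhoM w1 mulg1 rhoV mulgV.
Qed.

Lemma rho_conjV v w : rho w = 1%g -> rho (vact (rho v)^-1%g w) = 1%g.
Proof. by rewrite -rhoV; exact: rho_conj. Qed.

Lemma rhoDl v w : rho v = 1%g -> rho (v + w) = rho w.
Proof. by move=> v1; have := rhoM v w; rewrite /vmul v1 vact1 mul1g. Qed.

Lemma rhoN v : rho v = 1%g -> rho (- v) = 1%g.
Proof. by move=> v1; rewrite -(rhoDl (- v) v1) subrr rho0. Qed.

(** Kernel elements act trivially, so left cosets of the kernel for [vmul] are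
    additive cosets. *)
Lemma rho_eq v w : rho v = rho w <-> rho (v - w) = 1%g.
Proof.
split=> [vw|vw1]; last by rewrite -(subrK w v) rhoDl.
have /mulgI w1 : (rho v * rho (vact (rho v)^-1%g (w - v)) = rho v * 1)%g.
  by rewrite -rhoM /vmul -vactM mulgV vact1 addrC subrK mulg1.
have := rho_conj v w1; rewrite -vactM mulgV vact1 => /rhoN.
by rewrite opprB.
Qed.

Lemma rho_mulz v k : rho v = 1%g -> rho (v *~ k) = 1%g.
Proof.
move=> v1; have vn n : rho (v *+ n) = 1%g.
  by elim: n => [|n IHn]; rewrite ?mulr0n ?rho0 // mulrS rhoDl.
case: (intP k) => [|n|n]; first by rewrite mulr0z rho0.
  by rewrite -pmulrn.
by rewrite mulrNz -pmulrn rhoN.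
Qed.

Lemma rho_sum (I : Type) (s : seq I) (F : I -> vec X) :
  (forall i, rho (F i) = 1%g) -> rho (\sum_(i <- s) F i) = 1%g.
Proof.
move=> F1; apply: (big_rec (fun v => rho v = 1%g)) => [|i v _ v1]; first exact: rho0.
by rewrite rhoDl.
Qed.

Lemma rho_unitvD v x : rho (v + unitv x) = (rho v * rho (unitv (rho v x)))%g.
Proof. by rewrite -rhoM /vmul vact_unitv_perm. Qed.

Lemma rows_cycle_set : cycle_set (fun x => rho (unitv x)).
Proof. by move=> x y; rewrite -!rho_unitvD addrC. Qed.

End BraceMap.

Local Close Scope ring_scope.

(** * Words and the brace of a cycle set *)

Local Open Scope ring_scope.

Section Words.
Variables (X : finType) (p : X -> {perm X}).
Hypothesis pP : cycle_set p.

(** The semidirect product of vectors and permutations, in which a letter [x]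
    takes the value [(unitv x, p x)]. *)
Definition sdmul (a b : vec X * {perm X}) : vec X * {perm X} :=
  (a.1 + vact a.2 b.1, (a.2 * b.2)%g).

Definition evl (a : X * bool) : vec X * {perm X} :=
  if a.2 then (- unitv (p a.1 a.1), (p a.1)^-1%g) else (unitv a.1, p a.1).

Definition ev (u : word X) : vec X * {perm X} :=
  foldr (fun a s => sdmul (evl a) s) (0, 1%g) u.

Lemma sdmulA a b c : sdmul a (sdmul b c) = sdmul (sdmul a b) c.
Proof. by rewrite /sdmul /= vactD vactM addrA mulgA. Qed.

Lemma ev_cat u v : ev (u ++ v) = sdmul (ev u) (ev v).
Proof.
elim: u => [|a u IHu] /=; last by rewrite IHu sdmulA.
by rewrite /sdmul /= vact1 add0r mul1g -surjective_pairing.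
Qed.

Lemma evl_inv a : sdmul (evl a) (evl (inv_letter a)) = (0, 1%g).
Proof.
case: a => x [] /=; rewrite /sdmul /evl /= ?mulgV ?mulVg.
  by rewrite vact_unitv invgK addNr.
by rewrite vactN vact_unitv_perm subrr.
Qed.

Definition pos (s : seq X) : word X := [seq (x, false) | x <- s].

(** A positive word [x1 x2 x3] is coded by the letters [x1], [p x1 ^-1 x2], and so
    on: each letter is pulled back through the permutations of the earlier
    ones. Here the word is recovered from its code; [roll] computes the code.
    The vector of the word counts the letters of the code. *)
Fixpoint unroll n (s : seq X) : seq X :=
  if n is n'.+1 then
    if s is y :: s' then y :: unroll n' (map (p y) s') else [::]
  else [::].

Fixpoint roll (w : seq X) : seq X :=
  if w is x :: w' then x :: map (p x)^-1%g (roll w') else [::].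

Lemma size_roll w : size (roll w) = size w.
Proof. by elim: w => //= x w IHw; rewrite size_map IHw. Qed.

Lemma rollK w : unroll (size w) (roll w) = w.
Proof.
elim: w => //= x w IHw; rewrite -map_comp (eq_map (permKV (p x))) map_id.
by rewrite IHw.
Qed.

Lemma unrollK n s : size s = n -> roll (unroll n s) = s.
Proof.
elim: n s => [|n IHn] [|y s] //= [sn]; rewrite IHn ?size_map //.
by rewrite -map_comp (eq_map (permK (p y))) map_id.
Qed.

Lemma ev_pos w y : (ev (pos w)).1 y = (count_mem y (roll w))%:Z.
Proof.
elim: w y => [|x w IHw] y /=; first by rewrite ffunE.
rewrite /evl /= !ffunE IHw PoszD; congr (_ + _); first by rewrite eq_sym.
rewrite count_map; congr Posz; apply: eq_count => z /=.
by rewrite (canF_eq (permKV (p x))).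
Qed.

Variable R : word X -> word X -> Prop.
Hypothesis R_swap : forall x y, word_cong R (pos [:: x; p x y]) (pos [:: y; p y x]).
Hypothesis R_ev : forall u v, R u v -> ev u = ev v.

Lemma ev_cong u v : word_cong R u v -> ev u = ev v.
Proof.
elim=> [//|??? -> //|????-> ? -> //|????? IHu ? IHv||].
- by rewrite !ev_cat IHu IHv.
- by move=> a; rewrite -[[:: a; _]]/([:: a] ++ [:: inv_letter a]) ev_cat /=;
  rewrite /sdmul /= !vact0 !addr0 !mulg1 -/(sdmul _ _) evl_inv.
- exact: R_ev.
Qed.

Lemma cong_catl u v v' : word_cong R v v' -> word_cong R (u ++ v) (u ++ v').
Proof. by apply: WCcat; exact: WCrefl. Qed.

Lemma cong_catr u v v' : word_cong R v v' -> word_cong R (v ++ u) (v' ++ u).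
Proof. by move/WCcat; apply; exact: WCrefl. Qed.

Lemma cong_cons a v v' : word_cong R v v' -> word_cong R (a :: v) (a :: v').
Proof. exact: (@cong_catl [:: a]). Qed.

(** Exchanging the first two letters of a code is exactly one defining
    relation, so permuting a code does not change the class of the word. *)
Lemma unroll_perm n s s' : perm_eq s s' -> size s = n ->
  word_cong R (pos (unroll n s)) (pos (unroll n s')).
Proof.
elim: n s s' => [|n IHn] s s' ss' sn; first by exact: WCrefl.
have sn' : size s' = n.+1 by rewrite -(perm_size ss').
case: s ss' sn => // y t ss' [tn]; case: s' ss' sn' => // z t' ss' [tn'].
have [yz|yz] := eqVneq y z.
  rewrite -yz /=; apply/cong_cons/IHn; last by rewrite size_map.
  by apply: perm_map; move: ss'; rewrite -yz perm_cons.
have zt : z \in t.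
  by have := perm_mem ss' z; rewrite !inE eqxx eq_sym (negbTE yz).
pose u := rem z t.
have tu : perm_eq t (z :: u) by exact: perm_to_rem.
have tu' : perm_eq t' (y :: u).
  rewrite -(perm_cons z) perm_sym; apply: perm_trans ss'; rewrite perm_sym.
  apply: (@perm_trans _ (y :: z :: u)); first by rewrite perm_cons.
  by rewrite -[y :: z :: u]/([:: y] ++ [:: z] ++ u)
             -[z :: y :: u]/([:: z] ++ [:: y] ++ u) perm_catCA.
apply: (@WCtrans _ _ _ (pos (unroll n.+1 [:: y, z & u]))).
  by apply/cong_cons/IHn; rewrite ?size_map // perm_map.
apply: (@WCtrans _ _ _ (pos (unroll n.+1 [:: z, y & u]))); last first.
  apply/cong_cons/IHn; last by rewrite size_map -(perm_size tu').
  by rewrite perm_map // perm_sym.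
have n0 : (0 < n)%N by rewrite -tn; case: (t) zt.
rewrite -(prednK n0) /=.
have -> : [seq p (p y z) i | i <- [seq p y i | i <- u]] =
          [seq p (p z y) i | i <- [seq p z i | i <- u]].
  rewrite -!map_comp; apply: eq_map => i /=; rewrite -!permM; congr (fun_of_perm _ i); exact: pP.
exact: (@cong_catr _ (pos [:: y; p y z]) (pos [:: z; p z y])).
Qed.

Lemma pos_cong w w' :
  (ev (pos w)).1 = (ev (pos w')).1 -> word_cong R (pos w) (pos w').
Proof.
move=> ww'; have pw : perm_eq (roll w) (roll w').
  apply/allP => y _ /=; apply/eqP.
  by have /ffunP/(_ y) := ww'; rewrite !ev_pos => -[].
rewrite -(rollK w) -(rollK w') -(size_roll w') -(perm_size pw) size_roll.
by apply: unroll_perm => //; rewrite size_roll.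
Qed.

Definition word_of_seq (s : seq X) := unroll (size s) s.

Lemma ev_word_of_seq s y : (ev (pos (word_of_seq s))).1 y = (count_mem y s)%:Z.
Proof. by rewrite ev_pos unrollK. Qed.

(** A positive word with constant vector and trivial permutation: it is
    central, and every letter divides it. *)
Definition garside : seq X :=
  let w := word_of_seq (enum X) in flatten (nseq #[(ev (pos w)).2]%g w).

Lemma pos_cat w w' : pos (w ++ w') = pos w ++ pos w'.
Proof. exact: map_cat. Qed.

Lemma ev_garside_pow k : exists2 m : nat, (k <= m)%N &
  ev (pos (flatten (nseq k garside))) = ([ffun=> m%:Z], 1%g).
Proof.
pose w := word_of_seq (enum X); set o := #[(ev (pos w)).2]%g.
have wE : ev (pos w) = ([ffun=> 1], (ev (pos w)).2).
  rewrite [LHS]surjective_pairing; congr (_, _); apply/ffunP => y.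
  by rewrite ev_word_of_seq count_uniq_mem ?enum_uniq // mem_enum ffunE.
have wk n : ev (pos (flatten (nseq n w))) = ([ffun=> n%:Z], (ev (pos w)).2 ^+ n)%g.
  elim: n => [|n IHn] /=.
    by congr (_, _); apply/ffunP => y; rewrite !ffunE.
  rewrite pos_cat ev_cat IHn wE /sdmul /= expgS; congr (_, _).
  by apply/ffunP => y; rewrite !ffunE intS.
have gE : ev (pos garside) = ([ffun=> o%:Z], 1%g).
  by rewrite /garside -/w wk expg_order.
have o0 : (0 < o)%N by exact: order_gt0.
elim: k => [|k [m km IHk]].
  by exists 0%N => //=; congr (_, _); apply/ffunP => y; rewrite !ffunE.
exists (o + m)%N; first by rewrite -add1n leq_add.
rewrite /= pos_cat ev_cat IHk gE /sdmul /= mul1g vact1; congr (_, _).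
by apply/ffunP => y; rewrite !ffunE PoszD.
Qed.

Lemma garside_central w :
  word_cong R (pos (garside ++ w)) (pos (w ++ garside)).
Proof.
have [m _] := ev_garside_pow 1; rewrite /= cats0 => gE.
apply: pos_cong; rewrite !pos_cat !ev_cat gE /sdmul /= vact1 addrC.
by congr (_ + _); apply/ffunP => y; rewrite !ffunE.
Qed.

Lemma garside_letter x : exists t,
  word_cong R (pos garside) (pos (x :: t)).
Proof.
have [m m1] := ev_garside_pow 1; rewrite /= cats0 => gE.
have xg : x \in roll garside.
  rewrite -has_pred1 has_count; have := ev_pos garside x.
  by rewrite gE ffunE => -[<-].
exists (unroll (size garside).-1 (map (p x) (rem x (roll garside)))).
have g0 : (0 < size garside)%N by rewrite -size_roll; case: (roll _) xg.
have := unroll_perm (perm_to_rem xg) (size_roll garside).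
by rewrite rollK -(prednK g0).
Qed.

(** As every letter divides the central word [garside], an inverse letter can
    be cleared at the cost of one more factor [garside]. *)
Lemma word_fraction u : exists w k,
  word_cong R (u ++ pos (flatten (nseq k garside))) (pos w).
Proof.
elim: u => [|[x []] u [w [k uw]]]; first by exists [::], 0%N; exact: WCrefl.
- have [t gt] := garside_letter x; exists (t ++ w), k.+1.
  have -> : flatten (nseq k.+1 garside) = flatten (nseq k garside) ++ garside.
    by elim: (k) => [|n IHn] /=; rewrite ?cats0 // -catA -IHn.
  rewrite pos_cat /= catA.
  apply: (@WCtrans _ _ _ ((x, true) :: pos (w ++ garside))).
    by rewrite pos_cat; apply/cong_cons/cong_catr.
  apply: (@WCtrans _ _ _ ((x, true) :: pos (garside ++ w))).
    by apply/cong_cons/WCsym/garside_central.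
  rewrite pos_cat; apply: (@WCtrans _ _ _ ((x, true) :: pos (x :: t) ++ pos w)).
    exact/cong_cons/cong_catr.
  rewrite pos_cat; exact: (@cong_catr _ [:: (x, true); inv_letter (x, true)] [::] (WCcancel _ _)).
- by exists (x :: w), k; exact: cong_cons.
Qed.

(** Clearing denominators reduces this to positive words, where vectors are
    multisets of code letters. *)
Lemma vec_faithful u : (ev u).1 = 0 -> word_cong R u [::].
Proof.
move=> u0; have [w [k uw]] := word_fraction u.
set g := pos (flatten (nseq k garside)) in uw.
have ug : word_cong R (u ++ g) g.
  apply: (WCtrans uw); apply: pos_cong; rewrite -(ev_cong uw) ev_cat /= u0 add0r.
  have [m _ ->] := ev_garside_pow k.
  by apply/ffunP => y; rewrite !ffunE.
have gV : word_cong R (g ++ inv_word g) [::].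
  by rewrite -{1}(inv_wordK g); exact: word_cong_invV.
apply: WCtrans (WCtrans (cong_catr (inv_word g) ug) gV).
by rewrite -catA -{1}(cats0 u); apply/cong_catl/WCsym.
Qed.

Lemma vec_cong u v : (ev u).1 = (ev v).1 -> word_cong R u v.
Proof.
move=> uv; have vu : word_cong R (inv_word v ++ u) [::].
  apply: vec_faithful; rewrite ev_cat /= uv.
  by have /ev_cong := word_cong_invV R v; rewrite ev_cat => /(congr1 fst).
have vV : word_cong R (v ++ inv_word v) [::].
  by rewrite -{1}(inv_wordK v); exact: word_cong_invV.
apply: WCtrans (WCtrans (cong_catl v vu) _).
  by rewrite catA -{1}(cat0s u); apply/cong_catr/WCsym.
by rewrite cats0; exact: WCrefl.
Qed.

Lemma vec_word (v : vec X) : exists u, (ev u).1 = v.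
Proof.
pose k := (\sum_x absz (v x))%N; have [m km gE] := ev_garside_pow k.
pose n x := absz (v x + m%:Z).
have nE x : (n x)%:Z = v x + m%:Z.
  rewrite gez0_abs // -lerBlDr sub0r lerNl; apply: le_trans (_ : k%:Z <= _) => //.
  apply: le_trans (_ : `|v x|%:Z <= _); first by rewrite abszE -normrN; exact: ler_norm.
  by rewrite lez_nat /k (bigD1 x) //= leq_addr.
pose s := flatten [seq nseq (n x) x | x <- enum X].
exists (pos (word_of_seq s) ++ inv_word (pos (flatten (nseq k garside)))).
have /ev_cong := word_cong_invV R (inv_word (pos (flatten (nseq k garside)))).
rewrite inv_wordK !ev_cat gE /sdmul /= vact1 => -[/(canRL (addKr _)) -> _].
apply/ffunP => y; rewrite !ffunE ev_word_of_seq addr0.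
have -> : count_mem y s = n y.
  rewrite /s count_flatten -map_comp sumnE big_map big_enum /=.
  rewrite (bigD1 y) //= count_nseq /= eqxx mul1n big1 ?addn0 // => x xy.
  by rewrite count_nseq /= (negbTE xy).
by rewrite nE addrK.
Qed.

End Words.

Definition swap_rel (X : finType) (p : X -> {perm X}) (u v : word X) : Prop :=
  exists x y, u = pos [:: x; p x y] /\ v = pos [:: y; p y x].

Lemma ev_swap (X : finType) (p : X -> {perm X}) u v :
  cycle_set p -> swap_rel p u v -> ev p u = ev p v.
Proof.
move=> pP [x [y [-> ->]]]; rewrite /= /sdmul /= !vact0 !addr0 !mulg1 pP.
by rewrite !vact_unitv_perm addrC.
Qed.

(** The permutation of a word is a function of its vector, because words with
    the same vector represent the same element of the structure group. *)
Lemma cycle_set_brace (X : finType) (p : X -> {perm X}) :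
  cycle_set p -> exists2 rho, brace_map rho & forall u, rho (ev p u).1 = (ev p u).2.
Proof.
move=> pP; pose R := swap_rel p.
have R_swap x y : word_cong R (pos [:: x; p x y]) (pos [:: y; p y x]).
  by apply: WCrel; exists x, y.
have R_ev u v : R u v -> ev p u = ev p v by exact: ev_swap.
pose w v := projT1 (cid (vec_word R_ev v)).
have wE v : (ev p (w v)).1 = v by rewrite /w; case: cid.
pose rho v := (ev p (w v)).2.
have rhoE u : rho (ev p u).1 = (ev p u).2.
  by rewrite /rho (ev_cong R_ev (vec_cong pP R_swap R_ev (wE _))).
exists rho => // v v'; rewrite -[RHS]/((sdmul (ev p (w v)) (ev p (w v'))).2) -ev_cat.
by rewrite -rhoE ev_cat /= !wE.
Qed.

Local Close Scope ring_scope.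

(** * The normal form of the Promislow group *)

Local Open Scope group_scope.

Definition torsion_free (G : groupType) : Prop :=
  forall (g : G) n, g ^+ n.+1 = 1 -> g = 1.

(** The defining relations of the Promislow group, cleared of inverses. *)
Definition promislow_pair (G : groupType) (x y : G) : Prop :=
  y * y * x * y * y = x /\ x * x * y * x * x = y.

(** Membership in the cyclic subgroup of [a], with an integer exponent written
    as a difference. *)
Definition in_cycle (G : groupType) (a g : G) : Prop :=
  exists k l, g = a ^+ k * a ^- l.

Section InCycle.
Variable G : groupType.
Implicit Types a b g h x : G.

Lemma in_cycle1 a : in_cycle a 1.
Proof. by exists 0%N, 0%N; rewrite !expg0 mulgV. Qed.

Lemma commute_in_cycle a g x : commute x a -> in_cycle a g -> commute x g.
Proof.
move=> xa [k [l ->]].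
by apply: commuteM; [|apply: commuteV]; apply: commuteX.
Qed.

Lemma in_cycleM a g h : in_cycle a g -> in_cycle a h -> in_cycle a (g * h).
Proof.
move=> [k [l ->]] [k' [l' ->]]; exists (k + k')%N, (l + l')%N.
have c : commute (a ^- l) (a ^+ k').
  by apply/commute_sym/commuteV/commuteX2.
by rewrite -mulgA (mulgA (a ^- l)) c -!mulgA -invgM -expgnDr mulgA -expgnDr addnC (addnC l').
Qed.

Lemma in_cycleV a g : in_cycle a g -> in_cycle a g^-1.
Proof. by move=> [k [l ->]]; exists l, k; rewrite invgM invgK. Qed.

Lemma in_cycle_id a : in_cycle a a.
Proof. by exists 1%N, 0%N; rewrite expg0 invg1 mulg1 expg1. Qed.

Lemma in_cycle_inv a g x : x * a = a^-1 * x -> in_cycle a g -> x * g = g^-1 * x.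
Proof.
move=> xa [k [l ->]]; have xX n : x * a ^+ n = a ^- n * x.
  elim: n => [|n IHn]; first by rewrite expg0 invg1 mulg1 mul1g.
  by rewrite {1}expgS mulgA xa -mulgA IHn mulgA -invgM -expgSr.
have xV n : x * a ^- n = a ^+ n * x.
  by apply: (mulgI (a ^- n)); rewrite mulKg mulgA -xX mulgK.
by rewrite mulgA xX -mulgA xV mulgA invgM invgK; congr (_ * _);
   apply/commute_sym/commuteV/commuteX2.
Qed.


End InCycle.

Section NormalForm.
Variables (G : groupType) (x y : G).
Hypothesis xyP : promislow_pair x y.
Let a := x * x.
Let b := y * y.
Let c := x * y * (x * y).

Let xb : x * b = b^-1 * x.
Proof. by apply: (mulgI b); rewrite mulVKg /b mulgA -{2}xyP.1 !mulgA. Qed.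

Let ya : y * a = a^-1 * y.
Proof. by apply: (mulgI a); rewrite mulVKg /a mulgA -{2}xyP.2 !mulgA. Qed.

Let xbV : x * b^-1 = b * x.
Proof. by apply: (mulgI b^-1); rewrite mulKg mulgA -xb mulgK. Qed.

Let xa : x * a = a * x. Proof. by rewrite /a mulgA. Qed.
Let yb : y * b = b * y. Proof. by rewrite /b mulgA. Qed.

Let yxyx : y * x * (y * x) = c^-1.
Proof.
apply: (mulIg c); rewrite mulVg /c.
have -> : y * x * (y * x) * (x * y * (x * y)) = y * x * (y * a) * (y * x * y).
  by rewrite /a !mulgA.
have -> : y * x * (y * a) * (y * x * y) = y * (x * a^-1) * (b * x * y).
  by rewrite ya /b !mulgA.
rewrite -xbV; have -> : x * a^-1 = x^-1 by rewrite /a invgM mulVKg.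
by rewrite -!mulgA mulKg /b invgM -(mulgA y^-1) mulVg mulg1 mulgV.
Qed.

Let xc : x * c = c^-1 * x.
Proof.
have cx : c * x = x * c^-1 by rewrite -yxyx /c !mulgA.
by apply: (mulgI c); rewrite mulVKg mulgA cx mulgVK.
Qed.

Let yc : y * c = c^-1 * y.
Proof. by rewrite -yxyx /c !mulgA. Qed.

Let ab : commute a b.
Proof. by rewrite /commute /a -!mulgA xb !mulgA xbV. Qed.

Let ac : commute a c.
Proof.
have xcV : x * c^-1 = c * x by apply: (mulgI c^-1); rewrite mulKg mulgA -xc mulgK.
by rewrite /commute /a -(mulgA x x c) xc mulgA xcV mulgA.
Qed.

Let bc : commute b c.
Proof.
have ycV : y * c^-1 = c * y by apply: (mulgI c^-1); rewrite mulKg mulgA -yc mulgK.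
by rewrite /commute /b -(mulgA y y c) yc mulgA ycV mulgA.
Qed.

Let yxE : y * x = c^-1 * b * a^-1 * (x * y).
Proof.
apply: (mulIg (x * y)^-1); rewrite mulgK invgM.
rewrite -yxyx; apply/esym.
have -> : y * x * (y * x) * b * a^-1 = y * x * y * (x * b) * a^-1 by rewrite !mulgA.
by rewrite xb /a /b !invgM !mulgA mulgK mulgK.
Qed.

(** The subgroup generated by [x^2], [y^2] and [(x y)^2] is abelian and normal,
    with a quotient of order at most four represented by the values of [t]. *)
Definition normal_form (g : G) : Prop := exists A B C t,
  [/\ in_cycle a A, in_cycle b B, in_cycle c C,
      [\/ t = 1, t = x, t = y | t = x * y] & g = A * B * C * t].

(** Conjugation by [x] inverts the generators [b] and [c] and fixes [a]; [y]
    and [x * y] do the same for the other pairs. *)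
Let xN A B C : in_cycle a A -> in_cycle b B -> in_cycle c C ->
  x * (A * B * C) = A * B^-1 * C^-1 * x.
Proof.
move=> hA hB hC; rewrite !mulgA (commute_in_cycle xa hA) -(mulgA A x B).
by rewrite (in_cycle_inv xb hB) -!mulgA (in_cycle_inv xc hC).
Qed.

Let yN A B C : in_cycle a A -> in_cycle b B -> in_cycle c C ->
  y * (A * B * C) = A^-1 * B * C^-1 * y.
Proof.
move=> hA hB hC; rewrite !mulgA (in_cycle_inv ya hA) -(mulgA _ y B).
by rewrite (commute_in_cycle yb hB) -!mulgA (in_cycle_inv yc hC).
Qed.

Let cAB A B : in_cycle a A -> in_cycle b B -> commute A B.
Proof.
move=> hA hB; apply/commute_sym/(commute_in_cycle _ hA)/commute_sym.
exact: commute_in_cycle ab hB.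
Qed.

Let cAC A C : in_cycle a A -> in_cycle c C -> commute A C.
Proof.
move=> hA hC; apply/commute_sym/(commute_in_cycle _ hA)/commute_sym.
exact: commute_in_cycle ac hC.
Qed.

Let cBC B C : in_cycle b B -> in_cycle c C -> commute B C.
Proof.
move=> hB hC; apply/commute_sym/(commute_in_cycle _ hB)/commute_sym.
exact: commute_in_cycle bc hC.
Qed.

Let NM A B C A' B' C' : in_cycle a A -> in_cycle b B -> in_cycle c C ->
  in_cycle a A' -> in_cycle b B' -> in_cycle c C' ->
  A * B * C * (A' * B' * C') = A * A' * (B * B') * (C * C').
Proof.
move=> hA hB hC hA' hB' hC'; rewrite !mulgA.
rewrite -(mulgA (A * B) C A') -(cAC hA' hC) mulgA -(mulgA A B A') -(cAB hA' hB).
by rewrite -!mulgA (mulgA C B') -(cBC hB' hC) !mulgA.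
Qed.

Lemma normal_form1 : normal_form 1.
Proof.
by exists 1, 1, 1, 1; split; [exact: in_cycle1|exact: in_cycle1|exact: in_cycle1|constructor 1|rewrite !mulg1].
Qed.

Lemma normal_formN A B C g : in_cycle a A -> in_cycle b B -> in_cycle c C ->
  normal_form g -> normal_form (A * B * C * g).
Proof.
move=> hA hB hC [A' [B' [C' [t [hA' hB' hC' ht ->]]]]].
exists (A * A'), (B * B'), (C * C'), t.
by split=> //; [exact: in_cycleM..|rewrite (mulgA _ _ t) NM].
Qed.

Lemma normal_formx g : normal_form g -> normal_form (x * g).
Proof.
move=> [A [B [C [t [hA hB hC ht ->]]]]]; rewrite mulgA xN // -(mulgA _ x).
apply: normal_formN; [exact: hA|exact: in_cycleV..|].
have nf t' : [\/ t' = 1, t' = x, t' = y | t' = x * y] -> normal_form t'.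
  by move=> ht'; exists 1, 1, 1, t'; split=> //; [exact: in_cycle1..|rewrite !mul1g].
have nfa t' : normal_form t' -> normal_form (a * t').
  move=> /(normal_formN (in_cycle_id a) (in_cycle1 b) (in_cycle1 c)).
  by rewrite !mulg1.
case: ht => ->.
- by rewrite mulg1; apply: nf; constructor 2.
- by rewrite -(mulg1 (x * x)); apply/nfa/nf; constructor 1.
- by apply: nf; constructor 4.
- by rewrite mulgA; apply/nfa/nf; constructor 3.
Qed.

Lemma normal_formy g : normal_form g -> normal_form (y * g).
Proof.
move=> [A [B [C [t [hA hB hC ht ->]]]]]; rewrite mulgA yN // -(mulgA _ y).
apply: normal_formN; [exact: in_cycleV|exact: hB|exact: in_cycleV|].
have nf t' : [\/ t' = 1, t' = x, t' = y | t' = x * y] -> normal_form t'.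
  by move=> ht'; exists 1, 1, 1, t'; split=> //; [exact: in_cycle1..|rewrite !mul1g].
have yxE' : y * x = a^-1 * b * c^-1 * (x * y).
  have ha := in_cycleV (in_cycle_id a); have hc := in_cycleV (in_cycle_id c).
  have hb := in_cycle_id b.
  by rewrite yxE -(cBC hb hc) -(mulgA b) -(cAC ha hc) (mulgA b) -(cAB ha hb).
have hN := normal_formN (in_cycleV (in_cycle_id a)) (in_cycle_id b)
  (in_cycleV (in_cycle_id c)).
case: ht => ->.
- by rewrite mulg1; apply: nf; constructor 3.
- by rewrite yxE'; apply/hN/nf; constructor 4.
- rewrite -(mulg1 (y * y)) -(mul1g (y * y)) -(mulg1 (1 * _)).
  by apply: normal_formN; [exact: in_cycle1|exact: in_cycle_id|exact: in_cycle1|exact: normal_form1].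
- rewrite mulgA yxE' -mulgA; apply: hN.
  rewrite -(mulgA x) xb.
  have -> : b^-1 * x = 1 * b^-1 * 1 * x by rewrite mulg1 mul1g.
  by apply: normal_formN; [exact: in_cycle1|exact/in_cycleV/in_cycle_id|exact: in_cycle1|apply: nf; constructor 2].
Qed.

Lemma normal_formxV g : normal_form g -> normal_form (x^-1 * g).
Proof.
move=> hg; have -> : x^-1 * g = x * (a^-1 * 1 * 1 * g).
  by rewrite !mulg1 /a invgM !mulgA mulgV mul1g.
apply/normal_formx/normal_formN => //; [exact/in_cycleV/in_cycle_id|exact: in_cycle1..].
Qed.

Lemma normal_formyV g : normal_form g -> normal_form (y^-1 * g).
Proof.
move=> hg; have -> : y^-1 * g = y * (1 * b^-1 * 1 * g).
  by rewrite mulg1 mul1g /b invgM !mulgA mulgV mul1g.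
apply/normal_formy/normal_formN => //; [exact: in_cycle1|exact/in_cycleV/in_cycle_id|exact: in_cycle1].
Qed.

(** A homomorphism to a torsion-free group that does not kill [x], [y] and
    [x * y] is injective: conjugating an element of the abelian normal subgroup
    [<x^2, y^2, (x y)^2>] by these three elements isolates its factors, and
    every other element has a square that is an odd power of [x^2], [y^2] or
    [(x y)^2]. *)
Lemma normal_form_ker (H : groupType) (f : {multiplicative G -> H}) g :
  f 1 = 1 -> torsion_free H -> f x <> 1 -> f y <> 1 -> f (x * y) <> 1 ->
  normal_form g -> f g = 1 -> g = 1.
Proof.
move=> f1 tf fx fy fxy.
have fV u : f u^-1 = (f u)^-1 by apply: (mulgI (f u)); rewrite -gmulfM !mulgV.
have fX u n : f (u ^+ n) = f u ^+ n.
  by elim: n => [|n IHn]; rewrite ?expg0 // !expgS gmulfM IHn.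
have tfX (u : H) m n : u <> 1 -> u ^+ m = u ^+ n -> m = n.
  move=> u1; wlog mn : m n / (m < n)%N => [hw|umn].
    by case: (ltngtP m n) => // mn umn; [exact: hw|apply/esym/hw].
  case: u1; apply: (tf _ (n - m).-1); rewrite prednK ?subn_gt0 //.
  by apply: (mulgI (u ^+ m)); rewrite -expgnDr subnKC ?(ltnW mn) // mulg1 umn.
have tf2 (u : H) : u * u = 1 -> u = 1 by move=> u2; apply: (tf u 1%N).
have fcyc u A : f (u * u) <> 1 -> in_cycle (u * u) A -> f (A * A) = 1 -> A = 1.
  move=> fu [k [l ->]]; rewrite gmulfM => /tf2.
  rewrite gmulfM fV !fX => h; suff -> : k = l by rewrite mulgV.
  by apply: (tfX _ _ _ fu); apply: (mulIg (f (u * u) ^- l)); rewrite h mulgV.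
have fodd u A : f (u * u) <> 1 -> in_cycle (u * u) A -> f (A * A * (u * u)) <> 1.
  move: (u * u) => d fu [k [l ->]]; rewrite !gmulfM fV !fX => h.
  have : f d ^+ (k + k + 1)%N = f d ^+ (l + l)%N.
    have e : f d ^- l * f d ^+ k = f d ^+ k * f d ^- l.
      by apply/commute_sym/commuteV/commuteX2.
    have e1 : f d ^- l * f d = f d * f d ^- l.
      by apply/commute_sym/commuteV/commuteX.
    apply: (mulIg (f d ^- (l + l))); rewrite mulgV -[RHS]h !expgnDr expg1 invgM.
    rewrite -!mulgA; congr (_ * _).
    by rewrite e1 (mulgA (f d ^- l)) e -!mulgA (mulgA (f d ^- l) (f d)) e1 -mulgA.
  move/(tfX _ _ _ fu)/(congr1 odd).
  by rewrite !oddD !addbb.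
have fsq u : f u <> 1 -> f (u * u) <> 1 by move=> fu; rewrite gmulfM => /tf2.
move=> [A [B [C [t [hA hB hC ht ->]]]]] fg.
have fconj u v w : u * v = w * u -> f v = 1 -> f w = 1.
  move=> uv fv; have := congr1 f uv; rewrite !gmulfM fv mulg1.
  by move/(congr1 (fun z => z * (f u)^-1)); rewrite mulgV mulgK.
have xyN : x * y * (A * B * C) = A^-1 * B^-1 * C * (x * y).
  rewrite -mulgA yN // mulgA xN; [|exact: in_cycleV|exact: hB|exact: in_cycleV].
  by rewrite invgK mulgA.
case: ht fg => ->; rewrite ?mulg1 => fg.
- have fgx := fconj _ _ _ (xN hA hB hC) fg.
  have fgy := fconj _ _ _ (yN hA hB hC) fg.
  have fgxy := fconj _ _ _ xyN fg.
  have -> : A = 1.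
    apply: (fcyc x) => //; first exact: fsq.
    have <- : A * B * C * (A * B^-1 * C^-1) = A * A.
      by rewrite NM // ?mulgV ?mulg1 //; exact: in_cycleV.
    by rewrite gmulfM fg fgx mulg1.
  have -> : B = 1.
    apply: (fcyc y) => //; first exact: fsq.
    have <- : A * B * C * (A^-1 * B * C^-1) = B * B.
      by rewrite NM // ?mulgV ?mulg1 ?mul1g //; exact: in_cycleV.
    by rewrite gmulfM fg fgy mulg1.
  have -> : C = 1.
    apply: (fcyc (x * y)) => //; first exact: fsq.
    have <- : A * B * C * (A^-1 * B^-1 * C) = C * C.
      by rewrite NM // ?mulgV ?mulg1 ?mul1g //; exact: in_cycleV.
    by rewrite gmulfM fg fgxy mulg1.
  by rewrite !mulg1.
- case: (fodd x A (fsq _ fx) hA).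
  have <- : A * B * C * x * (A * B * C * x) = A * A * (x * x).
    rewrite (mulgA (A * B * C * x)) -(mulgA (A * B * C) x) xN // (mulgA (A * B * C)).
    by rewrite NM // ?mulgV ?mulg1; [rewrite -mulgA|exact: in_cycleV..].
  by rewrite gmulfM fg mulg1.
- case: (fodd y B (fsq _ fy) hB).
  have <- : A * B * C * y * (A * B * C * y) = B * B * (y * y).
    rewrite (mulgA (A * B * C * y)) -(mulgA (A * B * C) y) yN // (mulgA (A * B * C)).
    by rewrite NM // ?mulgV ?mulg1 ?mul1g; [rewrite -mulgA|exact: in_cycleV..].
  by rewrite gmulfM fg mulg1.
- case: (fodd (x * y) C (fsq _ fxy) hC).
  have <- : A * B * C * (x * y) * (A * B * C * (x * y)) = C * C * (x * y * (x * y)).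
    rewrite (mulgA (A * B * C * (x * y))) -(mulgA (A * B * C) (x * y)) xyN.
    rewrite (mulgA (A * B * C)).
    by rewrite NM // ?mulgV ?mul1g; [rewrite -mulgA|exact: in_cycleV..].
  by rewrite gmulfM fg mulg1.
Qed.

End NormalForm.

Local Close Scope group_scope.

(** * Copies of the Promislow group in torsion-free groups *)

Local Open Scope group_scope.

Section PresentedHom.
Variables (T : choiceType) (R : word T -> word T -> Prop) (G : groupType).
Variable g : T -> G.

Definition eval_letter (a : T * bool) : G := if a.2 then (g a.1)^-1 else g a.1.

Definition eval_word (u : word T) : G := foldr (fun a h => eval_letter a * h) 1 u.

Lemma eval_cat u v : eval_word (u ++ v) = eval_word u * eval_word v.
Proof. by elim: u => [|a u IHu] /=; rewrite ?mul1g // IHu mulgA. Qed.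

Hypothesis gR : forall u v, R u v -> eval_word u = eval_word v.

Lemma eval_cong u v : word_cong R u v -> eval_word u = eval_word v.
Proof.
elim=> [//|??? -> //|????-> ? -> //|????? IHu ? IHv|a|? ? /gR //].
  by rewrite !eval_cat IHu IHv.
by rewrite /eval_word /eval_letter /=; case: a => t [] /=; rewrite mulg1 ?mulVg ?mulgV.
Qed.

Lemma presented_hom : exists f : {multiplicative presented R -> G},
  forall u, f (pclass R u) = eval_word u.
Proof.
pose f (a : presented R) := eval_word (generic_quotient.repr a).
have fE u : f (pclass R u) = eval_word u by exact/eval_cong/word_cong_reprE.
have fM : {morph f : a b / a * b}.
  move=> a b; have [[u ->] [v ->]] := (pclass_surj a, pclass_surj b).
  by rewrite [_ * _]presented_mulE !fE eval_cat.
pose m := isMultiplicative.Build _ _ f fM.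
exists (HB.pack f m : {multiplicative presented R -> G}) => u; exact: fE.
Qed.

End PresentedHom.

Lemma gmulf1_group (G H : groupType) (f : {multiplicative G -> H}) : f 1 = 1.
Proof. by apply: (mulgI (f 1)); rewrite -gmulfM !mulg1. Qed.

(** The subset in the definition can be taken to be the image of the embedding. *)
Lemma contains_copyE (G P : groupType) :
  contains_copy G P <-> exists f : {multiplicative P -> G}, injective f.
Proof.
split=> [[H [_ [f fI _]]]|[f fI]]; first by exists f.
exists ((fun g => `[< exists p, f p = g >]) : {pred G}); split; last first.
  by exists f => // g; split=> [/asboolP|] //= h; apply/asboolP.
split; first by apply/asboolP; exists 1; exact: gmulf1_group.
move=> _ _ /asboolP[u <-] /asboolP[v <-]; apply/asboolP; exists (u * v^-1).
rewrite gmulfM; congr (_ * _); apply: (mulgI (f v)).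
by rewrite -gmulfM !mulgV gmulf1_group.
Qed.

Definition gen_x : promislow := pclass promislow_rel [:: px].
Definition gen_y : promislow := pclass promislow_rel [:: py].

Lemma promislow_gen_pair : promislow_pair gen_x gen_y.
Proof.
have cong u v : word_cong promislow_rel u v ->
  pclass promislow_rel u = pclass promislow_rel v by move=> /pclassP.
have E u v : (pclass promislow_rel u : promislow) * pclass promislow_rel v =
    pclass promislow_rel (u ++ v) by exact: presented_mulE.
have aux a b : promislow_rel [:: inv_letter a; b; b; a] [:: inv_letter b; inv_letter b] ->
    word_cong promislow_rel [:: b; b; a; b; b] [:: a].
  move=> h.
  have ca := WCcancel promislow_rel a.
  have cb : word_cong promislow_rel [:: inv_letter b; inv_letter b; b; b] [::].
    by exact: (word_cong_invV promislow_rel [:: b; b]).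
  have s1 : word_cong promislow_rel [:: b; b; a; b; b]
     ([:: a; inv_letter a] ++ [:: b; b; a; b; b]).
    apply: WCsym; exact: (WCcat ca (WCrefl promislow_rel [:: b; b; a; b; b])).
  apply: (WCtrans s1).
  have s2 : word_cong promislow_rel ([:: a] ++ ([:: inv_letter a; b; b; a] ++ [:: b; b]))
     ([:: a] ++ ([:: inv_letter b; inv_letter b] ++ [:: b; b])).
    by apply: WCcat; [exact: WCrefl|apply: WCcat; [exact: WCrel|exact: WCrefl]].
  apply: (WCtrans s2).
  exact: (WCcat (WCrefl promislow_rel [:: a]) cb).
split; rewrite /gen_x /gen_y !E /=; apply: cong; apply: aux; constructor.
Qed.

(** The exponent sum of [x] modulo 4 respects both relations. *)
Lemma promislow_gen_x_neq1 : gen_x <> 1.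
Proof.
pose g (t : bool) : 'Z_4 := if t then 0%R else 1%R.
pose h (u : word bool) : 'Z_4 := (\sum_(a <- u) (if a.2 then - g a.1 else g a.1))%R.
have hE u v : word_cong promislow_rel u v -> h u = h v.
  elim=> [//|??? -> //|????-> ? -> //|????? IHu ? IHv|a|].
  - by rewrite /h !big_cat /=; congr (_ + _)%R.
  - rewrite /h !big_cons !big_nil; case: a => t [] /=; rewrite GRing.addr0 ?GRing.subrr //.
    by rewrite GRing.addNr.
  - by move=> ? ? []; rewrite /h !big_cons !big_nil; apply/val_inj.
move/pclassP/hE; rewrite /h !big_cons !big_nil.
by move/(congr1 val).
Qed.

Lemma promislow_normal_form (a : promislow) : normal_form gen_x gen_y a.
Proof.
have [u ->] := pclass_surj a.
have E b u' : pclass promislow_rel (b :: u') =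
    (pclass promislow_rel [:: b] : promislow) * pclass promislow_rel u'.
  exact/esym/presented_mulE.
have V b : pclass promislow_rel [:: inv_letter b] =
    (pclass promislow_rel [:: b] : promislow)^-1.
  by apply/esym; exact: presented_invE.
have P := promislow_gen_pair.
elim: u => [|[[] []] u IHu].
- exact: normal_form1.
- by rewrite E (V py); apply: normal_formyV.
- by rewrite E; apply: normal_formy.
- by rewrite E (V px); apply: normal_formxV.
- by rewrite E; apply: normal_formx.
Qed.

(** In a torsion-free group every nontrivial homomorphism from the Promislow
    group is injective, so copies of it are pairs of elements. *)
Lemma contains_promislow (G : groupType) : torsion_free G ->
  contains_copy G promislow <->
  exists x y : G, promislow_pair x y /\ (x <> 1 \/ y <> 1).
Proof.
move=> tf; rewrite contains_copyE; split=> [[f fI]|[x [y [xyP xy1]]]].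
  exists (f gen_x), (f gen_y); split; last first.
    by left=> fx; apply: promislow_gen_x_neq1; apply: fI; rewrite fx gmulf1_group.
  by have [e1 e2] := promislow_gen_pair; split; rewrite -!gmulfM ?e1 ?e2.
have x1 : x <> 1.
  move=> x1; case: xy1 => // y1; apply: y1; apply: (tf _ 3%N).
  by have [] := xyP; rewrite x1 !mulg1 => e _; rewrite -[RHS]e !expgS expg0 mulg1 !mulgA.
have y1 : y <> 1.
  move=> y1; apply: x1; apply: (tf _ 3%N).
  by have [] := xyP; rewrite y1 !mulg1 => _ e; rewrite -[RHS]e !expgS expg0 mulg1 !mulgA.
have xy : x * y <> 1.
  move=> xy; apply: y1; apply: (tf _ 3%N).
  have yE : x^-1 = y by apply: mulg1_eq.
  have [e _] := xyP; move: e; rewrite -(mulgA (y * y)) xy mulg1 => e.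
  rewrite !expgS expg0 mulg1 mulgA; apply: (mulIg x); rewrite mul1g -[RHS]e.
  by rewrite -yE -!mulgA mulVg mulg1.
pose g (t : bool) := if t then y else x.
have gR u v : promislow_rel u v -> eval_word g u = eval_word g v.
  have [e1 e2] := xyP.
  case; rewrite /eval_word /eval_letter /= !mulg1.
  - apply: (mulgI x); rewrite mulVKg; apply: (mulIg y); apply: (mulIg y).
    by rewrite !mulgA !mulgVK.
  - apply: (mulgI y); rewrite mulVKg; apply: (mulIg x); apply: (mulIg x).
    by rewrite !mulgA !mulgVK.
have [f fE] := presented_hom gR.
exists f => a b fab; apply: divg1_eq; set d := _ * _.
have fa : f d = 1.
  rewrite /d gmulfM fab -gmulfM; apply: (mulIg (f b)).
  by rewrite mul1g -gmulfM mulgV mul1g.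
have fx : f gen_x = x by rewrite fE /eval_word /= mulg1.
have fy : f gen_y = y by rewrite fE /eval_word /= mulg1.
apply: (normal_form_ker promislow_gen_pair (gmulf1_group f) tf) fa.
- by rewrite fx.
- by rewrite fy.
- by rewrite gmulfM fx fy.
- exact: promislow_normal_form.
Qed.

Local Close Scope group_scope.

(** * The structure group of an involutive solution *)

Local Open Scope ring_scope.

(** A Promislow pair for the product [vmul rho]. *)
Definition vec_pair (X : finType) (rho : vec X -> {perm X}) (v w : vec X) : Prop :=
  let m := vmul rho in
  m (m (m (m w w) v) w) w = v /\ m (m (m (m v v) w) v) v = w.

Definition has_promislow (X : finType) (rho : vec X -> {perm X}) : Prop :=
  exists v w, vec_pair rho v w /\ (v <> 0 \/ w <> 0).

Section Torsion.
Variables (X : finType) (rho : vec X -> {perm X}).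
Hypothesis rhoM : brace_map rho.
Implicit Types v w : vec X.

Definition vpow v n : vec X := iter n (vmul rho v) 0.

(** The sum over the powers of a torsion element is fixed up to a multiple by
    its affine action. *)
Lemma vpow_sum v n :
  \sum_(i < n) vpow v i + vpow v n =
  v *+ n + vact (rho v) (\sum_(i < n) vpow v i).
Proof.
elim: n => [|n IHn]; first by rewrite !big_ord0 mulr0n vact0.
rewrite !big_ord_recr /= {1}IHn /vmul mulrSr vactD -!addrA; congr (_ + _).
by rewrite addrCA.
Qed.

Lemma vmul_fix v u : vmul rho v u = u -> v = 0.
Proof.
move=> vu; have := congr1 (fun z => vmul rho z (vinv rho u)) vu.
by rewrite vmulA // vmulV vmul0r.
Qed.

(** Dividing that sum with rounding down still gives a fixed point, which
    only the identity has. *)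
Lemma vpow_torsion v n : vpow v n.+1 = 0 -> v = 0.
Proof.
move=> v0; pose U := \sum_(i < n.+1) vpow v i.
have UE : U = v *+ n.+1 + vact (rho v) U by rewrite -vpow_sum v0 addr0.
apply: (@vmul_fix _ [ffun x => (U x %/ n.+1)%Z]).
apply/ffunP => x; rewrite /vmul !ffunE {2}UE !ffunE.
rewrite (_ : (v *+ n.+1) x = v x * n.+1%:Z) ?divzMDl //.
by rewrite ffunMnE pmulrn mulrzz.
Qed.

End Torsion.

Section Solution.
Variables (X : finType) (r : X * X -> X * X).
Hypotheses (rP : is_solution r) (rK : involutive r).

(** The cycle set of the solution: [sol_perm x] inverts [sigma x]. *)
Definition sol_perm (x : X) : {perm X} :=
  (perm (bij_inj (sol_sigma_bij rP x)))^-1%g.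

Lemma sol_permK x y : sigma r x (sol_perm x y) = y.
Proof. by rewrite /sol_perm -{2}(permKV (perm (bij_inj (sol_sigma_bij rP x))) y) permE. Qed.

Lemma sol_permE x y : r (x, sol_perm x y) = (y, sol_perm y x).
Proof.
have rE : r (x, sol_perm x y) = (y, (r (x, sol_perm x y)).2).
  by rewrite {1}[LHS]surjective_pairing; congr (_, _); exact: sol_permK.
rewrite rE; congr (_, _); apply: (bij_inj (sol_sigma_bij rP y)).
by rewrite sol_permK /sigma -rE rK.
Qed.

Lemma sol_sigma x y : sigma r x y = (sol_perm x)^-1%g y.
Proof. by rewrite -[y in LHS](permKV (sol_perm x)) sol_permK. Qed.

Lemma sol_cycle_set : cycle_set sol_perm.
Proof.
move=> x y; apply/permP => z; rewrite !permM.
have ss a b c : sigma r a (sigma r b c) =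
    sigma r (sigma r a b) (sigma r (tau r b a) c).
  by have /(congr1 (fun t => t.1.1)) := sol_braid rP (a, b, c); move=> /= /esym.
apply: (bij_inj (sol_sigma_bij rP (sol_perm x y))).
rewrite sol_permK; apply: (bij_inj (sol_sigma_bij rP x)).
rewrite sol_permK ss sol_permK (_ : tau r _ _ = sol_perm y x) ?sol_permK //.
by rewrite /tau sol_permE.
Qed.

Lemma structure_relE u v : structure_rel r u v <-> swap_rel sol_perm u v.
Proof.
split=> [[x y' y z rE]|[x [y [-> ->]]]]; last first.
  by constructor; exact: sol_permE.
have yE : y' = sol_perm x y.
  by apply: (bij_inj (sol_sigma_bij rP x)); rewrite sol_permK /sigma rE.
exists x, y; rewrite /= yE; split=> //.
by move: rE; rewrite yE sol_permE => -[<-].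
Qed.

Variable rho : vec X -> {perm X}.
Hypothesis rhoM : brace_map rho.
Hypothesis rhoE : forall u, rho (ev sol_perm u).1 = (ev sol_perm u).2.

Let G := structure_group r.

Let Rswap x y : word_cong (structure_rel r) (pos [:: x; sol_perm x y])
                                            (pos [:: y; sol_perm y x]).
Proof. by apply/WCrel/structure_relE; exists x, y. Qed.

Let Rev u v : structure_rel r u v -> ev sol_perm u = ev sol_perm v.
Proof. by move/structure_relE; exact/ev_swap/sol_cycle_set. Qed.

(** The class of a word is determined by its vector, and every vector occurs;
    products of words multiply as in the semidirect product. *)
Lemma structure_group_vec : exists f : G -> vec X,
  [/\ injective f, (forall v, exists g, f g = v), f 1%g = 0
    & forall g h, f (g * h)%g = vmul rho (f g) (f h)].
Proof.
pose f (g : G) := (ev sol_perm (generic_quotient.repr (g : presented (structure_rel r)))).1.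
have fE u : f (pclass _ u) = (ev sol_perm u).1.
  by rewrite /f (ev_cong Rev (word_cong_reprE _ u)).
exists f; split.
- move=> g h; have [[u ->] [v ->]] := (pclass_surj g, pclass_surj h).
  rewrite !fE => uv; apply/pclassP.
  exact: (vec_cong sol_cycle_set Rswap Rev).
- by move=> v; have [u uv] := vec_word Rev v; exists (pclass _ u); rewrite fE.
- by rewrite [1%g]/(pclass _ [::]) fE.
- move=> g h; have [[u ->] [v ->]] := (pclass_surj g, pclass_surj h).
  by rewrite [(_ * _)%g]presented_mulE !fE ev_cat /= /vmul rhoE.
Qed.

(** The structure group is torsion-free, so a copy of the Promislow group is
    the same thing as a nontrivial Promislow pair. *)
Lemma structure_group_promislow :
  contains_copy G promislow <-> has_promislow rho.
Proof.
have [f [fI fS f1 fM]] := structure_group_vec.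
have tf : torsion_free G.
  move=> g n gn; apply: fI; rewrite f1; apply: (vpow_torsion rhoM (n := n)).
  have fX m : f (g ^+ m)%g = vpow rho (f g) m.
    by elim: m => [|m IHm]; rewrite ?expg0 // expgS fM IHm.
  by rewrite -fX gn.
rewrite (contains_promislow tf); split=> [[x [y [[e1 e2] xy]]]|].
  exists (f x), (f y); split; first by rewrite /vec_pair -!fM e1 e2.
  by case: xy => h; [left|right]; move=> /esym; rewrite -f1 => /fI /esym.
move=> [v [w [[e1 e2] vw]]]; have [[x xv] [y yw]] := (fS v, fS w).
exists x, y; split; first by split; apply: fI; rewrite !fM xv yw.
by case: vw => h; [left|right] => h1; apply: h; rewrite -?xv -?yw h1.
Qed.

End Solution.

Local Close Scope ring_scope.

(** * Permutation groups of odd prime power order on at most eight points *)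

Local Open Scope group_scope.

(** Here [C] stands for the permutations coming from the part of a brace whose
    order is a power of [p]. The map [k] separates the points by their rows for
    the complementary part, and [q] is the cycle set of the part of [C]. *)
Section OddPGroup.
Variables (X : finType) (p : nat) (C : {group {perm X}}).
Hypotheses (X8 : (#|X| <= 8)%N) (p_pr : prime p) (p_odd : odd p) (Cp : p.-group C).

(** The cube of an odd prime does not divide 8 factorial. *)
Lemma odd_pgroup_abelian : abelian C.
Proof.
apply: (p2group_abelian Cp).
have CX : (#|C| %| 8`!)%N.
  apply: (@dvdn_trans #|X|`!); last first.
    by rewrite -(bin_fact X8) dvdn_mull // dvdn_mulr.
  have <- : #|{perm X}| = #|X|`!.
    rewrite -cardsT -(card_perm [set: X]); apply: eq_card => s.
    by rewrite !inE; apply/esym/subsetP => x _; rewrite inE.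
  by rewrite -cardsT cardSg ?subsetT.
apply: leq_trans (dvdn_leq_log p _ CX) _ => //.
rewrite leqNgt; apply/negP => h3.
have d : (p ^ 3 %| 8`!)%N by apply: dvdn_trans (pfactor_dvdnn p 8`!); exact: dvdn_exp2l.
have p35 : (p < 35)%N.
  rewrite ltnNge; apply/negP => p35.
  have := dvdn_leq (fact_gt0 8) d; rewrite leqNgt => /negP; apply.
  by apply: (@leq_trans (35 ^ 3)); [vm_compute|rewrite leq_exp2r].
have : all (fun k => odd k && (2 < k) ==> ~~ (k ^ 3 %| 8`!)%N) (iota 0 35) by vm_compute.
move/allP/(_ p); rewrite mem_iota p35 p_odd d /= => /(_ isT).
by rewrite odd_prime_gt2.
Qed.

Lemma commC c d : c \in C -> d \in C -> c * d = d * c.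
Proof. by move=> cC dC; exact: (centsP odd_pgroup_abelian). Qed.

Lemma fix_orbit x c y : c \in C -> c x = x -> y \in orbit 'P C x -> c y = y.
Proof.
move=> cC cx /orbitP[d dC <-] /=.
by rewrite /aperm -permM -(commC cC dC) permM cx.
Qed.

(** Nine points would be needed for an orbit of length [p ^ 2]. *)
Lemma card_moved_orbit (D : {group {perm X}}) x d :
  D \subset C -> d \in D -> d x != x -> #|orbit 'P D x| = p.
Proof.
move=> DC dD dx; have Dp := pgroupS DC Cp.
have [k Ek] : exists k, #|orbit 'P D x| = (p ^ k)%N.
  have := dvdn_orbit 'P D x; have [n ->] := p_natP Dp.
  by case/(dvdn_pfactor _ _ p_pr) => k _ ->; exists k.
have o8 : (#|orbit 'P D x| <= 8)%N.
  by apply: leq_trans X8; rewrite -cardsT subset_leq_card ?subsetT.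
have p3 : (2 < p)%N by exact: odd_prime_gt2.
case: k Ek => [|[|k]] Ek; last 2 first.
- by rewrite Ek expn1.
- have : (9 <= 8)%N; last by [].
  apply: leq_trans o8; rewrite Ek -[9]/(3 ^ 2)%N.
  by apply: (@leq_trans (p ^ 2)); rewrite ?leq_exp2r // leq_pexp2l ?prime_gt0.
have := card_orbit1 Ek => /setP/(_ (d x)).
by rewrite !inE (negbTE dx) => /negP[]; exact: (mem_orbit 'P).
Qed.

Lemma orbit_cycle c x y : c \in C -> c x != x -> y \in orbit 'P C x ->
  exists i, y = (c ^+ i) x.
Proof.
move=> cC cx yO.
have sub : <[c]> \subset C by rewrite cycle_subG.
have E : orbit 'P <[c]> x = orbit 'P C x.
  apply/eqP; rewrite eqEcard (card_moved_orbit sub (cycle_id c) cx).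
  rewrite (card_moved_orbit (subxx C) cC cx) leqnn andbT.
  by apply/subsetP => z /orbitP[e /(subsetP sub) eC <-]; apply: mem_orbit.
move: yO; rewrite -E => /orbitP[_ /cycleP[i ->] <-]; by exists i.
Qed.

Variables (T : eqType) (k : X -> T) (q : X -> {perm X}).
Hypotheses (qC : forall x, q x \in C) (qP : cycle_set q).
Hypothesis kq : forall x y, k x = k y -> q x = q y -> x = y.
Hypothesis kC : forall c x y, c \in C -> k x = k y -> k (c x) = k (c y).

Definition inner (c : {perm X}) : Prop := c \in C /\ forall x, k (c x) = k x.

Lemma inner_pow c i x : inner c -> k ((c ^+ i) x) = k x.
Proof.
move=> [_ cI]; elim: i => [|i IHi]; first by rewrite expg0 perm1.
by rewrite expgSr permM cI.
Qed.

Lemma innerM c d : inner c -> inner d -> inner (c * d).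
Proof. by move=> [cC cI] [dC dI]; split=> [|x]; rewrite ?groupM // permM dI. Qed.

Lemma innerV c : inner c -> inner c^-1.
Proof.
move=> [cC cI]; split=> [|x]; first by rewrite groupV.
by rewrite -[in RHS](permKV c x) cI.
Qed.

(** A bad orbit is an orbit moved by an inner element: it lies in one class of
    [k], hence [q] is injective on it. *)
Section BadOrbit.
Variables (g : {perm X}) (x0 : X).
Hypotheses (gI : inner g) (gx0 : g x0 != x0).
Let O := orbit 'P C x0.

Lemma bad_k x y : x \in O -> y \in O -> k x = k y.
Proof.
have kO z : z \in O -> k z = k x0.
  by case/(orbit_cycle gI.1 gx0) => i ->; exact: inner_pow.
by move=> /kO-> /kO->.
Qed.

Lemma bad_inj x y : x \in O -> y \in O -> q x = q y -> x = y.
Proof. by move=> xO yO; apply/kq/bad_k. Qed.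

Lemma memO c x : c \in C -> x \in O -> c x \in O.
Proof.
move=> cC /orbitP[d dC <-]; rewrite /O /= /aperm -permM.
by apply: (mem_orbit 'P); rewrite groupM.
Qed.

Lemma orbitO x : x \in O -> orbit 'P C x = O.
Proof. by move=> xO; apply/orbit_eqP. Qed.

Lemma fixO x y c : x \in O -> y \in O -> c \in C -> c x = x -> c y = y.
Proof. by move=> xO yO cC cx; apply: (fix_orbit cC cx); rewrite orbitO. Qed.

(** The identity for [z] and a point [y] fixed by [C] leaves [q (q y z) = q z],
    and [q] is injective on the orbit. *)
Lemma fixed_point_fixes y z : (forall c, c \in C -> c y = y) -> z \in O -> q y z = z.
Proof.
move=> yfix zO; have := qP z y; rewrite (yfix _ (qC z)).
rewrite (commC (qC z) (qC y)) => /mulgI e.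
by apply/esym/(bad_inj zO _ e); exact: memO.
Qed.

Let card_O : #|O| = p.
Proof. exact: (card_moved_orbit (subxx C) gI.1 gx0). Qed.

(** If some [q w] fixes a point of the orbit, the cycle set identity spreads
    this to all [q u]. Otherwise, if [C] acts regularly then [q] maps the orbit
    onto [C] and takes the value 1; and if [C] is larger then [p] is 3, and
    elements [q x] and [q y] rotating the orbit in opposite directions are
    excluded by the identity. *)
Lemma bad_shift x y z : x \in O -> y \in O -> z \in O -> (q x * (q y)^-1) z = z.
Proof.
have all_fix w : w \in O -> q w w = w -> forall u v, u \in O -> v \in O -> q u v = v.
  move=> wO qw u v uO vO; have wu := fixO wO uO (qC w) qw.
  have := qP u w; rewrite wu (commC (qC w) (qC u)) => /mulgI e.
  have : q u w = w by apply: bad_inj => //; exact: memO.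
  by apply: fixO => //; exact: qC.
have fin u v w : u \in O -> v \in O -> w \in O -> q u w = w -> q v w = w -> (q u * (q v)^-1) w = w.
  by move=> _ _ _ e1 e2; rewrite permM e1 -{1}e2 permK.
case: (boolP [exists w in O, q w w == w]) => [/exists_inP[w wO /eqP qw]|nofix].
  move=> xO yO zO; apply: fin => //; exact: all_fix qw _ _ _ _.
have qmv u v : u \in O -> v \in O -> q u v != v.
  move=> uO vO; apply: contra nofix => /eqP quv; apply/exists_inP; exists u => //.
  by apply/eqP; exact: (fixO vO uO (qC u) quv).
have x0O : x0 \in O by exact: orbit_refl.
have [/existsP[c /and3P[cC c1 /eqP cx0]]|nofixC] :=
  boolP [exists c, [&& c \in C, c != 1 & c x0 == x0]].
  have [y0 cy0] : exists y, c y != y.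
    apply/existsP; apply: contraR c1; rewrite negb_exists => /forallP h.
    by apply/eqP/permP => u; rewrite perm1; apply/eqP; move: (h u); rewrite negbK.
  have y0O : y0 \notin O.
    by apply: contra cy0 => y0O; apply/eqP; exact: fixO cx0.
  have p3 : p = 3%N.
    apply/eqP; rewrite eqn_leq (odd_prime_gt2 p_odd p_pr) andbT leqNgt; apply/negP => p4.
    have dis : [disjoint O & orbit 'P C y0].
      rewrite disjoint_sym; apply/pred0P => u /=; apply/negP => /andP[uy uO].
      by move: y0O; rewrite -(orbitO uO) orbit_sym uy.
    have : (#|O| + #|orbit 'P C y0| <= 8)%N.
      move: dis; rewrite -(leq_card_setU _ _).2 => /eqP <-.
      by apply: leq_trans X8; exact: max_card.
    rewrite card_O (card_moved_orbit (subxx C) cC cy0) leqNgt => /negP; apply.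
    move: p4 p_odd; rewrite leq_eqVlt => /predU1P[<- //|p5 _].
    by apply: (@leq_trans (5 + 5)) => //; exact: leq_add.
  move=> xO yO zO; apply/eqP/negPn/negP => qz.
  have qxy u : u \in O -> q x u != q y u.
    move=> uO; apply: contra qz => /eqP e; apply/eqP; apply: (fixO uO zO).
      by rewrite groupM ?groupV.
    by rewrite permM e permK.
  have mO w u : w \in O -> u \in O -> q w u \in O by move=> _; exact: memO.
  have xy : x != y by apply: contraNneq (qxy _ xO) => ->.
  set u1 := q x x; set u2 := q y x.
  have O3 u : u \in O -> [\/ u = x, u = u1 | u = u2].
    have OE : O = x |: [set u1; u2].
      apply/eqP; rewrite eq_sym eqEcard card_O p3 cardsU1 cards2 !inE.
      rewrite ![x == _]eq_sym (negbTE (qmv _ _ xO xO)) (negbTE (qmv _ _ yO xO)).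
      rewrite (qxy _ xO) andbT; apply/subsetP => w.
      by rewrite !inE => /or3P[] /eqP->; rewrite ?mO.
    rewrite OE !inE => /or3P[] /eqP->; by [constructor 1|constructor 2|constructor 3].
  have ne1 : u1 != x by exact: qmv.
  have ne2 : u2 != x by exact: qmv.
  have ne12 : u1 != u2 by exact: qxy.
  have u1O : u1 \in O by exact: mO.
  have u2O : u2 \in O by exact: mO.
  have neq (a b : X) : a != b -> a = b -> False by move=> /eqP.
  have rot (d : {perm X}) a b : d \in C -> (forall u, u \in O -> d u != u) ->
      a \in O -> b \in O -> a != x -> b != x -> a != b -> d x = a -> d a = b /\ d b = x.
    move=> dC dm aO bO ax bx ab dx.
    have O3' u : u \in O -> [\/ u = x, u = a | u = b].
      case: (O3 _ aO) (ax) (ab) => -> //; first by rewrite eqxx.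
        move=> _; case: (O3 _ bO) (bx) => -> //; first by rewrite eqxx.
          by rewrite eqxx.
        by move=> _ _ /O3.
      move=> _; case: (O3 _ bO) (bx) => -> //; first by rewrite eqxx.
        by move=> _ _ /O3[]; [constructor 1|constructor 3|constructor 2].
      by rewrite eqxx.
    have da : d a = b.
      case: (O3' _ (memO dC aO)) => // [dax|daa]; last by case: (neq _ _ (dm _ aO)).
      case: (O3' _ (memO dC bO)) => [dbx|dba|dbb].
      - by case: (neq _ _ ab); apply: (@perm_inj _ d); rewrite dax dbx.
      - by case: (neq _ _ bx); apply: (@perm_inj _ d); rewrite dba.
      - by case: (neq _ _ (dm _ bO)).
    split=> //; case: (O3' _ (memO dC bO)) => // [dba|dbb].
      by case: (neq _ _ bx); apply: (@perm_inj _ d); rewrite dba.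
    by case: (neq _ _ (dm _ bO)).
  have [d1 d2] : q x u1 = u2 /\ q x u2 = x.
    by apply: rot => //; move=> u; exact: qmv.
  have := qP x y; case: (O3 _ yO) => yE; first by rewrite yE eqxx in xy.
    rewrite {1}yE d1 -/u2 => /mulIg qq.
    by move: xy; rewrite (bad_inj xO yO qq) eqxx.
  rewrite {1}yE d2 -/u2 -yE => qq.
  have c2 : (q x * (q y)^-1) ^+ 2 = 1.
    rewrite expgMn; last by apply: commC; rewrite ?groupV.
    by rewrite expgVn -[q x ^+ 2]/(q x * q x) qq mulgV.
  have o2 : (#[(q x * (q y)^-1)] %| 2)%N by rewrite order_dvdn c2.
  have oC : (#[(q x * (q y)^-1)] %| #|C|)%N by rewrite order_dvdG // groupM ?groupV.
  have : #[(q x * (q y)^-1)] == 1%N.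
    rewrite -dvdn1; have /eqP <- : coprime 2 #|C|; last by rewrite dvdn_gcd o2.
    rewrite coprime2n; have [n ->] := p_natP Cp; by rewrite oddX p_odd orbT.
  rewrite order_eq1 => /eqP/divg1_eq e.
  by move: xy; rewrite (bad_inj xO yO) ?eqxx.
have Cp' : #|C| = p.
  rewrite -(card_orbit_stab 'P C x0) -/O card_O.
  have -> : 'C_C[x0 | 'P] = 1%g :> {set _}.
    apply/setP => c; rewrite !inE; apply/idP/eqP => [/andP[cC]|->].
      rewrite sub1set inE => /eqP cx0; apply/eqP; apply: contraR nofixC => c1.
      by apply/existsP; exists c; rewrite cC c1 -{2}cx0 eqxx.
    by rewrite group1 sub1set inE /= apermE perm1 eqxx.
  by rewrite cards1 muln1.
have qO : [set q u | u in O] = C.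
  apply/eqP; rewrite eqEcard; apply/andP; split.
    by apply/subsetP => _ /imsetP[u _ ->].
  by rewrite card_in_imset ?card_O ?Cp' // => u v uO vO; exact: bad_inj.
have : 1%g \in [set q u | u in O] by rewrite qO group1.
case/imsetP => w wO q1; move=> _ _ _; case/exists_inP: nofix.
by exists w; rewrite // -q1 perm1.
Qed.

(** The quotient of two values of [q] on a bad orbit fixes the orbit by
    [bad_shift], and is not 1 since [q] is injective there. *)
Lemma bad_stabilizer : exists2 c, c \in C & c x0 = x0 /\ c != 1.
Proof.
have x0O : x0 \in O by exact: orbit_refl.
have gO : g x0 \in O by exact: (memO gI.1).
exists (q x0 * (q (g x0))^-1); first by rewrite groupM ?groupV.
split; first exact: bad_shift.
apply/negP => /eqP/divg1_eq /(bad_inj x0O gO) e.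
by move: gx0; rewrite -e eqxx.
Qed.

Lemma moved_outside c y : c \in C -> c x0 = x0 -> c y != y -> y \notin O.
Proof.
move=> cC cx; apply: contra => yO; apply/eqP.
by apply: (fixO _ yO cC cx); exact: orbit_refl.
Qed.

End BadOrbit.

(** A bad orbit [O] and an orbit [O'] moved by an element [c] that fixes [O]
    already use six points, so [C] fixes the remaining ones. *)
Section TwoOrbits.
Variables (g c : {perm X}) (x0 y0 : X).
Hypotheses (gI : inner g) (gx0 : g x0 != x0).
Hypotheses (cC : c \in C) (cx0 : c x0 = x0) (cy0 : c y0 != y0).
Let O := orbit 'P C x0.
Let O' := orbit 'P C y0.

Let y0O : y0 \notin O. Proof. exact: moved_outside cx0 cy0. Qed.
Let x0O : x0 \in O. Proof. exact: orbit_refl. Qed.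
Let y0O' : y0 \in O'. Proof. exact: orbit_refl. Qed.

Let disj z : z \in O -> z \in O' -> False.
Proof.
move=> zO zO'; move: y0O; rewrite /O -(orbitO zO) (orbitO zO').
by rewrite [_ \in _]y0O'.
Qed.

Let rest_fixed z d : z \notin O -> z \notin O' -> d \in C -> d z = z.
Proof.
move=> zO zO' dC; apply/eqP; apply: contraT => dz.
have dOO' : [disjoint O & O'].
  by apply/pred0P => u /=; apply/negP => /andP[]; exact: disj.
have out A w : A = orbit 'P C w -> z \notin A -> [disjoint A & orbit 'P C z].
  move=> -> zA; apply/pred0P => u /=; apply/negP => /andP[uA uz].
  by move: zA; rewrite -(orbitO uA) (orbitO uz) orbit_refl.
have dU : [disjoint O :|: O' & orbit 'P C z].
  rewrite -setI_eq0 setIUl setU_eq0 !setI_eq0.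
  by rewrite (out O x0) // (out O' y0).
have : (#|(O :|: O') :|: orbit 'P C z| <= 8)%N.
  by apply: leq_trans X8; exact: max_card.
have /eqP -> : #|(O :|: O') :|: orbit 'P C z| ==
    (#|O :|: O'| + #|orbit 'P C z|)%N.
  by rewrite (leq_card_setU _ _).2.
have /eqP -> : #|O :|: O'| == (#|O| + #|O'|)%N by rewrite (leq_card_setU _ _).2.
rewrite (card_moved_orbit (subxx C) gI.1 gx0) (card_moved_orbit (subxx C) cC cy0).
rewrite (card_moved_orbit (subxx C) dC dz) leqNgt => /negP; case.
by apply: (@leq_trans (3 + 3 + 3)) => //; rewrite !leq_add ?odd_prime_gt2.
Qed.

Let both d : d \in C -> d x0 = x0 -> d y0 = y0 -> d = 1.
Proof.
move=> dC dx dy; apply/permP => z; rewrite perm1.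
have [zO|zO] := boolP (z \in O); first exact: (fixO x0O zO dC dx).
have [zO'|zO'] := boolP (z \in O'); first exact: (fixO y0O' zO' dC dy).
exact: rest_fixed.
Qed.

(** If [O'] were bad as well, then [q x] would fix [O'] for [x] in [O], and all
    values of [q] on [O] would agree on both orbits. *)
Let inner_fix d : inner d -> d y0 = y0.
Proof.
move=> dI; apply/eqP; apply: contraT => dy0.
have qx0 x y : x \in O -> y \in O' -> q x y = y.
  move=> xO yO'; have e : q (q x y) * (q y)^-1 = q (q y x) * (q x)^-1.
    have := qP x y; rewrite (commC (qC x) (qC _)) (commC (qC y) (qC _)) => h.
    apply: (mulIg (q x)); rewrite mulgVK -mulgA -(commC (qC x)) ?groupV //.
    by rewrite mulgA h mulgK.
  have xyO' : q x y \in O' by exact: memO.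
  have yxO : q y x \in O by exact: memO.
  have e1 : q (q x y) * (q y)^-1 = 1.
    apply: both; first by rewrite groupM ?groupV.
      by rewrite e; exact: (bad_shift gI gx0).
    exact: (bad_shift dI dy0).
  by move/divg1_eq: e1; exact: (bad_inj dI dy0).
have gO : g x0 \in O by exact: (memO gI.1).
have e : q x0 * (q (g x0))^-1 = 1.
  apply: both; first by rewrite groupM ?groupV.
    exact: (bad_shift gI gx0).
  by rewrite permM (qx0 x0 y0) // -{1}(qx0 (g x0) y0) // permK.
move: gx0; rewrite -(bad_inj gI gx0 x0O gO) ?eqxx //.
exact: divg1_eq.
Qed.

(** An element fixing [O] that moves a point of [O'] inside its class is inner,
    which [inner_fix] forbids: points of [O'] are alone in their classes. *)
Let sep z d : z \in O' -> d \in C -> d x0 = x0 -> d z != z -> k (d z) = k z -> False.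
Proof.
move=> zO' dC dx dz kz.
have dI : inner d.
  split=> // u.
  have [uO|uO] := boolP (u \in O); first by rewrite (fixO x0O uO dC dx).
  have [uO'|uO'] := boolP (u \in O'); last by rewrite rest_fixed.
  have [i ->] : exists i, u = (d ^+ i) z.
    by apply: (orbit_cycle dC dz); rewrite (orbitO zO').
  rewrite -permM -expgSr expgS permM; apply: kC => //.
  by rewrite groupX.
by case/negP: dz; apply/eqP/(fixO y0O' zO' dC)/inner_fix.
Qed.

Let sep2 z w : z \in O' -> k w = k z -> w \in O' -> w = z.
Proof.
move=> zO' kwz wO'; apply/eqP; apply: contraT => wz.
have cz : c z != z.
  by apply: contra cy0 => /eqP cz; apply/eqP; exact: (fixO zO' y0O' cC cz).
have [i wE] : exists i, w = (c ^+ i) z.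
  by apply: (orbit_cycle cC cz); rewrite (orbitO zO').
case: (@sep z (c ^+ i)) => //; rewrite ?groupX -?wE //.
by elim: (i) => [|j IHj]; rewrite ?perm1 // expgSr permM IHj.
Qed.

Let sep3 z w : z \in O' -> w \notin O' -> c w = w -> k w <> k z.
Proof.
move=> zO' wO' cw kwz.
have cz : c z != z.
  by apply: contra cy0 => /eqP cz; apply/eqP; exact: (fixO zO' y0O' cC cz).
by case: (@sep z c) => //; rewrite -(kC cC kwz) cw.
Qed.

Lemma outer_element : ~ inner c.
Proof. by move=> /inner_fix /eqP; rewrite (negbTE cy0). Qed.

Variable S : {perm X} -> Prop.
Hypothesis S_k : forall s x, S s -> k (s x) = k x.
Hypothesis S_q : forall s x, S s -> inner (q x * (q (s x))^-1).
Hypothesis S_conj : forall s d, S s -> d \in C -> exists2 e, e \in C & S (d * s * e^-1).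

Lemma two_orbits_trivial s : S s -> s = 1.
Proof.
move=> Ss.
have qO x y : x \in O -> y \in O -> inner (q x * (q y)^-1) -> x = y.
  move=> xO yO xyI; apply: (bad_inj gI gx0) => //; apply: divg1_eq.
  apply: both; [exact: xyI.1| |exact: inner_fix].
  exact: (bad_shift gI gx0).
have sO x : x \in O -> s x = x.
  move=> xO; have [sxO|sxO] := boolP (s x \in O); first by apply/esym/qO/S_q.
  have [sxO'|sxO'] := boolP (s x \in O').
    case: (@sep3 (s x) x) => //; last by rewrite S_k.
      by apply/negP; exact: disj.
    exact: (fixO x0O xO cC cx0).
  have [e eC Se] := S_conj Ss gI.1.
  have zO : g^-1 x \in O by apply: memO => //; rewrite groupV gI.1.
  have se : (g * s * e^-1) (g^-1 x) = s x.
    by rewrite !permM permKV rest_fixed // groupV.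
  have i1 := S_q (g^-1 x) Se; rewrite se in i1.
  have i2 := S_q x Ss.
  have /(qO _ _ xO zO) xE : inner (q x * (q (g^-1 x))^-1).
    have -> : q x * (q (g^-1 x))^-1 =
        q x * (q (s x))^-1 * (q (g^-1 x) * (q (s x))^-1)^-1.
      by rewrite invMg invgK mulgA mulgVK.
    by apply: innerM => //; exact: innerV.
  have gx : g x = x by rewrite {1}xE permKV.
  by case/negP: gx0; apply/eqP; exact: (fixO xO x0O gI.1 gx).
have sO2 x : x \notin O -> s x \notin O.
  by apply: contra => sx; rewrite -(@perm_inj _ s _ _ (sO _ sx)).
apply/permP => x; rewrite perm1.
have [xO|xO] := boolP (x \in O); first exact: sO.
have [xO'|xO'] := boolP (x \in O').
  have [sxO'|sxO'] := boolP (s x \in O'); first by apply: sep2; rewrite ?S_k.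
  case: (@sep3 x (s x)) => //; last exact: S_k.
  by rewrite rest_fixed // sO2.
have [sxO'|sxO'] := boolP (s x \in O').
  case: (@sep3 (s x) x) => //; last by rewrite S_k.
  by rewrite rest_fixed.
have qfix u z : u \notin O -> u \notin O' -> z \in O -> q u z = z.
  move=> uO uO'; apply: (fixed_point_fixes gI gx0) => d dC.
  exact: rest_fixed.
have i1 := S_q x Ss; have e : q x * (q (s x))^-1 = 1.
  apply: both; [exact: i1.1| |exact: inner_fix].
  by rewrite permM qfix // -{1}(qfix (s x) x0) ?permK // sO2.
by apply/esym/kq; [rewrite S_k|exact: divg1_eq].
Qed.

End TwoOrbits.

(** A nontrivial [s] yields an inner [q x * (q (s x))^-1] that moves some bad
    orbit [O], and by [bad_stabilizer] an element of [C] fixing [O] and moving a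
    second orbit. In that configuration no inner element relates the values of
    [q] at two points of [O], the points of the second orbit are alone in their
    classes, and at the remaining points [q] fixes [O], so that an inner
    quotient of two of its values is 1. *)
Lemma class_kernel_trivial (S : {perm X} -> Prop) :
  (forall s x, S s -> k (s x) = k x) ->
  (forall s x, S s -> inner (q x * (q (s x))^-1)) ->
  (forall s d, S s -> d \in C -> exists2 e, e \in C & S (d * s * e^-1)) ->
  forall s, S s -> s = 1.
Proof.
move=> S_k S_q S_conj s Ss; apply/permP => x; rewrite perm1.
apply/eqP; apply: contraT => sx; pose g := q x * (q (s x))^-1.
have gI : inner g by exact: S_q.
have [g1|g1] := eqVneq g 1.
  by case/negP: sx; apply/eqP/kq; [exact: S_k|apply/esym/divg1_eq].
have [x0 gx0] : exists x0, g x0 != x0.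
  apply/existsP; apply: contraR g1; rewrite negb_exists => /forallP h.
  by apply/eqP/permP => u; rewrite perm1; apply/eqP; move: (h u); rewrite negbK.
have [c cC [cx0 c1]] := bad_stabilizer gI gx0.
have [y0 cy0] : exists y0, c y0 != y0.
  apply/existsP; apply: contraR c1; rewrite negb_exists => /forallP h.
  by apply/eqP/permP => u; rewrite perm1; apply/eqP; move: (h u); rewrite negbK.
by case/negP: sx; rewrite (two_orbits_trivial gI gx0 cC cx0 cy0 S_k S_q S_conj Ss) perm1.
Qed.

(** If [k] is constant every element of [C] is inner, whereas the stabilizer of
    a bad orbit contains an element that is not. *)
Lemma one_class_trivial : (forall x y, k x = k y) -> forall x y : X, x = y.
Proof.
move=> k1 x y; apply: kq => //.
have inC g : g \in C -> inner g by move=> gC; split.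
apply: divg1_eq; apply/eqP; apply: contraT => g1; set g := _ * _ in g1.
have gI : inner g by apply: inC; rewrite groupM ?groupV.
have [x0 gx0] : exists x0, g x0 != x0.
  apply/existsP; apply: contraR g1; rewrite negb_exists => /forallP h.
  by apply/eqP/permP => u; rewrite perm1; apply/eqP; move: (h u); rewrite negbK.
have [c cC [cx0 c1]] := bad_stabilizer gI gx0.
have [y0 cy0] : exists y0, c y0 != y0.
  apply/existsP; apply: contraR c1; rewrite negb_exists => /forallP h.
  by apply/eqP/permP => u; rewrite perm1; apply/eqP; move: (h u); rewrite negbK.
by case: (outer_element gI gx0 cC cx0 cy0); exact: inC.
Qed.

End OddPGroup.

Local Close Scope group_scope.

(** * Cabling *)

Local Open Scope ring_scope.

(** The cabling of [rho] by [k], whose cycle set has the rows of the vectors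
    [unitv x *~ k]. *)
Definition cable (X : finType) (rho : vec X -> {perm X}) (k : int) (v : vec X) :=
  rho (v *~ k).

Section Cabling.
Variables (X : finType) (rho : vec X -> {perm X}).
Hypothesis rhoM : brace_map rho.
Implicit Types v w u : vec X.

Lemma vmul_cable k v w : vmul (cable rho k) v w *~ k = vmul rho (v *~ k) (w *~ k).
Proof. by rewrite /vmul /cable mulrzDl vact_mulz. Qed.

Lemma cableM k : brace_map (cable rho k).
Proof. by move=> v w; rewrite {1}/cable vmul_cable rhoM. Qed.

Lemma cable_row_stable u x y k :
  rho (unitv x *~ k) = rho (unitv y *~ k) ->
  rho (unitv (rho u x) *~ k) = rho (unitv (rho u y) *~ k).
Proof.
move=> /(rho_eq rhoM) e; apply/(rho_eq rhoM).
have := rho_conjV rhoM u e.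
by rewrite vactB !vact_mulz !vact_unitv !invgK.
Qed.

(** With [U] the sum of the powers of [w] below [l], Bezout makes a multiple of
    [U] a fixed point of [w] modulo the kernel. Hence a vector killed by [q]
    cannot give a permutation of order prime to [q]. *)
Lemma rho_order q l w : coprime q l ->
  rho (w *~ q%:Z) = 1%g -> (rho w ^+ l)%g = 1%g -> rho w = 1%g.
Proof.
move=> ql wq wl; pose z := vpow rho w l; pose U := \sum_(i < l) vpow rho w i.
have UE : U + z = w *+ l + vact (rho w) U by exact: vpow_sum.
have z1 : rho z = 1%g.
  rewrite -wl /z; elim: (l) => [|n IHn]; first by rewrite expg0 rho0.
  by rewrite /= rhoM IHn expgS.
have [[a b] ab] : exists ab : int * int, ab.1 * l%:Z + ab.2 * q%:Z = 1.
  have /coprimezP[[a b] ab] : coprimez l q by rewrite /coprimez /gcdz /= gcdnC (eqP ql).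
  by exists (a, b).
have E : vmul rho w (U *~ a) = (z *~ a + (w *~ q%:Z) *~ b) + U *~ a.
  rewrite /vmul vact_mulz -(mulrzA _ q%:Z) [q%:Z * b]mulrC.
  have -> : (w *~ (b * q%:Z) = w - w *~ (a * l%:Z)).
    by rewrite -[in w - _](mulr1z w) -mulrzBr -ab addrAC subrr add0r.
  have -> : vact (rho w) U = U + z - w *+ l by rewrite UE addrAC subrr add0r.
  rewrite mulrzBl mulrzDl pmulrn -mulrzA [l%:Z * a]mulrC.
  by rewrite [z *~ a + _]addrCA -[RHS]addrA -[U *~ a + _ - _]addrA [U *~ a + _]addrC.
apply: (mulIg (rho (U *~ a))); rewrite mul1g -rhoM E rhoDl //.
by rewrite rhoDl // rho_mulz.
Qed.

(** The product of [c] and [t] is their product in the other order, after each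
    of them has acted on the vector of the other one. *)
Lemma rho_exchange c t (t1 := vact (rho c) t) (c' := vact (rho t1)^-1%g c) :
  (rho c * rho t = rho t1 * rho c')%g.
Proof.
rewrite -!rhoM /vmul /c' -vactM mulgV vact1.
by rewrite addrC.
Qed.

End Cabling.

(** The class [q * m] splits the brace into a [p]-part, the multiples of [m],
    and a [p']-part, the multiples of [q]; [a] and [b] are the two idempotents.
    The permutations of both parts form groups of coprime orders. *)
Section OddPrime.
Variables (X : finType) (rho : vec X -> {perm X}) (p e m : nat) (a b : int).
Hypotheses (rhoM : brace_map rho) (rho_inj : injective (fun x => rho (unitv x))).
Hypotheses (X8 : (#|X| <= 8)%N) (p_pr : prime p) (p_odd : odd p).
Let q := (p ^ e)%N.
Hypotheses (pm : coprime p m) (cl : forall v, rho (v *~ (q * m)%:Z) = 1%g).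
Hypotheses (am : (m %| a)%Z) (bq : (q %| b)%Z) (ab : a + b = 1).

Definition multiple_set (n : nat) : {set {perm X}} :=
  [set s | `[< exists v, s = rho (v *~ n%:Z) >]].

Lemma multiple_setP n s : reflect (exists v, s = rho (v *~ n%:Z)) (s \in multiple_set n).
Proof. by rewrite inE; apply: asboolP. Qed.

Lemma multiple_group_set n : group_set (multiple_set n).
Proof.
apply/group_setP; split.
  by apply/multiple_setP; exists 0; rewrite mul0rz rho0.
move=> s t /multiple_setP[v ->] /multiple_setP[w ->].
by apply/multiple_setP; exists (vmul (cable rho n) v w); rewrite vmul_cable rhoM.
Qed.

Let C := Group (multiple_group_set m).
Let H := Group (multiple_group_set q).

Let memC v : (m %| v)%Z -> forall u, rho (u *~ v) \in C.
Proof.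
case/dvdzP => d -> u; apply/multiple_setP; exists (u *~ d)%R.
by rewrite mulrzA.
Qed.

Local Open Scope group_scope.

Let Cp : p.-group C.
Proof.
apply/pgroupP => l l_pr /(Cauchy l_pr)[s /multiple_setP[v ->] sl].
rewrite inE /=; apply: contraT => lp.
have co : coprime q l.
  by apply: coprimeXl; rewrite prime_coprime // dvdn_prime2 // eq_sym.
have := rho_order rhoM co (w := (v *~ m)%R); rewrite -mulrzA -PoszM mulnC cl.
move=> /(_ erefl); rewrite -sl expg_order => /(_ erefl) s1.
by move: l_pr; rewrite -sl s1 order1.
Qed.

Let CH : coprime #|H| #|C|.
Proof.
have [n ->] := p_natP Cp; apply: coprimeXr.
rewrite coprime_sym prime_coprime //; apply/negP => /(Cauchy p_pr)[s /multiple_setP[v ->] sp].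
have co : coprime m p by rewrite coprime_sym.
have := rho_order rhoM co (w := (v *~ q)%R); rewrite -mulrzA -PoszM cl.
move=> /(_ erefl); rewrite -sp expg_order => /(_ erefl) s1.
by move: p_pr; rewrite -sp s1 order1.
Qed.


Let pb x := rho (unitv x *~ b)%R.
Let qa x := rho (unitv x *~ a)%R.

Let memH v u : (q %| v)%Z -> rho (u *~ v)%R \in H.
Proof.
case/dvdzP => d ->; apply/multiple_setP; exists (u *~ d)%R.
by rewrite mulrzA.
Qed.

Let stable u x y : pb x = pb y -> pb (rho u x) = pb (rho u y).
Proof. exact: cable_row_stable. Qed.

Let S (s : {perm X}) := s \in H /\ forall x, pb (s x) = pb x.


Let exchange := rho_exchange rhoM.

(** On the classes of [pb] the element [t1] of the [p']-part acts as an element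
    of the [p]-part, because [t] acts trivially; as the two orders are coprime,
    both act trivially. *)
Let conj_kernel c0 t0 (c := (c0 *~ m%:Z)%R) (t := (t0 *~ q%:Z)%R)
    (t1 := vact (rho c) t) (c' := vact (rho t1)^-1 c) :
  (forall x, pb (rho t x) = pb x) ->
  (forall x, pb (rho t1 x) = pb x) /\ (forall x, pb ((rho c * (rho c')^-1) x) = pb x).
Proof.
move=> tS; set g := rho c * (rho c')^-1.
have gC : g \in C.
  rewrite /g /c' /c vact_mulz groupM ?groupV //; apply: memC; exact: dvdzz.
have hH : rho t1 \in H by rewrite /t1 /t vact_mulz; apply: memH; exact: dvdzz.
have [v gE] : exists v, g = rho v.
  by case/multiple_setP: gC => v ->; exists (v *~ m)%R.
have hE : rho t1 = rho c * rho t * (rho c')^-1 by rewrite exchange -/t1 -/c' mulgK.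
have hg x : pb (rho t1 x) = pb (g x).
  by rewrite hE /g !permM -(rhoV rhoM c'); apply: stable; exact: tS.
have hgn n x : pb ((rho t1 ^+ n) x) = pb ((g ^+ n) x).
  elim: n => [|n IHn]; first by rewrite !expg0.
  rewrite !expgSr permM [in RHS]permM hg; have := IHn; rewrite gE; exact: stable.
have [n [n1 n2]] : exists n, (n = 0 %[mod #|H|] /\ n = 1 %[mod #|C|])%N.
  exists (chinese #|H| #|C| 0 1)%N.
  by rewrite chinese_modl // chinese_modr.
have g1 x : pb (g x) = pb x.
  have := hgn n x; rewrite -(expg_mod n (expg_cardG hH)) n1 mod0n expg0 perm1.
  by rewrite -(expg_mod n (expg_cardG gC)) n2 expg_mod ?expg_cardG // expg1.
by split=> // x; rewrite hg.
Qed.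


Let kS (s : {perm X}) := exists t0, s = rho (t0 *~ q%:Z)%R /\ forall x, pb (s x) = pb x.

Let q_cycle : cycle_set qa.
Proof. exact: rows_cycle_set (cableM rhoM a). Qed.

Let qC x : qa x \in C. Proof. exact: memC. Qed.

Let kq x y : pb x = pb y -> qa x = qa y -> x = y.
Proof.
move=> /(rho_eq rhoM) eb /(rho_eq rhoM) ea; apply: rho_inj; apply/(rho_eq rhoM).
have -> : (unitv x - unitv y = (unitv x *~ a - unitv y *~ a) + (unitv x *~ b - unitv y *~ b))%R.
  by rewrite -!mulrzBl -mulrzDr ab.
by rewrite rhoDl.
Qed.

Let kC c x y : c \in C -> pb x = pb y -> pb (c x) = pb (c y).
Proof. by case/multiple_setP=> v ->; exact: stable. Qed.

Let kS_conj s d : kS s -> d \in C -> exists2 e, e \in C & kS (d * s * e^-1).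
Proof.
case=> t0 [-> tS] /multiple_setP[c0 ->].
set c := (c0 *~ m%:Z)%R; set t := (t0 *~ q%:Z)%R in tS *.
pose t1 := vact (rho c) t; pose c' := vact (rho t1)^-1 c.
exists (rho c'); first by rewrite /c' /c vact_mulz; exact/memC/dvdzz.
rewrite exchange -/t1 -/c' mulgK; exists (vact (rho c) t0).
split; first by rewrite /t1 vact_mulz.
by have [] := conj_kernel c0 tS.
Qed.

Let kS_q s x : kS s -> inner C pb (qa x * (qa (s x))^-1).
Proof.
case=> t0 [-> tS]; have [a' aE] := dvdzP am.
set t := (t0 *~ q%:Z)%R in tS *; pose c := (unitv x *~ a)%R.
split; first by rewrite groupM ?groupV.
have cE : c = ((unitv x *~ a') *~ m%:Z)%R by rewrite /c aE mulrzA.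
pose d := vinv rho c.
pose d0 := (- vact (rho c)^-1 (unitv x *~ a'))%R.
have dE : d = (d0 *~ m%:Z)%R by rewrite /d /vinv {2}cE vact_mulz mulNrz.
have [h1 _] := conj_kernel d0 tS.
have tE : vact (rho c) (vact (rho d) t) = t by rewrite -vactM rhoV // mulgV vact1.
have := @conj_kernel (unitv x *~ a')%R (vact (rho d) t0).
rewrite -[(vact _ t0 *~ _)%R]vact_mulz -/t -cE /= tE; rewrite -/t -dE in h1.
case/(_ h1) => _ h2 z; rewrite -[RHS]h2.
by rewrite {2}/c vact_mulz vact_unitv invgK.
Qed.

(** Two classes with the same action on classes differ by an element of the
    [p']-part that acts trivially on all classes. By [conj_kernel] such
    elements satisfy the hypotheses of [class_kernel_trivial], so it is 1. *)
Lemma cabled_retract_irretractable x y :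
  (forall z, pb (pb x z) = pb (pb y z)) -> pb x = pb y.
Proof.
move=> xy; apply/(divg1_eq); apply: (class_kernel_trivial X8 p_pr p_odd Cp qC q_cycle kq kC (S := kS)).
- by move=> s z [t0 [_]].
- by move=> s z; exact: kS_q.
- by move=> s d; exact: kS_conj.
have : pb x * (pb y)^-1 \in H by rewrite groupM ?groupV ?memH.
case/multiple_setP => v vE; exists v; split=> // z.
by rewrite permM -[in RHS](permK (pb y) z) /pb -!(rhoV rhoM); apply: stable.
Qed.

Lemma cabled_retract_nontrivial : (forall x y, pb x = pb y) -> forall x y : X, x = y.
Proof. exact: (one_class_trivial X8 p_pr p_odd Cp qC q_cycle kq). Qed.

End OddPrime.

Local Close Scope ring_scope.

(** * Morphisms *)

Local Open Scope ring_scope.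

Definition irretractable (X : finType) (rho : vec X -> {perm X}) : Prop :=
  injective (fun x => rho (unitv x)).

Definition brace_morph (X Y : finType) (rhoX : vec X -> {perm X})
    (rhoY : vec Y -> {perm Y}) (f : X -> Y) : Prop :=
  forall x y, f (rhoX (unitv x) y) = rhoY (unitv (f x)) (f y).

(** The inverse of [unitv x] is the opposite of a basis vector, that of the
    diagonal point [rho (unitv x) x]. *)
Lemma rho_diag_inj (X : finType) (rho : vec X -> {perm X}) :
  brace_map rho -> injective (fun x => rho (unitv x) x).
Proof.
move=> rhoM; have D x : rho (- unitv (rho (unitv x) x)) = (rho (unitv x))^-1%g.
  by rewrite -rhoV // /vinv vact_unitv invgK.
move=> x y /= xy; have /invg_inj e : (rho (unitv x))^-1%g = (rho (unitv y))^-1%g.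
  by rewrite -!D xy.
by move: xy; rewrite e => /perm_inj.
Qed.

Lemma row_brace (X : finType) (p : X -> {perm X}) : cycle_set p ->
  exists2 rho, brace_map rho & forall x, rho (unitv x) = p x.
Proof.
case/cycle_set_brace => rho rhoM rhoE; exists rho => // x.
by have := rhoE [:: (x, false)]; rewrite /ev /= /sdmul /= vact0 addr0 mulg1.
Qed.

Section Push.
Variables (X Y : finType) (rhoX : vec X -> {perm X}) (rhoY : vec Y -> {perm Y}).
Variable f : X -> Y.
Hypotheses (XM : brace_map rhoX) (YM : brace_map rhoY) (fM : brace_morph rhoX rhoY f).

Definition push (v : vec X) : vec Y := \sum_x unitv (f x) *~ v x.

Lemma pushD v w : push (v + w) = push v + push w.
Proof. by rewrite /push -big_split; apply: eq_bigr => x _; rewrite ffunE mulrzDr. Qed.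

Lemma push_mulz v k : push (v *~ k) = push v *~ k.
Proof.
rewrite /push (big_morph (fun u => u *~ k) (fun a b => mulrzDl k a b) (mul0rz _ k)).
apply: eq_bigr => x _.
by rewrite ffunMzE mulrzz mulrzA.
Qed.

Lemma push0 : push 0 = 0.
Proof. by rewrite /push big1 // => x _; rewrite ffunE mulr0z. Qed.

Lemma push_unitv x : push (unitv x) = unitv (f x).
Proof.
rewrite /push (bigD1 x) //= unitvE eqxx big1 ?addr0 // => y yx.
by rewrite unitvE (negbTE yx) mulr0z.
Qed.

(** Extending to inverses rests on [rho_diag_inj]: applied at the point [x], the
    identity for [v + unitv x] returns the one for [v]. *)
Lemma brace_morphE v y : f (rhoX v y) = rhoY (push v) (f y).
Proof.
move: v y; apply: vec_ind => [y|v x]; first by rewrite push0 !rho0 // !perm1.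
have E y : f (rhoX (v + unitv x) y) = rhoY (unitv (f (rhoX v x))) (f (rhoX v y)).
  by rewrite rho_unitvD // permM fM.
have E' y : rhoY (push (v + unitv x)) (f y) =
    rhoY (unitv (rhoY (push v) (f x))) (rhoY (push v) (f y)).
  by rewrite pushD push_unitv rho_unitvD // permM.
split=> h y; first by rewrite E E' !h.
have e : f (rhoX v x) = rhoY (push v) (f x).
  by apply: (rho_diag_inj YM); rewrite -E h E'.
by apply: (@perm_inj _ (rhoY (unitv (f (rhoX v x))))); rewrite -E h E' e.
Qed.

Lemma push_vact v w : push (vact (rhoX v) w) = vact (rhoY (push v)) (push w).
Proof.
rewrite /push (big_morph (vact _) (vactD _) (vact0 _)).
rewrite [RHS](reindex_inj (@perm_inj _ (rhoX v))); apply: eq_bigr => x _ /=.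
by rewrite brace_morphE vact_mulz vact_unitv permK ffunE.
Qed.

Lemma push_vmul v w : push (vmul rhoX v w) = vmul rhoY (push v) (push w).
Proof. by rewrite pushD push_vact. Qed.

Lemma brace_morph_cable k : brace_morph (cable rhoX k) (cable rhoY k) f.
Proof. by move=> x y; rewrite /cable brace_morphE push_mulz push_unitv. Qed.

Lemma push_inj0 v : injective f -> push v = 0 -> v = 0.
Proof.
move=> fI v0; apply/ffunP => x; rewrite ffunE; move/ffunP/(_ (f x)): v0.
rewrite sum_ffunE ffunE (bigD1 x) //= big1 => [|y yx]; rewrite !(ffunMzE, unitvE).
  by rewrite eqxx addr0 intz.
by rewrite (inj_eq fI) eq_sym (negbTE yx) mul0rz.
Qed.

(** The extension of an injective morphism to vectors is an injective homomorphism. *)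
Lemma promislow_push : injective f -> has_promislow rhoX -> has_promislow rhoY.
Proof.
move=> fI [v [w [[e1 e2] vw]]]; exists (push v), (push w).
split; first by rewrite /vec_pair -!push_vmul e1 e2.
by case: vw => h; [left|right] => /push_inj0 => /(_ fI).
Qed.

Lemma surj_push_trivial k : (forall y, exists x, f x = y) ->
  (forall v, rhoX (v *~ k) = 1%g) -> forall w, rhoY (w *~ k) = 1%g.
Proof.
move=> fS X1 w; have [v <-] : exists v, push v = w.
  have [g gK] := choice fS.
  exists (\sum_y unitv (g y) *~ w y).
  rewrite (big_morph push pushD push0) [RHS]vec_sum; apply: eq_bigr => y _.
  by rewrite push_mulz push_unitv gK.
apply/permP => y; have [x <-] := fS y.
by rewrite -push_mulz -brace_morphE X1 !perm1.
Qed.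

End Push.

(** Multiplication by [k] embeds the group of the cabled brace in the group of
    [rho]. *)
Lemma promislow_cable (X : finType) (rho : vec X -> {perm X}) k : k != 0 ->
  has_promislow (cable rho k) -> has_promislow rho.
Proof.
move=> k0 [v [w [[e1 e2] vw]]]; exists (v *~ k), (w *~ k).
split.
  move: e1 e2 (vmul_cable rho k); rewrite /vec_pair.
  move: (vmul rho) (vmul (cable rho k)) => m m' e1 e2 mE.
  by rewrite -!mE e1 e2.
have z u : u *~ k = 0 -> u = 0 :> vec X.
  move=> /ffunP u0; apply/ffunP => x; have := u0 x.
  rewrite ffunMzE !ffunE mulrzz => /eqP; rewrite mulf_eq0 (negbTE k0) orbF.
  by move/eqP.
by case: vw => h; [left|right] => /z.
Qed.

Lemma brace_class (X : finType) (rho : vec X -> {perm X}) : brace_map rho ->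
  exists2 d, (0 < d)%N & forall v, rho (v *~ d%:Z) = 1%g.
Proof.
move=> rhoM; pose N := #|{: {perm X}}|; exists N`!; first exact: fact_gt0.
move=> v; rewrite {1}(vec_sum v).
rewrite (big_morph (fun u => u *~ N`!) (fun a b => mulrzDl N`! a b) (mul0rz _ N`!)).
apply: rho_sum => // x; rewrite -mulrzA mulrC mulrzA; apply: (rho_mulz rhoM).
have /injectivePn[i [j ij e]] : ~~ injectiveb (fun i : 'I_N.+1 => rho (unitv x *+ i)).
  apply/negP => /injectiveP/leq_card; rewrite card_ord -/N ltnn //.
wlog ltij : i j ij e / (i < j)%N.
  move=> h; case: (ltngtP i j) => [lt|lt|/val_inj lt]; first exact: h ij e lt.
    by apply: (h j i _ (esym e) lt); rewrite eq_sym.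
  by rewrite lt eqxx in ij.
have /dvdnP[c ->] : (j - i %| N`!)%N.
  by rewrite dvdn_fact // subn_gt0 ltij /= leq_subLR (leq_trans _ (leq_addl i N)) // -ltnS.
rewrite mulnC PoszM mulrzA; apply: (rho_mulz rhoM).
rewrite -pmulrn mulrnBr ?(ltnW ltij) //; exact/(rho_eq rhoM)/esym.
Qed.

Local Close Scope ring_scope.

(** * Quotients *)

Local Open Scope ring_scope.

Lemma row_cycle (X : finType) (rho : vec X -> {perm X}) k : brace_map rho ->
  cycle_set (fun x => rho (unitv x *~ k)).
Proof. by move=> rhoM; exact: rows_cycle_set (cableM rhoM k). Qed.

(** The rows induced on the fibres are onto, hence bijective as the set is
    finite. Points are represented by a canonical element of their fibre. *)
Lemma brace_quotient (X : finType) (rho : vec X -> {perm X}) (T : eqType) (h : X -> T) :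
  brace_map rho ->
  (forall x x' y y', h x = h x' -> h y = h y' ->
     h (rho (unitv x) y) = h (rho (unitv x') y')) ->
  exists (Z : finType) (rhoZ : vec Z -> {perm Z}) (f : X -> Z),
    [/\ brace_map rhoZ, brace_morph rho rhoZ f, forall z, exists x, f x = z
      & forall x y, f x = f y <-> h x = h y].
Proof.
move=> rhoM hP; pose rep x := odflt x [pick y | h y == h x].
have h_rep x : h (rep x) = h x.
  by rewrite /rep; case: pickP => [y /eqP|/(_ x)]; rewrite ?eqxx.
have rep_eq x y : h x = h y -> rep x = rep y.
  move=> xy; rewrite /rep xy; case: pickP => [//|/(_ y)].
  by rewrite eqxx.
pose Z : finType := {x : X | rep x == x}.
have repK x : rep (rep x) == rep x by apply/eqP/rep_eq.
pose f x : Z := exist _ (rep x) (repK x).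
have fE x y : f x = f y <-> h x = h y.
  split=> [/(congr1 val) /= xy|xy]; first by rewrite -h_rep xy h_rep.
  by apply: val_inj; exact: rep_eq.
have fK z : f (val z) = z by apply: val_inj; apply/eqP/(valP z).
pose pz (z w : Z) := f (rho (unitv (val z)) (val w)).
have fp x y : f (rho (unitv x) y) = pz (f x) (f y).
  by apply/fE/hP; apply/fE; rewrite fK.
have pz_inj z : injective (pz z).
  have [g gK] : exists g, cancel g (pz z).
    suff /choice[g gK] : forall w, exists u, pz z u = w by exists g.
    move=> w; exists (f ((rho (unitv (val z)))^-1%g (val w))).
    by rewrite -{1}(fK z) -fp permKV fK.
  exact: bij_inj (Bijective (canF_sym gK) gK).
have pP : cycle_set (fun z => perm (pz_inj z)).
  move=> z w; apply/permP => u; rewrite !permM !permE -(fK z) -(fK w) -(fK u) -!fp.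
  have /permP/(_ (val u)) := row_cycle 1 rhoM (val z) (val w).
  by rewrite !permM !mulr1z => ->.
have [rhoZ rhoZM rhoZE] := row_brace pP.
exists Z, rhoZ, f; split=> //; last by move=> z; exists (val z); exact: fK.
by move=> x y; rewrite rhoZE permE fp.
Qed.

Local Close Scope ring_scope.

(** * Iterated retractions *)

Local Open Scope ring_scope.

Section Tower.
Variables (X : finType) (r : X * X -> X * X).
Hypotheses (rP : is_solution r) (rK : involutive r).

(** The retractions have different carriers, so they are compared through their
    maps from [X]. *)
Fixpoint tower n : X -> yb_set (iter n Ret (YbMap r)) :=
  match n return X -> yb_set (iter n Ret (YbMap r)) with
  | 0%N => id
  | n.+1 => fun x => ret_class (@yb_map (iter n Ret (YbMap r))) (tower n x)
  end.

Local Notation rn n := (@yb_map (iter n Ret (YbMap r))).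

Lemma tower_sol n : is_solution (rn n) /\ involutive (rn n).
Proof.
elim: n => [//|n [sn kn]]; split; first exact: (ret_solution sn kn).
exact: (ret_involutive sn kn).
Qed.

Lemma tower_surj n a : exists x, tower n x = a.
Proof.
elim: n a => [|n IHn] a; first by exists a.
have [b ->] := ret_class_surj a; have [x <-] := IHn b; by exists x.
Qed.

Lemma tower_sigma n x y : sigma (rn n) (tower n x) (tower n y) = tower n (sigma r x y).
Proof.
suff: rn n (tower n x, tower n y) = (tower n (sigma r x y), tower n (tau r y x)).
  by rewrite /sigma => ->.
elim: n x y => [|n IHn] x y; first by rewrite /= [LHS]surjective_pairing.
have [sn kn] := tower_sol n.
rewrite [LHS](ret_mapE sn kn (tower n x) (tower n y)).
by rewrite {1}/sigma {1}/tau IHn.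
Qed.

Lemma tower_perm n x x' y y' : tower n x = tower n x' -> tower n y = tower n y' ->
  tower n (sol_perm rP x y) = tower n (sol_perm rP x' y').
Proof.
move=> xx' yy'; have [sn _] := tower_sol n.
apply: (bij_inj (sol_sigma_bij sn (tower n x))).
by rewrite tower_sigma sol_permK xx' tower_sigma sol_permK.
Qed.

Lemma tower_retract n x y :
  (forall z, tower n (sol_perm rP x z) = tower n (sol_perm rP y z)) ->
  tower n.+1 x = tower n.+1 y.
Proof.
move=> xy; apply/ret_classP/funext => a.
have [w <-] := tower_surj a; rewrite !tower_sigma.
have wE : w = sol_perm rP x (sigma r x w) by rewrite sol_sigma permKV.
by rewrite [in RHS]wE -[RHS]tower_sigma xy tower_sigma sol_permK.
Qed.

(** The number of identified pairs grows strictly until two successive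
    retractions agree. *)
Lemma tower_stable : exists2 n, (0 < n)%N &
  forall x y, tower n.+1 x = tower n.+1 y -> tower n x = tower n y.
Proof.
pose K n := #|[set u : X * X | tower n u.1 == tower n u.2]|.
have KS n : (K n <= K n.+1)%N.
  by apply/subset_leq_card/subsetP => u; rewrite !inE /= => /eqP->.
apply: contrapT => no.
have Klt n : (0 < n)%N -> (K n < K n.+1)%N.
  move=> n0; rewrite ltn_neqAle KS andbT; apply/negP => /eqP e.
  apply: no; exists n => // x y xy.
  have sub : [set u : X * X | tower n u.1 == tower n u.2] \subset
             [set u | tower n.+1 u.1 == tower n.+1 u.2].
    by apply/subsetP => u; rewrite !inE /= => /eqP->.
  have /eqP/setP/(_ (x, y)) : [set u : X * X | tower n u.1 == tower n u.2] ==
             [set u | tower n.+1 u.1 == tower n.+1 u.2].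
    by rewrite eqEcard sub /= -[X in (X <= _)%N]/(K n.+1) -e.
  by rewrite !inE xy eqxx => /eqP.
have Kn n : (n <= K n.+1)%N.
  by elim: n => // n IHn; apply: leq_ltn_trans IHn (Klt _ _).
have := Kn #|{: X * X}|.+1; rewrite leqNgt => /negP; apply.
exact: max_card.
Qed.

(** The stable term of the tower is irretractable, and it has two points since
    the solution is not a multipermutation solution. When the map is not
    injective, the first retraction already identifies two points, and these
    have equal rows. *)
Lemma irretractable_image (rho : vec X -> {perm X}) :
  brace_map rho -> (forall x, rho (unitv x) = sol_perm rP x) ->
  ~ multipermutation r ->
  exists (Z : finType) (rhoZ : vec Z -> {perm Z}) (f : X -> Z),
    [/\ brace_map rhoZ, irretractable rhoZ, exists z z' : Z, z <> z' &
     [/\ brace_morph rho rhoZ f, forall z, exists x, f x = z &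
       injective f \/ exists x y, [/\ x <> y, f x = f y & rho (unitv x) = rho (unitv y)]]].
Proof.
move=> rhoM rhoE nmp; have [n n0 nS] := tower_stable.
have not_one : exists x y, tower n x <> tower n y.
  apply: contrapT => no; apply: nmp; exists n => //.
  have [x0] := sol_nonempty rP; exists (tower n x0) => d.
  have [x <-] := tower_surj d; apply: contrapT => ne; apply: no.
  by exists x, x0.
case: (pselect (injective (fun x => rho (unitv x)))) => [inj|ninj].
  exists X, rho, id; split=> //.
    by have [x [y xy]] := not_one; exists x, y => e; apply: xy; rewrite e.
  by split=> //; [move=> z; exists z | left].
have [x [y [xy exy]]] : exists x y, x <> y /\ rho (unitv x) = rho (unitv y).
  apply: contrapT => no; apply: ninj => x y e; apply: contrapT => xy; apply: no.
  by exists x, y.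
have hP x1 x2 y1 y2 : tower n x1 = tower n x2 -> tower n y1 = tower n y2 ->
    tower n (rho (unitv x1) y1) = tower n (rho (unitv x2) y2).
  by rewrite !rhoE; exact: tower_perm.
have [Z [rhoZ [f [ZM fM fS fE]]]] := brace_quotient rhoM hP.
exists Z, rhoZ, f; split=> //.
- move=> z z' /=; have [u <-] := fS z; have [v <-] := fS z' => e.
  apply/fE/nS/tower_retract => w; apply/fE.
  by rewrite -!rhoE !fM e.
- have [u [v uv]] := not_one; exists (f u), (f v); exact/fE.
split=> //; right; exists x, y; split=> //; apply/fE.
case: (n) n0 => // m _; elim: m => [|m IHm]; last exact: (congr1 (fun u => ret_class (rn m.+1) u) IHm).
by apply: tower_retract => z; rewrite -!rhoE exy.
Qed.

End Tower.

Local Close Scope ring_scope.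

(** * Reduction to 2-power class *)

Local Open Scope ring_scope.

Section Reduction.
Variables (X : finType) (rho : vec X -> {perm X}).
Hypotheses (rhoM : brace_map rho) (X8 : (#|X| <= 8)%N).

(** An irretractable image [Z] of the cabling of [rho] by [k], of class [d].
    The last clause says that the failure of injectivity of [f] is witnessed by
    two points with equal rows; it is what makes the fibres of size two
    tractable later. *)
Record reduction (k : int) (d : nat) (Z : finType) (rhoZ : vec Z -> {perm Z})
    (f : X -> Z) : Prop := Reduction {
  red_brace : brace_map rhoZ;
  red_irr : irretractable rhoZ;
  red_nontriv : exists z z' : Z, z <> z';
  red_morph : brace_morph (cable rho k) rhoZ f;
  red_surj : forall z, exists x, f x = z;
  red_class : forall w, rhoZ (w *~ d%:Z) = 1%g;
  red_fibre : injective f \/ exists x y,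
    [/\ x <> y, f x = f y & rho (unitv x *~ k) = rho (unitv y *~ k)] }.

Lemma crt_int q m : coprime q m -> (0 < q)%N -> (0 < m)%N ->
  exists b : nat, [/\ (0 < b)%N, (q %| b)%N & (m%:Z %| 1 - b%:Z)%Z].
Proof.
move=> qm q0 m0; exists (chinese q m 0 1 + q * m)%N; split.
- by rewrite addn_gt0 muln_gt0 q0 m0 orbT.
- by rewrite /dvdn -modnDmr mulnC modnMl addn0 chinese_modl // mod0n.
rewrite -eqz_mod_dvd !modz_nat eqz_nat -modnDmr modnMl addn0.
by rewrite chinese_modr.
Qed.

Lemma cable_cable (Y : finType) (rho' : vec Y -> {perm Y}) k b v : cable (cable rho' k) b v = cable rho' (b * k) v.
Proof. by rewrite /cable mulrzA. Qed.

(** Cabling by a factor congruent to 0 modulo the [p]-part of the class and to 1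
    modulo the rest kills the prime [p]; the retraction of the result is
    irretractable with at least two points. The factor is also chosen congruent
    to 1 modulo [J]. *)
Lemma reduction_step k J d Z rhoZ f p :
  @reduction k d Z rhoZ f -> (0 < J)%N -> coprime p J -> (J%:Z %| 1 - k)%Z -> 0 < k ->
  prime p -> odd p -> (p %| d)%N -> (0 < d)%N ->
  exists k' d' (Z' : finType) (rhoZ' : vec Z' -> {perm Z'}) (f' : X -> Z'),
    [/\ reduction k' d' rhoZ' f', (J%:Z %| 1 - k')%Z, 0 < k', (0 < d')%N & (d' < d)%N].
Proof.
move=> red J0 pJ Jk k0 p_pr p_odd pd d0.
have [m pm dE] := pfactor_coprime p_pr d0; set e := logn p d in dE.
have m0 : (0 < m)%N by move: d0; rewrite dE muln_gt0 => /andP[].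
have [b [b0 qb mb]] : exists b : nat, [/\ (0 < b)%N, (p ^ e %| b)%N & ((m * J)%N%:Z %| 1 - b%:Z)%Z].
  apply: crt_int; first by rewrite coprimeMr !coprimeXl.
    by rewrite expn_gt0 prime_gt0.
  by rewrite muln_gt0 m0.
have Zc : brace_map (cable rhoZ b) by exact/cableM/(red_brace red).
have Z8 : (#|Z| <= 8)%N.
  have [g gK] := choice (red_surj red).
  by apply: leq_trans X8; apply: (@leq_card _ _ g); exact: can_inj gK.
have mb' : (m%:Z %| 1 - b%:Z)%Z.
  by apply: dvdz_trans mb; rewrite PoszM dvdz_mulr.
have cl v : rhoZ (v *~ (p ^ e * m)%N%:Z) = 1%g by rewrite mulnC -dE; exact: red_class red v.
have qb' : ((p ^ e)%N%:Z %| b%:Z)%Z by rewrite dvdzE.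
have ab : 1 - b%:Z + b%:Z = 1 :> int by rewrite subrK.
have irr := cabled_retract_irretractable (red_brace red) (red_irr red) Z8 p_pr p_odd pm cl mb' qb' ab.
have nt := cabled_retract_nontrivial (red_brace red) (red_irr red) Z8 p_pr p_odd cl mb' ab.
pose h z := rhoZ (unitv z *~ b).
have hP z z' w w' : h z = h z' -> h w = h w' ->
    h (cable rhoZ b (unitv z) w) = h (cable rhoZ b (unitv z') w').
  move=> zz' ww'; rewrite /cable -/(h z) zz'.
  exact: (@cable_row_stable _ _ (red_brace red) (unitv z' *~ b)).
have [W [rhoW [g [WM gM gS gE]]]] := brace_quotient Zc hP.
have fM : brace_morph (cable (cable rho k) b) (cable rhoZ b) f.
  by apply: brace_morph_cable; [exact: cableM|exact: red_brace red|exact: red_morph red].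
exists (b%:Z * k), m, W, rhoW, (g \o f); split.
- split=> //.
  + move=> w w'; have [z <-] := gS w; have [z' <-] := gS w' => /= e'.
    apply/gE/irr => u; apply/gE; rewrite -![rhoZ (unitv _ *~ _) _]/(cable rhoZ b (unitv _) _).
    by rewrite !gM e'.
  + apply: contrapT => no.
    have [z [z' zz']] := red_nontriv red; apply/zz'/nt => x y.
    suff /gE : g x = g y by [].
    by apply: contrapT => ne; apply: no; exists (g x), (g y).
  + by move=> x y /=; rewrite -cable_cable fM gM.
  + by move=> w; have [z <-] := gS w; have [x <-] := red_surj red z; exists x.
  + apply: (surj_push_trivial Zc WM gM gS) => v.
    have /dvdnP[c ->] := qb; rewrite /cable -mulrzA -PoszM.
    by rewrite mulnCA [(m * _)%N]mulnC PoszM mulrzA cl.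
  have [fI|[x [y [xy fxy exy]]]] := red_fibre red; last first.
    right; exists x, y; split=> //=; first by rewrite fxy.
    rewrite mulrC !mulrzA; apply/(rho_eq rhoM); rewrite -mulrzBl.
    by apply: (rho_mulz rhoM); apply/(rho_eq rhoM).
  have [gI|gnI] := pselect (injective g); first by left; exact: inj_comp.
  have [z [z' [zz' gzz']]] : exists z z', z <> z' /\ g z = g z'.
    apply: contrapT => no; apply: gnI => z z' e'; apply: contrapT => zz'; apply: no.
    by exists z, z'.
  have [x xz] := red_surj red z; have [x' xz'] := red_surj red z'.
  right; exists x, x'; split.
  + by move=> xx'; apply: zz'; rewrite -xz -xz' xx'.
  + by rewrite /= xz xz'.
  apply/permP => u; apply: fI.
  have /gE hz := gzz'.
  have E t : f (rho (unitv t *~ (b%:Z * k)) u) = h (f t) (f u).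
    by rewrite -[LHS]/(f (cable rho _ (unitv t) u)) -cable_cable fM.
  by rewrite !E xz xz' hz.
- have -> : 1 - b%:Z * k = (1 - k) + k * (1 - b%:Z) by rewrite mulrBr mulr1 [k * b]mulrC addrA subrK.
  rewrite rpredD ?dvdz_mull //; apply: dvdz_trans mb.
  by rewrite PoszM dvdz_mull.
- by rewrite mulr_gt0.
- by [].
rewrite dE -{1}(muln1 m) ltn_pmul2l // -(expn0 p) ltn_exp2l ?prime_gt1 //.
by rewrite /e logn_gt0 mem_primes p_pr d0.
Qed.

Lemma reduction_2power J k d Z rhoZ f :
  @reduction k d Z rhoZ f -> (0 < J)%N ->
  (forall p, prime p -> odd p -> coprime p J) ->
  (J%:Z %| 1 - k)%Z -> 0 < k -> (0 < d)%N ->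
  exists k' j (Z' : finType) (rhoZ' : vec Z' -> {perm Z'}) (f' : X -> Z'),
    [/\ reduction k' (2 ^ j) rhoZ' f', (J%:Z %| 1 - k')%Z & 0 < k'].
Proof.
move=> + J0 pJ.
have [n] := ubnP d; elim: n => // n IHn in k d Z rhoZ f * => dn red Jk k0 d0.
have [m modd dE] := pfactor_coprime (isT : prime 2) d0.
have [m1|m1] := leqP m 1.
  have m1' : m = 1%N by apply/eqP; rewrite eqn_leq m1; move: d0; rewrite dE muln_gt0 => /andP[].
  exists k, (logn 2 d), Z, rhoZ, f; split=> //.
  by move: dE red; rewrite m1' mul1n => <-.
have p_pr := pdiv_prime m1; have pm := pdiv_dvd m.
have p_odd : odd (pdiv m).
  by move: modd; rewrite coprime2n => /dvdn_odd; apply.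
have pd : (pdiv m %| d)%N by rewrite dE dvdn_mulr.
have [k' [d' [Z' [rhoZ' [f' [red' J' k'0 d'0 d'd]]]]]] :=
  reduction_step red J0 (pJ _ p_pr p_odd) Jk k0 p_pr p_odd pd d0.
by apply: (IHn k' d' Z' rhoZ' f') => //; apply: leq_trans d'd _.
Qed.

(** [J] is the 2-part of the class of [rho] and [M] its odd part. Since [J]
    divides [1 - k], multiples of [M * (1 - k)] are in the kernel. *)
Lemma reduction_exists Z rhoZ f d : @reduction 1 d Z rhoZ f -> (0 < d)%N ->
  exists k j M (Z' : finType) (rhoZ' : vec Z' -> {perm Z'}) (f' : X -> Z'),
    [/\ reduction k (2 ^ j) rhoZ' f', 0 < k, odd M
      & forall v, rho (v *~ (M%:Z * (1 - k))) = 1%g].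
Proof.
move=> red d0; have [D D0 cl] := brace_class rhoM.
have [M Modd DE] := pfactor_coprime (isT : prime 2) D0.
set J := (2 ^ logn 2 D)%N in DE.
have [|p p_pr p_odd|||//|k [j [Z' [rhoZ' [f' [red' Jk k0]]]]]] := @reduction_2power J 1 d Z rhoZ f red.
- by rewrite expn_gt0.
- by rewrite coprimeXr // coprimen2.
- by rewrite subrr dvdz0.
- by [].
exists k, j, M, Z', rhoZ', f'; split=> //; first by rewrite -coprime2n.
move=> v; have /dvdzP[c ->] := Jk.
by rewrite mulrCA -PoszM -DE mulrzA cl.
Qed.

End Reduction.

Local Close Scope ring_scope.

(** * Search for small cycle sets *)

(** Conditionals replace boolean connectives here and below, so that evaluation
    by value stops early. *)
Fixpoint forall_in (T : Type) (f : T -> bool) (s : seq T) : bool :=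
  if s is x :: s' then if f x then forall_in f s' else false else true.

Lemma forall_inE (T : Type) (f : T -> bool) s : forall_in f s = all f s.
Proof. by elim: s => //= x s ->; case: (f x). Qed.

Fixpoint first_some (T U : Type) (f : T -> option U) (s : seq T) : option U :=
  if s is x :: s' then if f x is Some u then Some u else first_some f s' else None.

Fixpoint row_eq (r r' : seq nat) : bool :=
  match r, r' with
  | [::], [::] => true
  | a :: s, b :: s' => if eqn a b then row_eq s s' else false
  | _, _ => false
  end.

Lemma row_eqP r r' : reflect (r = r') (row_eq r r').
Proof.
elim: r r' => [|a s IHs] [|b s'] /=; try by constructor.
case: (@eqnP a b) => [<-|ab]; last by constructor => -[].
by apply: (iffP (IHs s')) => [->|[]].
Qed.

Fixpoint row_lt (r r' : seq nat) : bool :=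
  match r, r' with
  | a :: s, b :: s' => if eqn a b then row_lt s s' else a < b
  | _, _ => false
  end.

(** A partial table is a sequence of rows, the empty row standing for a row that
    is not yet known. *)
Definition row (st : seq (seq nat)) x := nth [::] st x.

Section Search.
Variable n : nat.
Let pts := iota 0 n.

Definition law_at st x y : bool :=
  let rx := row st x in let ry := row st y in
  let ru := row st (nth 0 rx y) in let rv := row st (nth 0 ry x) in
  if nilp ru then true else if nilp rv then true else
  forall_in (fun z => eqn (nth 0 ru (nth 0 rx z)) (nth 0 rv (nth 0 ry z))) pts.

(** Rows and diagonal entries of an irretractable cycle set are distinct. *)
Definition pair_ok st y x : bool :=
  if eqn x y then true else
  if nilp (row st x) then true else
  if row_eq (row st x) (row st y) then false else
  if eqn (nth 0 (row st x) x) (nth 0 (row st y) y) then false else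
  law_at st x y.

Definition row_ok st y : bool :=
  if nilp (row st y) then true else forall_in (pair_ok st y) pts.

(** The identity determines the row of [p_y x] from the rows of [x], [y] and
    [p_x y]. *)
Definition forced st : option (nat * seq nat) :=
  first_some (fun x => if nilp (row st x) then None else
    first_some (fun y =>
      let ry := row st y in
      if nilp ry then None else
      let v := nth 0 ry x in
      if nilp (row st v) then
        let ru := row st (nth 0 (row st x) y) in
        if nilp ru then None else
        Some (v, [seq nth 0 ru (nth 0 (row st x) (index w ry)) | w <- pts])
      else None) pts) pts.

(** Rows are tried first where many instances of the identity can be checked. *)
Definition score st y : nat :=
  count (fun x => if nilp (row st x) then false
                  else ~~ nilp (row st (nth 0 (row st x) y))) pts.

Definition pick st : option nat :=
  (foldr (fun y (best : option nat * nat) =>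
    if nilp (row st y) then
      let s := (score st y).+1 in
      if best.2 <= s then (Some y, s) else best
    else best) (None, 0) pts).1.

Variables (closed leaf : seq (seq nat) -> bool).

Fixpoint search (fuel : nat) (allowed : seq (seq (seq nat))) st : bool :=
  if fuel is fuel'.+1 then
    if ~~ forall_in (row_ok st) pts then true else
    if closed st then true else
    let try y r := let st' := set_nth [::] st y r in
      if row_ok st' y then search fuel' allowed st' else true in
    if forced st is Some (y, r) then
      if has (row_eq r) (nth [::] allowed y) then try y r else true
    else if pick st is Some y then forall_in (try y) (nth [::] allowed y)
    else leaf st
  else false.

Definition conj_row (h r : seq nat) : seq nat :=
  [seq index (nth 0 r y) h | y <- h].

(** The least conjugate of a row of [x] by a symmetry taking [x] to 0, or the
    empty row when no symmetry does. *)
Definition key (q : seq (seq nat)) (x : nat) (r : seq nat) : seq nat :=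
  foldr (fun h k => if eqn (nth 0 h 0) x then
      let r' := conj_row h r in
      if nilp k then r' else if row_lt r' k then r' else k
    else k) [::] q.

Definition preserves (d : nat) (l : seq nat) : bool :=
  forall_in (fun i => forall_in (fun j =>
    if eqn (i %/ d) (j %/ d) then eqn (nth 0 l i %/ d) (nth 0 l j %/ d) else true)
    pts) pts.

(** The permutations respecting the blocks of sizes 2 and 4: a Sylow
    2-subgroup of the symmetric group when [n] is at most 8. *)
Definition two_rows : seq (seq nat) :=
  [seq l <- permutations pts | if preserves 2 l then preserves 4 l else false].

(** Up to symmetry the row of 0 is one of [cs]. Taking the earliest class that
    occurs at all, rows in earlier classes may be discarded at every point. *)
Fixpoint search_classes (keys : seq (seq (seq nat * seq nat))) (cs : seq (seq nat)) : bool :=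
  if cs is c :: cs' then
    let allowed := [seq [seq rk.1 | rk <- ks] | ks <- keys] in
    if nilp c then false else
    if search n allowed (set_nth [::] (nseq n [::]) 0 c) then
      search_classes [seq [seq rk <- ks | ~~ row_eq rk.2 c] | ks <- keys] cs'
    else false
  else nilp (nth [::] keys 0).

Definition search_all : bool :=
  let q := two_rows in
  let keys := [seq [seq (r, key q x r) | r <- q] | x <- pts] in
  search_classes keys (rev (sort (fun a b => ~~ row_lt b a) (undup [seq rk.2 | rk <- nth [::] keys 0]))).

End Search.

Definition tableA := [:: [:: 1;0;2;3]; [:: 3;2;0;1]; [:: 0;1;3;2]; [:: 2;3;1;0]].
Definition tableB := [:: [:: 1;2;3;0]; [:: 3;0;1;2]; [:: 0;3;2;1]; [:: 2;1;0;3]].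

Definition subtable (t st : seq (seq nat)) (g : seq nat) : bool :=
  if uniq g then
  forall_in (fun i => let r := row st (nth 0 g i) in
    if nilp r then false else
    forall_in (fun j => eqn (nth 0 r (nth 0 g j)) (nth 0 g (nth 0 (nth [::] t i) j))) (iota 0 4)) (iota 0 4)
  else false.

(** In [tableA] the four points are the iterates of a point under the diagonal
    map; in [tableB] the row of the first point is a 4-cycle. *)
Definition contains_AB n st : bool :=
  has (fun a => let b := nth 0 (row st a) a in
    let c := nth 0 (row st b) b in let d := nth 0 (row st c) c in
    if subtable tableA st [:: a; b; c; d] then true else
    let c' := nth 0 (row st a) b in let d' := nth 0 (row st a) c' in
    subtable tableB st [:: a; b; c'; d']) (iota 0 n).


Definition int_succ (z : int) : int :=
  match z with Posz m => Posz m.+1 | Negz 0 => Posz 0 | Negz m.+1 => Negz m end.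

Definition int_pred (z : int) : int :=
  match z with Posz m.+1 => Posz m | Posz 0 => Negz 0 | Negz m => Negz m.+1 end.

Definition int_eq (z z' : int) : bool :=
  match z, z' with
  | Posz m, Posz m' => eqn m m' | Negz m, Negz m' => eqn m m' | _, _ => false
  end.

Fixpoint ints_eq (v w : seq int) : bool :=
  match v, w with
  | [::], [::] => true
  | a :: s, b :: s' => if int_eq a b then ints_eq s s' else false
  | _, _ => false
  end.

Fixpoint word_vec n (st : seq (seq nat)) (u : seq (nat * bool)) : seq int :=
  if u is (x, b) :: u' then
    let v := word_vec n st u' in let r := row st x in
    if b then
      let d := nth 0 r x in
      [seq let c := nth (Posz 0) v (index y r) in if eqn y d then int_pred c else c | y <- iota 0 n]
    else
      [seq let c := nth (Posz 0) v (nth 0 r y) in if eqn y x then int_succ c else c | y <- iota 0 n]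
  else nseq n (Posz 0).

Definition promislow_words n st (uv : seq (nat * bool) * seq (nat * bool)) : bool :=
  let: (u, v) := uv in
  let wu := word_vec n st u in let wv := word_vec n st v in
  if ints_eq wu (nseq n (Posz 0)) then false else
  if ints_eq (word_vec n st (v ++ v ++ u ++ v ++ v)) wu then
    ints_eq (word_vec n st (u ++ u ++ v ++ u ++ u)) wv
  else false.

(** Words representing Promislow pairs: each table without a copy of [tableA]
    or [tableB] that the search reaches, and each nonexceptional covering of
    these, satisfies the relations for one of the pairs. *)
Definition word_pairs : seq (seq (nat * bool) * seq (nat * bool)) :=
  let p x := (x, false) in let m x := (x, true) in
  [:: ([:: p 2; m 3], [:: p 6; m 7]); ([:: p 0; m 2], [:: p 5; m 6]);
      ([:: p 5; m 6], [:: p 3; m 0]); ([:: p 0; m 1], [:: p 3; m 2]);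
      ([:: p 7; m 0], [:: p 5; m 7]); ([:: p 0; m 3], [:: p 0; m 2]);
      ([:: p 0; m 1], [:: p 6; m 0]); ([:: p 1; m 7], [:: p 2; m 7]);
      ([:: p 1; m 0], [:: p 5; m 7]); ([:: p 6; m 7], [:: p 2; m 0]);
      ([:: p 2; m 1], [:: p 7; m 6]); ([:: p 2; m 1], [:: p 7; m 5]);
      ([:: p 3; m 1], [:: p 6; m 7]);
      ([:: p 5; p 6; m 2; m 0], [:: p 5; p 4; m 1; m 0])].

Definition has_words n st : bool := has (promislow_words n st) word_pairs.

Fixpoint choices (T : Type) (s : seq (T * T)) : seq (seq (T * T)) :=
  if s is (a, b) :: s' then
    let l := choices s' in
    [seq (a, b) :: u | u <- l] ++ [seq (b, a) :: u | u <- l]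
  else [:: [::]].

Definition unzip_cat (T : Type) (s : seq (T * T)) : seq T :=
  [seq u.1 | u <- s] ++ [seq u.2 | u <- s].

Definition row_lifts (r : seq nat) : seq (seq nat) :=
  [seq unzip_cat u | u <- choices [seq (a, a + 4) | a <- r]].

Definition doubled (rs : seq (seq nat)) := rs ++ rs.

Definition full_law n st : bool :=
  forall_in (fun x => forall_in (law_at n st x) (iota 0 n)) (iota 0 n).

Definition cycle_table (t : seq cycle_row) : seq (seq nat) :=
  [seq let s := [seq (nat_sigma t x.+1 z.+1).-1 | z <- iota 0 8] in
       [seq index y s | y <- iota 0 8] | x <- iota 0 8].

(** All bijections from the points [a], [a + 4] to the pairs of points with equal
    rows in a table. *)
Definition relabelings (t : seq cycle_row) : seq (seq nat) :=
  flatten [seq [seq unzip_cat u | u <- choices c] |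
    c <- permutations [seq (let c := cr.1.1 in ((nth 0 c 0).-1, (nth 0 c 1).-1)) | cr <- t]].

Definition table_iso (st ct : seq (seq nat)) (f : seq nat) : bool :=
  if uniq f then
  forall_in (fun x => let r := row ct (nth 0 f x) in let s := row st x in
    forall_in (fun y => eqn (nth 0 r (nth 0 f y)) (nth 0 f (nth 0 s y))) (iota 0 8)) (iota 0 8)
  else false.

Definition is_exceptional st : bool :=
  has (fun t => let ct := cycle_table t in has (table_iso st ct) (relabelings t)) exceptional_tables.

Definition doubles_ok (t : seq (seq nat)) : bool :=
  forall_in (fun r0 => forall_in (fun r1 => forall_in (fun r2 => forall_in (fun r3 =>
    let st := doubled [:: r0; r1; r2; r3] in
    if full_law 8 st then
      if has_words 8 st then true else is_exceptional st
    else true)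
   (row_lifts (row t 3))) (row_lifts (row t 2))) (row_lifts (row t 1))) (row_lifts (row t 0)).

(** * Soundness of the search *)

Lemma first_some_mem (T : eqType) U (f : T -> option U) s u :
  first_some f s = Some u -> exists2 x, x \in s & f x = Some u.
Proof.
elim: s => //= x s IHs; case E: (f x) => [v|].
  by case=> <-; exists x; rewrite ?mem_head.
by case/IHs => y ys fy; exists y; rewrite // inE ys orbT.
Qed.

Lemma keyP q x r : key q x r = [::] \/
  exists2 h, h \in q & nth 0 h 0 = x /\ key q x r = conj_row h r.
Proof.
elim: q => [|h q IHq] /=; first by left.
have rec : key q x r = [::] \/ exists2 h0, h0 \in h :: q &
    nth 0 h0 0 = x /\ key q x r = conj_row h0 r.
  case: IHq => [->|[h' hq hE]]; first by left.
  by right; exists h'; rewrite // inE hq orbT.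
rewrite -/(key q x r); case: eqnP => // hx.
have new : exists2 h0, h0 \in h :: q & nth 0 h0 0 = x /\ conj_row h r = conj_row h0 r.
  by exists h; rewrite ?mem_head.
by case: nilp; [right|case: row_lt; [right|]].
Qed.

(** [V] is the set of tables of a fixed cycle set under all admissible
    labellings, and [G] what is to be proved about it. *)
Section SearchSound.
Variables (n : nat) (V : seq (seq nat) -> Prop) (G : Prop).
Variables closed leaf : seq (seq nat) -> bool.
Hypothesis n_gt0 : 0 < n.
Hypothesis V_size : forall T, V T -> size T = n.
Hypothesis V_row : forall T x, V T -> x < n -> row T x \in two_rows n.
Hypothesis V_law : forall T x y z, V T -> x < n -> y < n -> z < n ->
  nth 0 (row T (nth 0 (row T x) y)) (nth 0 (row T x) z) =
  nth 0 (row T (nth 0 (row T y) x)) (nth 0 (row T y) z).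
Hypothesis V_uniq : forall T x y, V T -> x < n -> y < n -> row T x = row T y -> x = y.
Hypothesis V_diag : forall T x y, V T -> x < n -> y < n ->
  nth 0 (row T x) x = nth 0 (row T y) y -> x = y.
Hypothesis V_conj : forall T h, V T -> h \in two_rows n ->
  exists2 T', V T' & row T' 0 = conj_row h (row T (nth 0 h 0)).

Definition extends (T st : seq (seq nat)) : Prop :=
  size st = n /\ forall x, x < n -> row st x = [::] \/ row st x = row T x.

Hypothesis closedP : forall T st, V T -> extends T st -> closed st -> G.
Hypothesis leafP : forall T, V T -> leaf T -> G.

Lemma two_rowsP r : r \in two_rows n -> perm_eq r (iota 0 n).
Proof. by rewrite mem_filter mem_permutations => /andP[]. Qed.

Section Fixed.
Variable T : seq (seq nat).
Hypothesis VT : V T.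

Lemma row_perm x : x < n -> perm_eq (row T x) (iota 0 n).
Proof. by move=> xn; exact/two_rowsP/V_row. Qed.

Lemma row_size x : x < n -> size (row T x) = n.
Proof. by move=> xn; rewrite (perm_size (row_perm xn)) size_iota. Qed.

Lemma row_lt_n x y : x < n -> y < n -> nth 0 (row T x) y < n.
Proof.
move=> xn yn; have : nth 0 (row T x) y \in row T x by rewrite mem_nth ?row_size.
by rewrite (perm_mem (row_perm xn)) mem_iota.
Qed.

Lemma ext_row st x : extends T st -> x < n -> nilp (row st x) = false -> row st x = row T x.
Proof. by case=> _ e xn; case: (e x xn) => -> //. Qed.

Lemma ext_ok st y : extends T st -> y < n -> row_ok n st y.
Proof.
move=> e yn; rewrite /row_ok; case ny: nilp => //; rewrite forall_inE.
apply/allP => x; rewrite mem_iota /= => xn; rewrite /pair_ok.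
case: eqnP => // xy; case nx: nilp => //.
rewrite (ext_row e xn nx) (ext_row e yn ny).
case: row_eqP => [/(V_uniq VT xn yn)//|_].
case: eqnP => [/(V_diag VT xn yn)//|_].
rewrite /law_at (ext_row e xn nx) (ext_row e yn ny).
case nu: nilp => //; case nv: nilp => //.
rewrite forall_inE; apply/allP => z; rewrite mem_iota /= => zn; apply/eqnP.
by rewrite (ext_row e _ nu) ?row_lt_n // (ext_row e _ nv) ?row_lt_n // V_law.
Qed.

Lemma forced_row st y r : extends T st -> forced n st = Some (y, r) ->
  y < n /\ r = row T y.
Proof.
move=> e E; have [x] := first_some_mem E; rewrite mem_iota /= => xn {E}.
case nx: nilp => // E; have [w] := first_some_mem E; rewrite mem_iota /= => wn {E}.
case nw: nilp => //; case: nilp => //; case nu: nilp => // -[<- <-].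
rewrite (ext_row e xn nx) (ext_row e wn nw) in nu *.
rewrite (ext_row e _ nu) ?row_lt_n //; split=> //.
have vn := row_lt_n wn xn.
apply: (@eq_from_nth _ 0) => [|i]; rewrite size_map size_iota ?row_size // => iltn.
rewrite (nth_map 0) ?size_iota // nth_iota // add0n.
have iw : i \in row T w by rewrite (perm_mem (row_perm wn)) mem_iota.
have jn : index i (row T w) < n by rewrite -[X in _ < X](row_size wn) index_mem.
by rewrite V_law // nth_index.
Qed.

Lemma ext_set st y : extends T st -> y < n -> extends T (set_nth [::] st y (row T y)).
Proof.
move=> [s e] yn; split; first by rewrite size_set_nth s; apply/maxn_idPr.
move=> x xn; rewrite /row nth_set_nth /=.
by case: eqP => [->|_]; [right|exact: e].
Qed.

Lemma pick_lt st : match pick n st with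
  | Some y => is_true (y < n)
  | None => forall x, x < n -> nilp (row st x) = false end.
Proof.
rewrite /pick; have sub : {subset iota 0 n <= iota 0 n} by [].
have : forall s, {subset s <= iota 0 n} ->
    let b := foldr (fun y (best : option nat * nat) =>
      if nilp (row st y) then let s := (score n st y).+1 in
      if best.2 <= s then (Some y, s) else best else best) (None, 0) s in
    match b.1 with Some y => is_true (y < n)
    | None => b.2 = 0 /\ forall x, x \in s -> nilp (row st x) = false end.
  elim=> [//|y s IHs] sub' /=.
  have /IHs /= : {subset s <= iota 0 n} by move=> z zs; apply: sub'; rewrite inE zs orbT.
  set b := foldr _ _ s; have yn : y < n by have := sub' y (mem_head _ _); rewrite mem_iota.
  case: b => [[z|] m] /=; first by case: nilp => //; case: ifP.
  case=> -> h; case ny: nilp => //=; split=> // x; rewrite inE => /predU1P[->//|]; exact: h.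
move=> /(_ _ sub) /=; case: (foldr _ _ _) => [[z|] m] //= [_ h] x xn.
by apply: h; rewrite mem_iota.
Qed.

Lemma search_sound fuel allowed st : search n closed leaf fuel allowed st ->
  extends T st -> (forall x, x < n -> row T x \in nth [::] allowed x) -> G.
Proof.
elim: fuel st => [//|fuel IH] st /= + e al.
rewrite forall_inE; have -> : all (row_ok n st) (iota 0 n).
  by apply/allP => y; rewrite mem_iota /= => yn; exact: ext_ok.
rewrite /=; case cl: (closed st); first by move=> _; exact: closedP VT e cl.
have ok y : y < n -> row_ok n (set_nth [::] st y (row T y)) y.
  by move=> yn; apply: ext_ok => //; exact: ext_set.
case F: forced => [[y r]|].
  have [yn ->] := forced_row e F.
  have -> : has (row_eq (row T y)) (nth [::] allowed y).
    by apply/hasP; exists (row T y); [exact: al|exact/row_eqP].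
  by rewrite ok // => s; apply: IH s _ al; exact: ext_set.
have := pick_lt st; case: pick => [y yn|full].
  rewrite forall_inE => /allP/(_ _ (al y yn)); rewrite ok // => s.
  by apply: IH s _ al; exact: ext_set.
suff -> : st = T by exact: leafP.
apply: (@eq_from_nth _ [::]) => [|x]; first by rewrite e.1 V_size.
by rewrite e.1 => xn; apply: (ext_row e xn); exact: full.
Qed.

End Fixed.

(** If [G] fails, no table in [V] has [c] as its row of 0, so by conjugation no
    table in [V] has a row in the class of [c]. *)
Lemma search_classes_sound keys cs :
  search_classes n closed leaf keys cs ->
  (forall T x, V T -> x < n ->
    (row T x, key (two_rows n) x (row T x)) \in nth [::] keys x) ->
  (exists T, V T) -> G.
Proof.
elim: cs keys => [|c cs IHcs] keys /=.
  move=> k0 kP [T VT]; have := kP T 0 VT n_gt0.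
  by case: (nth _ _ _) k0.
case: nilP => // c0; case s: search => // rest kP exV.
apply: contrapT => nG; apply: (nG); apply: (IHcs _ rest _ exV) => T x VT xn.
have xk : x < size keys.
  rewrite ltnNge; apply/negP => kx; have := kP T x VT xn.
  by rewrite nth_default.
rewrite (nth_map [::]) // mem_filter kP // andbT /=.
apply/row_eqP => kc; apply: nG.
have [/esym k0|[h hq [hx hE]]] := keyP (two_rows n) x (row T x).
  by case: c0; rewrite k0.
have [T' VT' T'0] := V_conj VT hq.
apply: (search_sound VT' s).
  split; first by rewrite size_set_nth size_nseq; apply/maxn_idPr.
  move=> y yn; rewrite /row nth_set_nth /=; case: eqP => [->|_]; last first.
    by left; rewrite nth_nseq yn.
  by right; rewrite -/(row T' 0) T'0 hx -hE.
move=> y yn; have yk : y < size keys.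
  rewrite ltnNge; apply/negP => ky; have := kP T' y VT' yn.
  by rewrite nth_default.
by rewrite (nth_map [::]) //; apply/mapP; exists (row T' y, key (two_rows n) y (row T' y)); rewrite ?kP.
Qed.

Lemma search_all_sound : search_all n closed leaf -> (exists T, V T) -> G.
Proof.
move=> s; apply: (search_classes_sound s) => T x VT xn.
rewrite (nth_map 0) ?size_iota // nth_iota //.
by apply/mapP; exists (row T x); rewrite ?V_row.
Qed.

End SearchSound.

(** * Sylow 2-subgroups as tables *)

Local Open Scope ring_scope.

Section PermRows.
Variable n : nat.
Implicit Types s t : {perm 'I_n}.

Definition perm_row s : seq nat := [seq nat_of_ord (s i) | i <- enum 'I_n].

Lemma size_perm_row s : size (perm_row s) = n.
Proof. by rewrite size_map size_enum_ord. Qed.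

Lemma nth_perm_row s (i : 'I_n) : nth 0%N (perm_row s) i = s i.
Proof. by rewrite (nth_map i) ?size_enum_ord // nth_ord_enum. Qed.

Lemma perm_row_inj : injective perm_row.
Proof.
move=> s t st; apply/permP => i; apply: ord_inj.
by rewrite -!nth_perm_row st.
Qed.

Lemma perm_row_uniq s : uniq (perm_row s).
Proof. by rewrite map_inj_uniq ?enum_uniq // => i j /ord_inj /perm_inj. Qed.

Lemma index_perm_row s (i : 'I_n) : index (nat_of_ord i) (perm_row s) = (s^-1)%g i.
Proof.
have -> : nat_of_ord i = nth 0%N (perm_row s) ((s^-1)%g i) by rewrite nth_perm_row permKV.
by rewrite index_uniq ?perm_row_uniq ?size_perm_row.
Qed.

Lemma perm_row_perm s : perm_eq (perm_row s) (iota 0 n).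
Proof.
apply: uniq_perm; rewrite ?perm_row_uniq ?iota_uniq // => a; rewrite mem_iota /=.
apply/mapP/idP => [[i _ ->] //|an].
by exists ((s^-1)%g (Ordinal an)); rewrite ?mem_enum // permKV.
Qed.

Lemma perm_row_surj l : perm_eq l (iota 0 n) -> exists s, l = perm_row s.
Proof.
move=> ln; have sl : size l = n by rewrite (perm_size ln) size_iota.
have lt (i : 'I_n) : (nth 0%N l i < n)%N.
  by have := mem_nth 0%N (s := l) (n := i); rewrite sl ltn_ord (perm_mem ln) mem_iota => /(_ isT).
have inj : injective (fun i : 'I_n => Ordinal (lt i)).
  move=> i j /(congr1 (@nat_of_ord n)) /= /eqP; rewrite nth_uniq ?sl //; first by move/eqP/ord_inj.
  by rewrite (perm_uniq ln) iota_uniq.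
exists (perm inj); apply: (@eq_from_nth _ 0%N) => [|a]; first by rewrite size_perm_row.
by rewrite sl => an; rewrite -[a]/(nat_of_ord (Ordinal an)) nth_perm_row permE.
Qed.

Lemma conj_perm_row s t : conj_row (perm_row s) (perm_row t) = perm_row (s * t * s^-1)%g.
Proof.
rewrite /conj_row /perm_row -map_comp; apply: eq_map => i /=.
by rewrite nth_perm_row index_perm_row !permM.
Qed.

Lemma preservesP d s : reflect
  (forall i j : 'I_n, i %/ d = j %/ d -> s i %/ d = s j %/ d)%N (preserves n d (perm_row s)).
Proof.
rewrite /preserves forall_inE; apply: (iffP allP) => [h i j ij|h a].
  have := h (nat_of_ord i); rewrite mem_iota forall_inE ltn_ord => /(_ isT)/allP/(_ (nat_of_ord j)).
  rewrite mem_iota ltn_ord => /(_ isT); rewrite !nth_perm_row.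
  by case: eqnP => // _ /eqnP.
rewrite mem_iota /= => an; rewrite forall_inE; apply/allP => b; rewrite mem_iota /= => bn.
case: eqnP => // ab; apply/eqnP; rewrite -[a]/(nat_of_ord (Ordinal an)) -[b]/(nat_of_ord (Ordinal bn)).
by rewrite !nth_perm_row; apply: h.
Qed.

Definition two_set : {set {perm 'I_n}} := [set s | perm_row s \in two_rows n].

Lemma two_setE s : s \in two_set = preserves n 2 (perm_row s) && preserves n 4 (perm_row s).
Proof.
by rewrite inE mem_filter mem_permutations perm_row_perm andbT; case: preserves.
Qed.

Lemma two_group_set : group_set two_set.
Proof.
have g1 d : preserves n d (perm_row 1%g) by apply/preservesP => i j; rewrite !perm1.
have gM d s t : preserves n d (perm_row s) -> preserves n d (perm_row t) ->
    preserves n d (perm_row (s * t)%g).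
  move=> /preservesP hs /preservesP ht; apply/preservesP => i j ij.
  by rewrite !permM; apply/ht/hs.
apply/group_setP; split; first by rewrite two_setE !g1.
by move=> s t; rewrite !two_setE => /andP[? ?] /andP[? ?]; rewrite !gM.
Qed.

Definition two_group := Group two_group_set.

Lemma card_two_group : #|two_group| = size (two_rows n).
Proof.
rewrite cardE -(size_map perm_row); apply/perm_size/uniq_perm.
- by rewrite map_inj_uniq ?enum_uniq //; exact: perm_row_inj.
- by rewrite filter_uniq ?permutations_uniq.
move=> l; apply/mapP/idP => [[s]|lq]; first by rewrite mem_enum inE => ? ->.
have /perm_row_surj[s lE] := two_rowsP lq.
by exists s => //; rewrite mem_enum inE -lE.
Qed.

Lemma two_group_Sylow k : size (two_rows n) = (2 ^ k)%N -> odd (n`! %/ 2 ^ k) ->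
  (2.-Sylow([set: {perm 'I_n}]) two_group)%g.
Proof.
move=> sz od; rewrite /pHall subsetT /pgroup card_two_group sz pnatX pnat_id // !andTb.
rewrite -divgS ?subsetT // card_two_group sz.
have -> : #|[set: {perm 'I_n}]| = n`!.
  rewrite -[in RHS](card_ord n) -(cardsT 'I_n) -card_perm; apply: eq_card => s.
  by rewrite !inE; apply/esym/subsetP => i _; rewrite inE.
by rewrite p'natE // dvdn2 od.
Qed.

End PermRows.

Lemma two_rows_Sylow n : (2 <= n <= 8)%N ->
  (2.-Sylow([set: {perm 'I_n}]) (two_group n))%g.
Proof.
move=> n28; have : n \in iota 2 7 by rewrite mem_iota.
rewrite !inE => /or4P[/eqP->|/eqP->|/eqP->|]; last case/or4P => /eqP->.
- by apply: (@two_group_Sylow _ 1); [vm_compute|].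
- by apply: (@two_group_Sylow _ 1); [vm_compute|].
- by apply: (@two_group_Sylow _ 3); [vm_compute|].
- by apply: (@two_group_Sylow _ 3); [vm_compute|].
- by apply: (@two_group_Sylow _ 4); [vm_compute|].
- by apply: (@two_group_Sylow _ 4); [vm_compute|vm_compute].
- by apply: (@two_group_Sylow _ 7); [vm_compute|vm_compute].
Qed.

Local Close Scope ring_scope.

(** * Labelled braces and words *)

Local Open Scope ring_scope.

(** Both sides are multiplicative and agree on letters and their inverses. *)
Lemma brace_ev (X : finType) (rho : vec X -> {perm X}) u : brace_map rho ->
  rho (ev (fun x => rho (unitv x)) u).1 = (ev (fun x => rho (unitv x)) u).2.
Proof.
move=> rhoM; elim: u => [|[x b] u IHu] /=; first exact: rho0.
have -> : (evl (fun x => rho (unitv x)) (x, b)).2 = rho (evl (fun x => rho (unitv x)) (x, b)).1.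
  by rewrite /evl; case: b => //=; rewrite -rhoV // /vinv vact_unitv invgK.
by rewrite -IHu -rhoM.
Qed.

Definition labelled (X : finType) (rho : vec X -> {perm X}) n (e : 'I_n -> X)
    (p : 'I_n -> {perm 'I_n}) : Prop :=
  bijective e /\ forall i j, rho (unitv (e i)) (e j) = e (p i j).

Definition perm_table n (p : 'I_n -> {perm 'I_n}) : seq (seq nat) :=
  [seq perm_row (p i) | i <- enum 'I_n].

Lemma row_perm_table n (p : 'I_n -> {perm 'I_n}) (i : 'I_n) : row (perm_table p) i = perm_row (p i).
Proof. by rewrite /row (nth_map i) ?size_enum_ord // nth_ord_enum. Qed.

Lemma int_succE z : int_succ z = z + 1.
Proof.
case: z => [m|[|m]] //=; first by rewrite -addn1 PoszD.
by rewrite !NegzE -[m.+2]addn1 PoszD opprD subrK.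
Qed.

Lemma int_predE z : int_pred z = z - 1.
Proof.
case: z => [[|m]|m] //=; first by rewrite -[m.+1]addn1 PoszD addrK.
by rewrite !NegzE -[m.+2]addn1 PoszD opprD.
Qed.

Lemma ints_eqP v w : reflect (v = w) (ints_eq v w).
Proof.
elim: v w => [|a s IHs] [|b s'] /=; try by constructor.
have : reflect (a = b) (int_eq a b).
  case: a b => a [] b; rewrite /int_eq; try by constructor.
    by apply: (iffP eqnP) => [->|[]].
  by apply: (iffP eqnP) => [->|[]].
case: int_eq => [/elimT/(_ isT) <-|/elimF/(_ erefl) ab]; last by constructor => -[].
by apply: (iffP (IHs s')) => [->|[]].
Qed.

Section Words.
Variables (X : finType) (rho : vec X -> {perm X}) (n : nat) (e : 'I_n -> X).
Variable p : 'I_n -> {perm 'I_n}.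
Hypotheses (rhoM : brace_map rho) (L : labelled rho e p).
Let pr x := rho (unitv x).
Let label (u : word 'I_n) : word X := [seq (e a.1, a.2) | a <- u].
Let code (u : word 'I_n) : seq (nat * bool) := [seq (nat_of_ord a.1, a.2) | a <- u].
Let T := perm_table p.

Lemma size_word_vec u : size (word_vec n T u) = n.
Proof.
by case: u => [|[x []] u]; rewrite /= ?size_nseq ?size_map ?size_iota.
Qed.

Lemma labelledV i j : (rho (unitv (e i)))^-1%g (e j) = e ((p i)^-1%g j).
Proof. by apply: (@perm_inj _ (rho (unitv (e i)))); rewrite permKV L.2 permKV. Qed.

Lemma word_vecE u (j : 'I_n) : (ev pr (label u)).1 (e j) = nth 0 (word_vec n T (code u)) j.
Proof.
have eI := bij_inj L.1.
elim: u j => [|[x b] u IHu] j /=; first by rewrite ffunE nth_nseq ltn_ord.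
case: b => /=; rewrite (nth_map 0%N) ?size_iota // nth_iota // add0n row_perm_table.
  rewrite nth_perm_row index_perm_row -IHu !ffunE labelledV L.2 (inj_eq eI).
  rewrite int_predE -[eqn _ _]/(j == p x x).
  by case: eqP => _; [rewrite addrC|rewrite oppr0 add0r].
rewrite nth_perm_row -IHu !ffunE L.2 (inj_eq eI) int_succE -[eqn _ _]/(j == x).
by case: eqP => _; [rewrite addrC|rewrite add0r].
Qed.

Lemma word_vec_eq u v : word_vec n T (code u) = word_vec n T (code v) ->
  (ev pr (label u)).1 = (ev pr (label v)).1.
Proof.
move=> uv; apply/ffunP => x; have [e' _ eK] := L.1.
by rewrite -(eK x) !word_vecE uv.
Qed.

Lemma promislow_wordsP u v : promislow_words n T (code u, code v) -> has_promislow rho.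
Proof.
rewrite /promislow_words; case: ints_eqP => // u0; case: ints_eqP => // e1 /ints_eqP e2.
have cat a b : code (a ++ b) = code a ++ code b by rewrite /code map_cat.
have lcat a b : label (a ++ b) = label a ++ label b by rewrite /label map_cat.
have M a b : (ev pr (label (a ++ b))).1 = vmul rho (ev pr (label a)).1 (ev pr (label b)).1.
  by rewrite lcat ev_cat /= /vmul -(brace_ev _ rhoM).
exists (ev pr (label u)).1, (ev pr (label v)).1; split.
  split; rewrite -!M; apply: word_vec_eq; rewrite !cat -!catA //.
left => w0; apply: u0; apply: (@eq_from_nth _ 0) => [|i].
  by rewrite size_word_vec size_nseq.
rewrite size_word_vec => iltn; rewrite -[i]/(nat_of_ord (Ordinal iltn)) -word_vecE w0.
by rewrite nth_nseq ffunE; case: ifP.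
Qed.

End Words.

Lemma has_wordsP (X : finType) (rho : vec X -> {perm X}) (e : 'I_8 -> X) p :
  brace_map rho -> labelled rho e p -> has_words 8 (perm_table p) -> has_promislow rho.
Proof.
move=> rhoM L /hasP[[u v] uv h].
have code (w : seq (nat * bool)) : all (fun a => a.1 < 8)%N w ->
    w = [seq (nat_of_ord a.1, a.2) | a <- [seq (inord a.1 : 'I_8, a.2) | a <- w]].
  move=> wlt; rewrite -map_comp -[LHS]map_id; apply/eq_in_map => -[a b] aw /=.
  by rewrite inordK //; have := allP wlt _ aw.
have lt : all (fun uv => all (fun a => a.1 < 8)%N uv.1 && all (fun a => a.1 < 8)%N uv.2) word_pairs.
  by vm_compute.
have /andP[ul vl] := allP lt _ uv.
move: h; rewrite (code u ul) (code v vl); exact: (promislow_wordsP rhoM L).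
Qed.

Local Close Scope ring_scope.

(** * Labelling a brace of 2-power class *)

Local Open Scope ring_scope.

Definition contains_table (X : finType) (rho : vec X -> {perm X}) (t : seq (seq nat)) : Prop :=
  exists2 g : 'I_4 -> X, injective g &
    forall i j : 'I_4, rho (unitv (g i)) (g j) = g (inord (nth 0%N (row t i) j)).

Section Labelling.
Variables (X : finType) (rho : vec X -> {perm X}) (k : nat).
Hypotheses (rhoM : brace_map rho) (cl : forall v, rho (v *~ (2 ^ k)%N%:Z) = 1%g).

(** The permutation group of a brace of class [2 ^ k] is a 2-group: an element
    of odd prime order would contradict [rho_order]. Sylow's theorem then moves
    it inside [two_group]. *)
Lemma two_labelling n : #|X| = n -> (2 <= n <= 8)%N ->
  exists (e : 'I_n -> X) (q : vec X -> {perm 'I_n}), bijective e /\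
    forall v, q v \in two_group n /\ forall y, rho v (e y) = e (q v y).
Proof.
move=> Xn n28.
pose e0 (i : 'I_n) : X := enum_val (cast_ord (esym Xn) i).
pose e0V (x : X) : 'I_n := cast_ord Xn (enum_rank x).
have e0K : cancel e0 e0V by move=> i; rewrite /e0V enum_valK cast_ordKV.
have Ke0 : cancel e0V e0 by move=> x; rewrite /e0 /e0V cast_ordK enum_rankK.
have inj v : injective (fun i => e0V (rho v (e0 i))).
  by move=> i j /(can_inj Ke0)/perm_inj/(can_inj e0K).
pose s v : {perm 'I_n} := perm (inj v).
have sE v i : e0 (s v i) = rho v (e0 i) by rewrite permE Ke0.
have sM v w : s (vmul rho v w) = (s v * s w)%g.
  by apply/permP => i; apply: (can_inj e0K); rewrite permM !sE rhoM permM.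
have s1 v : rho v = 1%g <-> s v = 1%g.
  split=> /permP v1; apply/permP => i; rewrite perm1.
    by apply: (can_inj e0K); rewrite sE v1 perm1.
  by rewrite -(Ke0 i) -sE v1 perm1.
pose P := [set t | `[< exists v, t = s v >]].
have PP t : reflect (exists v, t = s v) (t \in P) by rewrite inE; apply: asboolP.
have Pg : group_set P.
  apply/group_setP; split.
    by apply/PP; exists 0; apply/esym/s1; exact: rho0.
  by move=> t u /PP[v ->] /PP[w ->]; apply/PP; exists (vmul rho v w).
pose PG := Group Pg.
have P2 : (2.-group PG)%g.
  apply/pgroupP => l l_pr /(Cauchy l_pr)[t /PP[v ->] ol].
  rewrite inE /=; apply: contraT => l2.
  have co : coprime (2 ^ k) l by rewrite coprimeXl // prime_coprime // dvdn_prime2 // eq_sym.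
  have sX m : exists w, s w = (s v ^+ m)%g /\ rho w = (rho v ^+ m)%g.
    elim: m => [|m [w [w1 w2]]]; first by exists 0; rewrite !expg0 rho0 //; split=> //; apply/s1/rho0.
    by exists (vmul rho v w); rewrite sM rhoM w1 w2 !expgS.
  have [w [w1 w2]] := sX l; have r1 : (rho v ^+ l)%g = 1%g.
    by rewrite -w2; apply/s1; rewrite w1 -ol expg_order.
  have /s1 sv1 := rho_order rhoM co (cl v) r1.
  by move: l_pr; rewrite -ol sv1 order1.
have [h _ hP] := Sylow_subJ (two_rows_Sylow n28) (subsetT PG) P2.
exists (e0 \o h), (fun v => (h * s v * h^-1)%g); split.
  apply: bij_comp; last by exists (h^-1)%g; [exact: permK|exact: permKV].
  by exists e0V.
move=> v; split.
  have : s v \in PG by apply/PP; exists v.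
  move/(subsetP hP); rewrite mem_conjg => /=.
  by rewrite conjgE invgK mulgA.
by move=> y /=; rewrite -sE !permM permKV.
Qed.

End Labelling.

Section SubTable.
Variables (X : finType) (rho : vec X -> {perm X}) (n : nat) (e : 'I_n -> X).
Variable p : 'I_n -> {perm 'I_n}.
Hypothesis L : labelled rho e p.

Lemma subtableP t st g : extends n (perm_table p) st -> all (fun a => a < n)%N g ->
  size g = 4 -> all (fun r => all (fun a => a < 4)%N r) t ->
  subtable t st g -> contains_table rho t.
Proof.
move=> ext gn sg t4; rewrite /subtable; case: ifP => // ug; rewrite forall_inE => /allP h.
have lt (i : 'I_4) : (nth 0%N g i < n)%N by apply: (allP gn); rewrite mem_nth ?sg.
exists (fun i => e (Ordinal (lt i))).
  move=> i j /(bij_inj L.1)/(congr1 (@nat_of_ord n))/eqP; rewrite nth_uniq ?sg //.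
  by move/eqP/ord_inj.
move=> i j; rewrite L.2; congr e; apply: ord_inj => /=.
have := h i; rewrite mem_iota ltn_ord => /(_ isT); case ni: nilp => //.
rewrite forall_inE => /allP/(_ (nat_of_ord j)); rewrite mem_iota ltn_ord => /(_ isT)/eqnP.
have -> : row st (nth 0%N g i) = perm_row (p (Ordinal (lt i))).
  have [_ /(_ _ (lt i))[nil|->]] := ext; first by rewrite nil in ni.
  by rewrite -[X in row _ X]/(nat_of_ord (Ordinal (lt i))) row_perm_table.
rewrite -[in X in X -> _]/(nat_of_ord (Ordinal (lt j))) nth_perm_row => ->.
rewrite inordK //; have [it|it] := ltnP i (size t); last by rewrite /row [nth [::] _ _]nth_default // nth_nil.
have [jt|jt] := ltnP j (size (nth [::] t i)); last by rewrite /row nth_default.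
by apply: (allP (allP t4 _ (mem_nth [::] it))); exact: mem_nth.
Qed.

Lemma contains_ABP st : (0 < n)%N -> extends n (perm_table p) st -> contains_AB n st ->
  contains_table rho tableA \/ contains_table rho tableB.
Proof.
move=> n0 ext.
have lt a b : (a < n)%N -> (b < n)%N -> (nth 0%N (row st a) b < n)%N.
  move=> an bn; case: ext => _ /(_ a an) [->|->]; first by rewrite nth_nil.
  rewrite -[a]/(nat_of_ord (Ordinal an)) -[b]/(nat_of_ord (Ordinal bn)) row_perm_table.
  by rewrite nth_perm_row.
case/hasP => a; rewrite mem_iota => /= an; set b := nth _ (row st a) a.
have bn : (b < n)%N by exact: lt.
case: ifP => [h _|_ h]; [left|right]; apply: (subtableP ext _ _ _ h) => //=;
  by rewrite an bn !lt.
Qed.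

End SubTable.

Local Close Scope ring_scope.

(** * Irretractable cycle sets of 2-power class *)

Local Open Scope ring_scope.

Definition search_leaf n st : bool := if eqn n 8 then has_words 8 st else false.

Lemma search_2_7 : forall_in (fun n => search_all n (contains_AB n) (search_leaf n)) (iota 2 6).
Proof. by vm_cast_no_check (erefl true). Qed.

Lemma search_8 : search_all 8 (contains_AB 8) (search_leaf 8).
Proof. by vm_cast_no_check (erefl true). Qed.

Lemma search_small n : (2 <= n <= 8)%N -> search_all n (contains_AB n) (search_leaf n).
Proof.
case/andP => n2; rewrite leq_eqVlt => /predU1P[->|n8]; first exact: search_8.
have := search_2_7; rewrite forall_inE => /allP; apply.
by rewrite mem_iota n2 n8.
Qed.

Section Small.
Variables (X : finType) (rho : vec X -> {perm X}) (k : nat).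
Hypotheses (rhoM : brace_map rho) (cl : forall v, rho (v *~ (2 ^ k)%N%:Z) = 1%g).
Hypotheses (X8 : (#|X| <= 8)%N) (irr : irretractable rho) (nt : exists x y : X, x <> y).

(** The tables of [rho] under labellings by blocks satisfy the hypotheses of
    the search, closed under relabelling by [two_group]. *)
Lemma small_irretractable :
  [\/ #|X| = 8 /\ has_promislow rho, contains_table rho tableA | contains_table rho tableB].
Proof.
have X2 : (2 <= #|X|)%N.
  by have [x [y /eqP xy]] := nt; have := max_card [set x; y]; rewrite cards2 xy.
have n28 : (2 <= #|X| <= 8)%N by rewrite X2.
have [e [q [eB qP]]] := two_labelling rhoM cl erefl n28.
set n := #|X| in e q eB qP n28 *.
pose V T := exists (e : 'I_n -> X) p, [/\ labelled rho e p,
  forall i, p i \in two_group n & T = perm_table p].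
have D := rho_diag_inj rhoM.
apply: (@search_all_sound n V _ (contains_AB n) (search_leaf n)).
- by case/andP: n28 => /ltnW.
- by move=> T [e' [p [_ _ ->]]]; rewrite size_map size_enum_ord.
- move=> T x [e' [p [_ pQ ->]]] xn; rewrite -[x]/(nat_of_ord (Ordinal xn)) row_perm_table.
  by have := pQ (Ordinal xn); rewrite inE.
- move=> T x y z [e' [p [L _ ->]]] xn yn zn.
  rewrite -[x]/(nat_of_ord (Ordinal xn)) -[y]/(nat_of_ord (Ordinal yn)) -[z]/(nat_of_ord (Ordinal zn)).
  rewrite !(row_perm_table, nth_perm_row); congr nat_of_ord.
  apply: (bij_inj L.1); rewrite -!L.2.
  have /permP/(_ (e' (Ordinal zn))) := rows_cycle_set rhoM (e' (Ordinal xn)) (e' (Ordinal yn)).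
  by rewrite !permM.
- move=> T x y [e' [p [L _ ->]]] xn yn.
  rewrite -[x]/(nat_of_ord (Ordinal xn)) -[y]/(nat_of_ord (Ordinal yn)).
  rewrite !row_perm_table => /perm_row_inj pxy; congr nat_of_ord.
  apply/(bij_inj L.1)/irr/permP => u; have [g _ gK] := L.1.
  by rewrite -(gK u) !L.2 pxy.
- move=> T x y [e' [p [L _ ->]]] xn yn.
  rewrite -[x]/(nat_of_ord (Ordinal xn)) -[y]/(nat_of_ord (Ordinal yn)).
  rewrite !(row_perm_table, nth_perm_row) => /ord_inj pxy; congr nat_of_ord.
  by apply/(bij_inj L.1)/D; rewrite !L.2 pxy.
- move=> T h [e' [p [L pQ ->]]] hq.
  have [s hE] := perm_row_surj (two_rowsP hq).
  have sQ : s \in two_group n by rewrite inE -hE.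
  have n0 : (0 < n)%N by case/andP: n28 => /ltnW.
  exists (perm_table (fun i => s * p (s i) * s^-1)%g).
    exists (e' \o s), (fun i => s * p (s i) * s^-1)%g; split=> //; last first.
      by move=> i; rewrite !groupM ?groupV.
    split; first by apply: (bij_comp L.1); exists (s^-1)%g; [exact: permK|exact: permKV].
    by move=> i j /=; rewrite L.2 !permM permKV.
  rewrite hE -[X in row _ X]/(nat_of_ord (Ordinal n0)) -[X in nth _ _ X]/(nat_of_ord (Ordinal n0)).
  by rewrite nth_perm_row !row_perm_table conj_perm_row.
- move=> T st [e' [p [L pQ ->]]] ext /(contains_ABP L _ ext).
  by case; [case/andP: n28 => /ltnW | constructor 2 | constructor 3].
- move=> T [e' [p [L pQ ->]]]; rewrite /search_leaf; case: eqnP => // n8 w.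
  constructor 1; split=> //; move: n8 => n8.
  clear -rhoM L w n8; move: (n) n8 e' p L w => m m8; rewrite m8 => e' p L w.
  exact: (has_wordsP rhoM L w).
- exact: search_small.
exists (perm_table (fun i => q (unitv (e i)))), e, (fun i => q (unitv (e i))).
split=> //; last by move=> i; have [] := qP (unitv (e i)).
by split=> // i j; have [_ ->] := qP (unitv (e i)).
Qed.

End Small.

Local Close Scope ring_scope.

(** * The two cycle sets of size four *)

Local Open Scope ring_scope.

Lemma table_brace n t : size t = n -> all (fun r => perm_eq r (iota 0 n)) t -> full_law n t ->
  exists2 p : 'I_n -> {perm 'I_n}, perm_table p = t & cycle_set p.
Proof.
move=> tn tp law.
have rowP (i : 'I_n) : exists s : {perm 'I_n}, row t i = perm_row s.
  by apply/perm_row_surj/(allP tp (row t i)); rewrite /row mem_nth ?tn.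
have [p pE] := choice rowP.
have E : perm_table p = t.
  apply: (@eq_from_nth _ [::]) => [|i]; rewrite size_map size_enum_ord ?tn // => iltn.
  by have := pE (Ordinal iltn); rewrite -row_perm_table.
exists p => // i j; apply/permP => l; apply: ord_inj; rewrite !permM.
move: law; rewrite /full_law forall_inE => /allP/(_ (nat_of_ord i)).
rewrite mem_iota ltn_ord forall_inE => /(_ isT)/allP/(_ (nat_of_ord j)).
rewrite mem_iota ltn_ord => /(_ isT); rewrite /law_at !pE !nth_perm_row !pE.
have nn s : nilp (@perm_row n s) = false.
  by rewrite /nilp size_perm_row; case: (n) i => [[]|].
rewrite !nn forall_inE => /allP/(_ (nat_of_ord l)); rewrite mem_iota ltn_ord => /(_ isT)/eqnP.
by rewrite !nth_perm_row.
Qed.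

Section Brace4.
Variable t : seq (seq nat).
Hypothesis tAB : t = tableA \/ t = tableB.

(** With [a], [b], [c] the first three points, [a b^-1] and [a c^-1] form a
    Promislow pair of the group of the four-point cycle set. *)
Lemma contains_table_promislow (X : finType) (rho : vec X -> {perm X}) :
  brace_map rho -> contains_table rho t -> has_promislow rho.
Proof.
move=> rhoM [g gI gE].
have [p pt pc] : exists2 p : 'I_4 -> {perm 'I_4}, perm_table p = t & cycle_set p.
  by apply: table_brace; case: tAB => -> //; vm_compute.
have [rho4 rho4M rho4E] := row_brace pc.
apply: (promislow_push rho4M rhoM (f := g)) => //.
  move=> i j; rewrite gE rho4E; congr g; apply: ord_inj.
  by rewrite -pt row_perm_table nth_perm_row inordK.
have L : labelled rho4 id p by split=> [|i j]; [exists id|rewrite rho4E].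
pose o (a : nat) : 'I_4 := inord a.
apply: (@promislow_wordsP _ _ _ _ _ rho4M L [:: (o 0%N, false); (o 1%N, true)] [:: (o 0%N, false); (o 2, true)]).
have oE a : (a < 4)%N -> nat_of_ord (o a) = a by exact: inordK.
rewrite [X in promislow_words _ _ (X, _)](_ : _ = [:: (0, false); (1, true)])%N; last by rewrite /= !oE.
rewrite [X in promislow_words _ _ (_, X)](_ : _ = [:: (0, false); (2, true)])%N; last by rewrite /= !oE.
by rewrite pt; case: tAB => ->; vm_compute.
Qed.

(** Both tables have a row that is a 4-cycle: row 1 of [tableA], row 0 of [tableB]. *)
Lemma table_transitive (P : 'I_4 -> Prop) i0 :
  P i0 -> (forall i j : 'I_4, P i -> P (inord (nth 0%N (row t j) i))) -> forall i, P i.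
Proof.
move=> P0 PS i.
pose c : 'I_4 := if t == tableA then inord 1 else inord 0.
pose nxt a := nth 0%N (row t c) a.
have PX m : P (inord (iter m nxt i0)).
  elim: m => [|m IHm] /=; first by rewrite inord_val.
  have lt : (iter m nxt i0 < 4)%N.
    elim: (m) => //= l; move: (iter l _ _) => a.
    have : all (fun a => nxt a < 4)%N (iota 0 4) by rewrite /nxt /c; case: tAB => ->; rewrite /= !inordK.
    by move=> /allP/(_ a) h a4; apply: h; rewrite mem_iota.
  by have := PS _ c IHm; rewrite inordK.
have h : all (fun a => all (fun b => has (fun m => iter m nxt a == b) (iota 0 4)) (iota 0 4)) (iota 0 4).
  by rewrite /nxt /c; case: tAB => ->; rewrite /= !inordK.
have h0 := allP h (nat_of_ord i0); rewrite mem_iota ltn_ord in h0.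
have /allP/(_ (nat_of_ord i)) := h0 isT.
rewrite mem_iota ltn_ord => /(_ isT)/hasP[m _ /eqP mi].
by have := PX m; rewrite mi inord_val.
Qed.

End Brace4.

Lemma choicesP (T : eqType) (s s' : seq (T * T)) : size s = size s' ->
  all (fun u => (u.2 == u.1) || (u.2 == (u.1.2, u.1.1))) (zip s s') -> s' \in choices s.
Proof.
elim: s s' => [|[a b] s IHs] [|u s'] //= [sz] /andP[uab h].
have s'c := IHs _ sz h.
rewrite mem_cat; case/orP: uab => /eqP->; apply/orP; [left|right]; exact: map_f.
Qed.

Lemma row_liftsP r l m : size l = m -> size r = (m + m)%N ->
  (forall y, y < m -> let a := nth 0 l y in
     (nth 0 r y = a /\ nth 0 r (m + y) = a + 4) \/
     (nth 0 r y = a + 4 /\ nth 0 r (m + y) = a))%N ->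
  r \in row_lifts l.
Proof.
move=> sl sr h; have s1 : size (take m r) = m by rewrite size_takel // sr leq_addl.
have s2 : size (drop m r) = m by rewrite size_drop sr addnK.
apply/mapP; exists (zip (take m r) (drop m r)); last first.
  by rewrite /unzip_cat -/(unzip1 _) -/(unzip2 _) unzip1_zip ?unzip2_zip ?s1 ?s2 // cat_take_drop.
apply: choicesP; first by rewrite size_map size_zip s1 s2 minnn.
apply/(all_nthP ((0, 0), (0, 0)))%N => i; rewrite size_zip size_map size_zip s1 s2 sl !minnn => im.
rewrite nth_zip ?size_map ?size_zip ?s1 ?s2 ?minnn // (nth_map 0%N) ?sl //=.
rewrite nth_zip ?s1 ?s2 // nth_take // nth_drop.
by case: (h i im) => -[-> ->]; rewrite eqxx ?orbT.
Qed.

Local Close Scope ring_scope.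

(** * Coverings of the two cycle sets of size four *)

Local Open Scope ring_scope.

Lemma labelled_law (X : finType) (rho : vec X -> {perm X}) n (e : 'I_n -> X) p :
  brace_map rho -> labelled rho e p -> full_law n (perm_table p).
Proof.
move=> rhoM L; rewrite /full_law forall_inE; apply/allP => x; rewrite mem_iota /= => xn.
rewrite forall_inE; apply/allP => y; rewrite mem_iota /= => yn; rewrite /law_at.
do 2!case: nilp => //; rewrite forall_inE; apply/allP => z; rewrite mem_iota /= => zn; apply/eqnP.
rewrite -[x]/(nat_of_ord (Ordinal xn)) -[y]/(nat_of_ord (Ordinal yn)) -[z]/(nat_of_ord (Ordinal zn)).
rewrite !(row_perm_table, nth_perm_row); congr nat_of_ord.
apply: (bij_inj L.1); rewrite -!L.2.
have /permP/(_ (e (Ordinal zn))) := rows_cycle_set rhoM (e (Ordinal xn)) (e (Ordinal yn)).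
by rewrite !permM.
Qed.

Lemma labelling_exists (X : finType) (rho : vec X -> {perm X}) n (e : 'I_n -> X) :
  bijective e -> exists p, labelled rho e p.
Proof.
move=> eB; have [e' eK Ke] := eB.
have inj i : injective (fun j => e' (rho (unitv (e i)) (e j))).
  by move=> j l /(can_inj Ke)/perm_inj/(can_inj eK).
by exists (fun i => perm (inj i)); split=> // i j; rewrite permE Ke.
Qed.

Lemma cycle_table_brace t : t \in exceptional_tables ->
  exists2 p : 'I_8 -> {perm 'I_8}, perm_table p = cycle_table t & cycle_set p.
Proof.
move=> tE; have : all (fun t => [&& size (cycle_table t) == 8,
    all (fun r => perm_eq r (iota 0 8)) (cycle_table t) & full_law 8 (cycle_table t)])
  exceptional_tables by vm_compute.
by move=> /allP/(_ _ tE)/and3P[/eqP ? ? ?]; exact: table_brace.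
Qed.

Definition exceptional (X : finType) (rho : vec X -> {perm X}) (t : seq cycle_row) : Prop :=
  exists (e : 'I_8 -> X) p, labelled rho e p /\ perm_table p = cycle_table t.

Lemma relabelings_perm : all (fun t => all (fun f => perm_eq f (iota 0 8)) (relabelings t)) exceptional_tables.
Proof. by vm_compute. Qed.

Lemma is_exceptionalP (X : finType) (rho : vec X -> {perm X}) (e : 'I_8 -> X) p :
  labelled rho e p -> is_exceptional (perm_table p) ->
  exists2 t, t \in exceptional_tables & exceptional rho t.
Proof.
move=> L /hasP[t tE] /hasP[f fr]; rewrite /table_iso; case: ifP => // _.
have [s ->] := perm_row_surj (allP (allP relabelings_perm _ tE) _ fr).
rewrite forall_inE => /allP iso; exists t => //.
have [q qt _] := cycle_table_brace tE.
exists (e \o (s^-1)%g), q; split=> //; split.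
  by apply: (bij_comp L.1); exists s; [exact: permKV|exact: permK].
move=> i j /=; rewrite L.2; congr e; apply: (@perm_inj _ s); rewrite permKV.
apply: ord_inj; have := iso ((s^-1)%g i); rewrite mem_iota ltn_ord forall_inE => /(_ isT).
move=> /allP/(_ (nat_of_ord ((s^-1)%g j))); rewrite mem_iota ltn_ord => /(_ isT)/eqnP.
by rewrite -qt !(row_perm_table, nth_perm_row) !permKV.
Qed.

Lemma doubles_okA : doubles_ok tableA. Proof. by vm_cast_no_check (erefl true). Qed.
Lemma doubles_okB : doubles_ok tableB. Proof. by vm_cast_no_check (erefl true). Qed.

(** By transitivity the fibres over the four points have the same size, which
    is 1 or 2 as there are at most eight points. *)
Section DoubleCover.
Variables (X Z : finType) (rho : vec X -> {perm X}) (rhoZ : vec Z -> {perm Z}) (f : X -> Z).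
Variable t : seq (seq nat).
Hypotheses (rhoM : brace_map rho) (X8 : (#|X| <= 8)%N) (fM : brace_morph rho rhoZ f).
Hypotheses (fS : forall z, exists x, f x = z) (tAB : t = tableA \/ t = tableB).
Hypothesis fJ : injective f \/ exists x y,
  [/\ x <> y, f x = f y & rho (unitv x) = rho (unitv y)].
Variable g : 'I_4 -> Z.
Hypotheses (gI : injective g).
Let top (i j : 'I_4) : 'I_4 := inord (nth 0%N (row t i) j).
Hypothesis gE : forall i j : 'I_4, rhoZ (unitv (g i)) (g j) = g (top i j).

Let F i := [set x | f x == g i].

Let fibre_move i j x y : x \in F i -> y \in F j -> rho (unitv x) y \in F (top i j).
Proof. by rewrite !inE => /eqP fx /eqP fy; rewrite fM fx fy gE. Qed.

Let fibre_ex i : exists x, x \in F i.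
Proof. by have [x fx] := fS (g i); exists x; rewrite inE fx. Qed.

Let fibre_card i j : (#|F i| <= #|F j|)%N.
Proof.
apply: (@table_transitive _ tAB (fun j => #|F i| <= #|F j|)%N i (leqnn _)).
move=> j' l h; apply: (leq_trans h); have [x xl] := fibre_ex l.
rewrite -(card_imset _ (@perm_inj _ (rho (unitv x)))); apply/subset_leq_card.
by apply/subsetP => _ /imsetP[y yF ->]; exact: fibre_move.
Qed.

Let fibre_le2 i : (#|F i| <= 2)%N.
Proof.
have : (\sum_(j < 4) #|F i| <= #|X|)%N.
  apply: (@leq_trans (\sum_(j < 4) #|F j|)%N); first by apply: leq_sum => j _; exact: fibre_card.
  have E j : #|F j| = (\sum_x (f x == g j))%N.
    by rewrite -sum1_card big_mkcond; apply: eq_bigr => x _; rewrite inE; case: eqP.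
  under eq_bigr do rewrite E; rewrite exchange_big /= -sum1_card; apply: leq_sum => x _.
  case: (fintype.pickP (fun j => f x == g j)) => [j fx|no]; last by rewrite big1 // => j _; rewrite no.
  rewrite (bigD1 j) //= fx big1 // => l lj; rewrite (eqP fx) (inj_eq gI).
  by rewrite eq_sym (negbTE lj).
rewrite sum_nat_const card_ord => h; have := leq_trans h X8.
by rewrite -[8%N]/(4 * 2)%N leq_pmul2l.
Qed.

(** One point in each fibre gives a copy of the table in [X]. *)
Lemma point_fibres i0 : #|F i0| = 1%N -> has_promislow rho.
Proof.
move=> F1; apply: (contains_table_promislow tAB rhoM).
have [s sF] := choice fibre_ex.
have fs i : f (s i) = g i by have := sF i; rewrite inE => /eqP.
exists s => [i j ij|i j]; first by apply: gI; rewrite -!fs ij.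
have /cards1P[x xE] : #|F (top i j)| == 1%N.
  by rewrite -F1 eqn_leq !fibre_card.
have := sF (top i j); rewrite xE inE => /eqP->.
by have := fibre_move (sF i) (sF j); rewrite xE inE => /eqP.
Qed.

Section Pairs.
Variables a b : 'I_4 -> X.
Hypothesis ab : forall i, a i != b i.
Hypothesis Fab : forall i, F i = [set a i; b i].

Let aF i : a i \in F i. Proof. by rewrite Fab !inE eqxx. Qed.
Let bF i : b i \in F i. Proof. by rewrite Fab !inE eqxx orbT. Qed.

Let e (l : 'I_(4 + 4)) : X := match split l with inl i => a i | inr i => b i end.
Let ea i : e (lshift 4 i) = a i. Proof. by rewrite /e (unsplitK (inl i)). Qed.
Let eb i : e (rshift 4 i) = b i. Proof. by rewrite /e (unsplitK (inr i)). Qed.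

Let fe x i : x \in F i -> f x = g i. Proof. by rewrite inE => /eqP. Qed.

Let e_bij : bijective e.
Proof.
apply: inj_card_bij; last by rewrite card_ord.
move=> l l'; case: (split_ordP l) => i ->; case: (split_ordP l') => j ->; rewrite ?ea ?eb => h.
- by congr lshift; apply: gI; rewrite -(fe (aF i)) -(fe (aF j)) h.
- have ij : i = j by apply: gI; rewrite -(fe (aF i)) -(fe (bF j)) h.
  by have := ab i; rewrite {2}ij h eqxx.
- have ij : i = j by apply: gI; rewrite -(fe (bF i)) -(fe (aF j)) h.
  by have := ab i; rewrite {1}ij -h eqxx.
- by congr rshift; apply: gI; rewrite -(fe (bF i)) -(fe (bF j)) h.
Qed.

Let pair_rows x y i : x \in F i -> y \in F i -> x <> y ->
  rho (unitv x) = rho (unitv y) -> rho (unitv (a i)) = rho (unitv (b i)).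
Proof.
by rewrite Fab !inE => /orP[] /eqP-> /orP[] /eqP-> //.
Qed.

(** Two points with equal rows exist in one fibre, and transitivity carries
    them to all fibres. *)
Let ab_rows i : rho (unitv (a i)) = rho (unitv (b i)).
Proof.
case: fJ => [fI|[x [y [xy fxy rxy]]]].
  have := ab i; rewrite (fI (a i) (b i)) ?eqxx //.
  by rewrite (fe (aF i)) (fe (bF i)).
have [i0 xF] : exists i0, x \in F i0.
  have [e' _ eK] := e_bij; rewrite -(eK x).
  by case: (split_ordP (e' x)) => j ->; exists j; rewrite ?ea ?eb.
have yF : y \in F i0 by move: xF; rewrite !inE fxy.
apply: (@table_transitive _ tAB (fun i => rho (unitv (a i)) = rho (unitv (b i))) i0).
  exact: pair_rows xF yF xy rxy.
move=> {}i j iE; apply: (@pair_rows (rho (unitv (a j)) (a i)) (rho (unitv (a j)) (b i))).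
- exact: fibre_move.
- exact: fibre_move.
- by move=> /perm_inj /eqP; apply/negP.
by have := @cable_row_stable _ _ rhoM (unitv (a j)) (a i) (b i) 1; rewrite !mulr1z; apply.
Qed.

(** The rows of the eight points are lifts of the rows of [t] and are constant
    on fibres, so the table is one of those enumerated by [doubles_ok]. *)
Lemma pair_fibres : has_promislow rho \/ exists2 s, s \in exceptional_tables & exceptional rho s.
Proof.
have [p L] := labelling_exists rho e_bij.
pose T := perm_table (n := 8) p.
have pE (l : 'I_(4 + 4)) i : e l \in F i -> nat_of_ord l = i \/ nat_of_ord l = (i + 4)%N.
  case: (split_ordP l) => j ->; rewrite ?ea ?eb => jF /=; [left|right; rewrite addnC].
    by have -> : j = i by apply: gI; rewrite -(fe jF) (fe (aF j)).
  by have -> : j = i by apply: gI; rewrite -(fe jF) (fe (bF j)).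
have rowT (l : 'I_(4 + 4)) : row T l = perm_row (p l) by exact: row_perm_table.
have rowS (i : 'I_4) : row T (4 + i) = row T i.
  rewrite -[(4 + i)%N]/(nat_of_ord (rshift 4 i)) -[X in _ = row _ X]/(nat_of_ord (lshift 4 i)) !rowT.
  congr perm_row; apply/permP => l; apply: (bij_inj e_bij).
  by rewrite -!L.2 ea eb ab_rows.
have [t4 tr] : size t = 4 /\ forall i j : 'I_4, size (row t i) = 4 /\ (nth 0 (row t i) j < 4)%N.
  have : all (fun t => (size t == 4) && all (fun i => (size (row t i) == 4) &&
     all (fun j => nth 0 (row t i) j < 4)%N (iota 0 4)) (iota 0 4)) [:: tableA; tableB] by vm_compute.
  move=> /allP/(_ t); rewrite !inE; case: tAB => -> /(_ isT)/andP[/eqP s4 /allP h]; split=> // i j.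
    by have := h i; rewrite mem_iota ltn_ord => /(_ isT)/andP[/eqP-> /allP hj]; split=> //; apply: hj; rewrite mem_iota ltn_ord.
  by have := h i; rewrite mem_iota ltn_ord => /(_ isT)/andP[/eqP-> /allP hj]; split=> //; apply: hj; rewrite mem_iota ltn_ord.
have lift (i : 'I_4) : row T i \in row_lifts (row t i).
  have [si _] := tr i i; apply: (row_liftsP si).
    by rewrite -[X in row _ X]/(nat_of_ord (lshift 4 i)) rowT size_perm_row.
  move=> y y4; pose j : 'I_4 := Ordinal y4; rewrite /=.
  have topE : nat_of_ord (top i j) = nth 0%N (row t i) y by rewrite /top inordK //; exact: (tr i j).2.
  rewrite -topE -[X in row _ X]/(nat_of_ord (lshift 4 i)) rowT.
  rewrite -[X in nth _ _ X = _ /\ _]/(nat_of_ord (lshift 4 j)) -[(4 + y)%N]/(nat_of_ord (rshift 4 j)).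
  rewrite !nth_perm_row.
  have q1 : e (p (lshift 4 i) (lshift 4 j)) \in F (top i j) by rewrite -L.2 !ea fibre_move.
  have q2 : e (p (lshift 4 i) (rshift 4 j)) \in F (top i j) by rewrite -L.2 ea eb fibre_move.
  have ne : nat_of_ord (p (lshift 4 i) (lshift 4 j)) <> p (lshift 4 i) (rshift 4 j).
    move/ord_inj/perm_inj/(congr1 (@nat_of_ord _)) => /= jj.
    by have := y4; rewrite jj ltnNge leq_addr.
  by case: (pE _ _ q1) (pE _ _ q2) ne => -> [] ->; [|left|right|].
have TE : T = doubled [:: row T 0; row T 1; row T 2; row T 3].
  rewrite -[LHS](mkseq_nth [::]) size_map size_enum_ord /mkseq /=.
  have e4 l : (l < 4)%N -> nth [::] T (4 + l) = nth [::] T l.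
    by move=> l4; exact: (rowS (Ordinal l4)).
  have e0 : nth [::] T 4 = nth [::] T 0 := e4 0%N isT.
  have e1 : nth [::] T 5 = nth [::] T 1 := e4 1%N isT.
  have e2 : nth [::] T 6 = nth [::] T 2 := e4 2%N isT.
  have e3 : nth [::] T 7 = nth [::] T 3 := e4 3%N isT.
  by rewrite e0 e1 e2 e3.
have ok : doubles_ok t by case: tAB => ->; [exact: doubles_okA|exact: doubles_okB].
have := (lift (inord 0), lift (inord 1), lift (inord 2), lift (inord 3)).
rewrite !inordK // => -[[[l0 l1] l2] l3].
move: ok; rewrite /doubles_ok forall_inE => /allP/(_ _ l0).
rewrite forall_inE => /allP/(_ _ l1); rewrite forall_inE => /allP/(_ _ l2).
rewrite forall_inE => /allP/(_ _ l3); rewrite -TE (labelled_law rhoM L).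
case: ifP => [w _|_ x]; first by left; exact: has_wordsP rhoM L w.
by right; exact: is_exceptionalP L x.
Qed.

End Pairs.

Lemma double_cover :
  has_promislow rho \/ exists2 s, s \in exceptional_tables & exceptional rho s.
Proof.
have [F1|F1] := eqVneq #|F ord0| 1%N; first by left; exact: point_fibres F1.
have F2 i : exists u : X * X, u.1 != u.2 /\ F i = [set u.1; u.2].
  suff /cards2P[x [y [xy E]]] : #|F i| == 2 by exists (x, y); split.
  rewrite eqn_leq fibre_le2 /= (leq_trans _ (fibre_card ord0 i)) // ltn_neqAle eq_sym F1.
  by have [x xF] := fibre_ex ord0; rewrite (cardD1 x) xF.
have [u uP] := choice F2.
apply: (@pair_fibres (fun i => (u i).1) (fun i => (u i).2)) => i; by have [] := uP i.
Qed.

End DoubleCover.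

Local Close Scope ring_scope.

(** * Certificates for the exceptional solutions *)

(** The permutation of a vector is determined by the values modulo 4 of a few
    linear functionals, which form its state. *)
Definition state := seq nat.

Definition state_add (s f : state) : state := [seq (u.1 + u.2) %% 4 | u <- zip s f].
Definition state_sub (s f : state) : state := [seq (u.1 + 3 * u.2) %% 4 | u <- zip s f].

Definition row_comp (f g : seq nat) := [seq nth 0 g a | a <- f].

Definition machine := seq (state * seq nat).

Fixpoint find_state (m : machine) (s : state) : seq nat :=
  if m is (s', g) :: m' then if row_eq s' s then g else find_state m' s else [::].

(** The permutation of [v + unitv z] computed from the permutation [g] of [v]. *)
Definition advance (ct : seq (seq nat)) (g : seq nat) (z : nat) := row_comp g (row ct (nth 0 g z)).

Definition grow (ct fs : seq (seq nat)) (m : machine) : machine :=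
  foldl (fun m' sg => foldl (fun m'' z =>
    let s := state_add sg.1 (nth [::] fs z) in
    if nilp (find_state m'' s) then rcons m'' (s, advance ct sg.2 z) else m'') m' (iota 0 8)) m m.

Definition machine_of ct fs : machine :=
  iter 6 (grow ct fs) [:: (nseq (size (nth [::] fs 0)) 0, iota 0 8)].

Definition machine_ok ct fs (m : machine) : bool :=
  if ~~ row_eq (find_state m (nseq (size (nth [::] fs 0)) 0)) (iota 0 8) then false else
  if ~~ forall_in (fun sg => perm_eq sg.2 (iota 0 8)) m then false else
  forall_in (fun sg => forall_in (fun z =>
    let f := nth [::] fs z in
    if row_eq (find_state m (state_add sg.1 f)) (advance ct sg.2 z) then
      let g := find_state m (state_sub sg.1 f) in
      if nilp g then false else row_eq (advance ct g z) sg.2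
    else false) (iota 0 8)) m.

(** Linear forms in the coordinates of a pair of vectors are kept as sequences
    of coefficients modulo 8. *)
Definition bump (k : nat) (c : seq nat) (a : nat) : seq nat := set_nth 0 c a (nth 0 c a + k).

(** Adds [k] times the relation at the point [y], whose coefficient 7 stands
    for -1. *)
Definition add_equation (A B : seq nat) (k y : nat) (c : seq nat * seq nat) : seq nat * seq nat :=
  let b1 := nth 0 B y in let b2 := nth 0 B b1 in
  let ab2 := nth 0 A b2 in let bab2 := nth 0 B ab2 in
  (bump (7 * k) (bump k c.1 b2) y, foldl (bump k) c.2 [:: y; b1; ab2; bab2]).

Definition swap_pair T (c : T * T) := (c.2, c.1).

Definition combination (A B t : seq nat) : seq nat * seq nat :=
  let c := foldl (fun c y => add_equation A B (nth 0 t y) y c) (nseq 8 0, nseq 8 0) (iota 0 8) in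
  swap_pair (foldl (fun c y => add_equation B A (nth 0 t (8 + y)) y c) (swap_pair c) (iota 0 8)).

Fixpoint dot (a s : seq nat) : nat :=
  if a is x :: a' then if s is y :: s' then x * y + dot a' s' else 0 else 0.

Fixpoint coefficients (r : nat) : seq (seq nat) :=
  if r is r'.+1 then flatten [seq [seq x :: a | a <- coefficients r'] | x <- iota 0 4] else [:: [::]].

Definition even_form fs (c a : seq nat) : bool :=
  forall_in (fun z => eqn (nth 0 c z %% 8) ((2 * dot a (nth [::] fs z)) %% 8)) (iota 0 8).

(** The template [t] combines the sixteen coordinates of the two relations into
    a form that is twice a combination of the functionals modulo 8, so that its
    value is known from the states; the states are impossible if it is not 0. *)
Definition refutes fs (s s' : state) (A B t : seq nat) : bool :=
  let c := combination A B t in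
  let cs := coefficients (size s) in
  has (fun a => if even_form fs c.1 a then
    has (fun b => if even_form fs c.2 b then
      ~~ eqn ((2 * (dot a s + dot b s')) %% 8) 0 else false) cs else false) cs.

(** The first functional is a multiple of the degree, which vanishes on
    Promislow pairs. *)
Definition pairs_ok fs templates (m : machine) : bool :=
  let m0 := [seq sg <- m | eqn (nth 0 sg.1 0) 0] in
  forall_in (fun sg => forall_in (fun sg' =>
    if row_eq sg.1 (nseq (size sg.1) 0) && row_eq sg'.1 (nseq (size sg'.1) 0) then true
    else has (refutes fs sg.1 sg'.1 sg.2 sg'.2) templates) m0) m0.

Definition const_functional fs : bool :=
  forall_in (fun z => eqn (nth 0 (nth [::] fs z) 0) (nth 0 (nth [::] fs 0) 0)) (iota 0 8).

(** For each table, the values of the functionals at the eight points, and the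
    templates used for all pairs of states. *)
Definition certificates : seq (seq cycle_row * seq (seq nat) * seq (seq nat)) := [::
  (S1_table,
    [:: [:: 1; 0; 0]; [:: 1; 0; 0]; [:: 1; 0; 1]; [:: 1; 0; 1]; [:: 1; 2; 1]; [:: 1; 2; 0]; [:: 1; 2; 1]; [:: 1; 2; 0]],
    [:: [:: 0; 0; 0; 0; 4; 2; 0; 6; 4; 4; 0; 0; 0; 0; 0; 0];
      [:: 0; 0; 0; 0; 0; 0; 0; 0; 2; 6; 4; 0; 0; 0; 0; 0];
      [:: 0; 0; 0; 7; 6; 0; 1; 0; 0; 0; 0; 0; 0; 0; 0; 0];
      [:: 0; 0; 0; 0; 0; 0; 0; 0; 7; 0; 0; 0; 0; 6; 0; 1]]);
  (S2_table,
    [:: [:: 1; 0; 0]; [:: 1; 0; 0]; [:: 1; 0; 1]; [:: 1; 0; 1]; [:: 1; 2; 3]; [:: 1; 2; 0]; [:: 1; 2; 3]; [:: 1; 2; 0]],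
    [:: [:: 4; 0; 4; 0; 0; 0; 0; 0; 2; 2; 0; 0; 0; 0; 0; 0];
      [:: 0; 0; 0; 0; 0; 6; 0; 6; 0; 0; 0; 0; 0; 0; 0; 0];
      [:: 0; 0; 0; 4; 0; 0; 0; 4; 0; 0; 0; 0; 0; 0; 0; 0];
      [:: 2; 0; 0; 1; 1; 0; 0; 0; 0; 0; 0; 0; 4; 0; 4; 0];
      [:: 0; 0; 0; 0; 0; 0; 0; 0; 0; 2; 1; 0; 1; 0; 0; 0]]);
  (S3_table,
    [:: [:: 1; 0; 0]; [:: 1; 0; 0]; [:: 1; 0; 2]; [:: 1; 1; 0]; [:: 1; 3; 2]; [:: 1; 3; 2]; [:: 1; 1; 0]; [:: 1; 0; 2]],
    [:: [:: 6; 2; 4; 0; 0; 0; 0; 0; 4; 4; 0; 4; 0; 0; 4; 0];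
      [:: 0; 0; 0; 0; 0; 0; 0; 0; 7; 7; 1; 4; 4; 0; 0; 1];
      [:: 0; 0; 0; 0; 0; 0; 0; 0; 4; 0; 0; 0; 6; 2; 0; 0];
      [:: 7; 0; 7; 0; 7; 0; 7; 0; 0; 0; 0; 1; 7; 0; 0; 0];
      [:: 0; 0; 0; 0; 7; 0; 1; 0; 0; 0; 0; 4; 4; 0; 0; 0]]);
  (S4_table,
    [:: [:: 1; 0; 0]; [:: 1; 0; 0]; [:: 1; 0; 2]; [:: 1; 1; 0]; [:: 1; 0; 2]; [:: 1; 1; 0]; [:: 1; 1; 2]; [:: 1; 1; 2]],
    [:: [:: 0; 0; 0; 0; 0; 0; 0; 0; 6; 6; 0; 0; 0; 0; 0; 0];
      [:: 0; 0; 2; 4; 6; 0; 0; 0; 0; 0; 0; 0; 0; 0; 0; 0];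
      [:: 0; 0; 4; 0; 4; 0; 0; 0; 0; 4; 0; 0; 0; 0; 0; 4];
      [:: 0; 0; 0; 2; 6; 0; 0; 0; 7; 0; 3; 4; 0; 0; 0; 0];
      [:: 7; 0; 0; 0; 7; 0; 0; 0; 0; 0; 0; 7; 0; 1; 0; 0]]);
  (S5_table,
    [:: [:: 2; 0; 1]; [:: 2; 0; 3]; [:: 2; 1; 0]; [:: 2; 3; 0]; [:: 2; 1; 0]; [:: 2; 3; 0]; [:: 2; 0; 1]; [:: 2; 0; 3]],
    [:: [:: 0; 0; 0; 0; 0; 0; 4; 4; 0; 0; 0; 0; 0; 0; 0; 0];
      [:: 1; 7; 0; 0; 0; 0; 1; 7; 0; 0; 0; 0; 0; 0; 0; 0];
      [:: 0; 4; 0; 0; 4; 0; 0; 0; 0; 0; 3; 1; 3; 1; 0; 0];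
      [:: 0; 0; 6; 0; 6; 0; 0; 0; 0; 0; 0; 0; 0; 0; 0; 0];
      [:: 0; 0; 0; 0; 7; 1; 0; 0; 0; 0; 6; 0; 6; 0; 0; 0];
      [:: 0; 0; 0; 0; 0; 0; 0; 0; 0; 0; 6; 1; 1; 0; 0; 0]]);
  (S6_table,
    [:: [:: 2; 0; 1]; [:: 2; 0; 3]; [:: 2; 1; 0]; [:: 2; 3; 0]; [:: 2; 1; 0]; [:: 2; 3; 0]; [:: 2; 0; 1]; [:: 2; 0; 3]],
    [:: [:: 0; 0; 0; 0; 4; 4; 0; 0; 0; 0; 0; 0; 0; 0; 0; 0];
      [:: 0; 0; 0; 0; 4; 4; 0; 0; 0; 0; 6; 2; 2; 6; 0; 0];
      [:: 0; 0; 6; 0; 6; 0; 0; 0; 0; 0; 0; 0; 0; 0; 0; 0];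
      [:: 0; 0; 0; 0; 0; 0; 0; 0; 0; 0; 5; 7; 5; 7; 0; 0];
      [:: 7; 0; 1; 0; 1; 0; 7; 0; 4; 0; 0; 0; 0; 0; 4; 0];
      [:: 1; 7; 0; 0; 0; 0; 1; 7; 0; 0; 0; 0; 0; 0; 0; 0];
      [:: 7; 1; 0; 0; 0; 0; 0; 0; 0; 0; 6; 0; 6; 0; 0; 0];
      [:: 6; 6; 0; 0; 0; 0; 0; 0; 7; 0; 6; 2; 0; 0; 0; 1]]);
  (S7_table,
    [:: [:: 1; 0; 0]; [:: 1; 0; 1]; [:: 1; 2; 1]; [:: 1; 2; 0]; [:: 1; 2; 1]; [:: 1; 2; 0]; [:: 1; 0; 0]; [:: 1; 0; 1]],
    [:: [:: 0; 4; 4; 0; 0; 0; 0; 0; 0; 2; 0; 0; 4; 0; 0; 6];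
      [:: 0; 0; 4; 4; 4; 4; 4; 4; 0; 4; 0; 0; 0; 0; 4; 0];
      [:: 0; 0; 0; 2; 0; 2; 0; 0; 0; 2; 0; 2; 0; 0; 0; 0];
      [:: 0; 0; 6; 0; 6; 0; 0; 0; 0; 0; 0; 0; 0; 0; 0; 0];
      [:: 0; 7; 7; 4; 0; 4; 0; 0; 0; 0; 0; 0; 0; 0; 0; 0];
      [:: 0; 0; 0; 0; 0; 0; 0; 0; 1; 0; 0; 0; 0; 1; 0; 0]]);
  (S8_table,
    [:: [:: 1; 0; 0]; [:: 1; 0; 2]; [:: 1; 1; 0]; [:: 1; 1; 2]; [:: 1; 0; 0]; [:: 1; 0; 2]; [:: 1; 1; 0]; [:: 1; 1; 2]],
    [:: [:: 0; 0; 0; 0; 4; 0; 4; 0; 2; 4; 0; 4; 6; 0; 4; 0];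
      [:: 0; 0; 6; 0; 0; 0; 6; 0; 0; 0; 0; 0; 0; 0; 0; 0];
      [:: 0; 0; 4; 0; 0; 4; 0; 0; 0; 0; 0; 0; 0; 0; 0; 0];
      [:: 1; 7; 2; 0; 0; 0; 0; 0; 0; 0; 6; 6; 0; 0; 0; 0];
      [:: 0; 0; 0; 7; 0; 0; 0; 1; 0; 0; 7; 7; 0; 0; 0; 0]])].

Definition certificate_ok (u : seq cycle_row * seq (seq nat) * seq (seq nat)) : bool :=
  let: (t, fs, templates) := u in
  let ct := cycle_table t in let m := machine_of ct fs in
  if forall_in (fun f => eqn (size f) (size (nth [::] fs 0))) fs then
  if eqn (size fs) 8 then
  if const_functional fs then
  if machine_ok ct fs m then pairs_ok fs templates m
  else false else false else false else false.

(** * The exceptional solutions have no Promislow pair *)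

Local Open Scope ring_scope.

Lemma row_comp_perm n (g h : {perm 'I_n}) : row_comp (perm_row g) (perm_row h) = perm_row (g * h)%g.
Proof.
rewrite /row_comp /perm_row -map_comp; apply: eq_map => i /=.
by rewrite nth_perm_row permM.
Qed.

Lemma perm_row1 n : perm_row (1%g : {perm 'I_n}) = iota 0 n.
Proof. by rewrite /perm_row -[RHS]val_enum_ord; apply: eq_map => i; rewrite perm1. Qed.

Lemma find_state_mem m s : find_state m s <> [::] -> (s, find_state m s) \in m.
Proof.
elim: m => //= -[s' g] m IHm; case: row_eqP => [->|_] h; first by rewrite mem_head.
by rewrite inE IHm ?orbT.
Qed.

Lemma dotE a s : dot a s = (\sum_(j < size s) nth 0 a j * nth 0 s j)%N.
Proof.
elim: a s => [|x a IHa] [|y s] /=; rewrite ?big_ord0 //.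
  by rewrite big1 // => j _; rewrite nth_nil mul0n.
by rewrite big_ord_recl /= IHa.
Qed.

(** A Promislow pair [v], [w] with permutations [A], [B] satisfies linear
    relations between the coordinates of [v] and [w] that depend on [A] and [B]
    only. Their combinations modulo 8 contradict the states of [v] and [w]. *)
Section Exceptional.
Variables (X : finType) (rho : vec X -> {perm X}) (e : 'I_8 -> X) (p : 'I_8 -> {perm 'I_8}).
Variables (fs : seq (seq nat)).
Let ct := perm_table p.
Hypotheses (rhoM : brace_map rho) (L : labelled rho e p).
Let r := size (nth [::] fs 0).
Hypothesis fs_size : forall z : 'I_8, size (nth [::] fs z) = r.
Variable m : machine.
Hypothesis m_ok : machine_ok ct fs m.

Let value (v : vec X) (j : nat) : int := \sum_(z < 8) (nth 0%N (nth [::] fs z) j)%:Z * v (e z).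
Let st (v : vec X) : state := mkseq (fun j => `|(value v j %% 4)%Z|%N) r.

Let st_nth v j : (j < r)%N -> (nth 0%N (st v) j)%:Z = (value v j %% 4)%Z.
Proof. by move=> jr; rewrite nth_mkseq // gez0_abs // modz_ge0. Qed.

Let eI : injective e. Proof. exact: bij_inj L.1. Qed.

Let valueD v z j : value (v + unitv (e z)) j = value v j + (nth 0%N (nth [::] fs z) j)%:Z.
Proof.
have <- : \sum_(l < 8) (nth 0%N (nth [::] fs l) j)%:Z * (unitv (e z)) (e l) =
    (nth 0%N (nth [::] fs z) j)%:Z.
  rewrite (bigD1 z) //= unitvE eqxx mulr1 big1 ?addr0 // => l lz.
  by rewrite unitvE (inj_eq eI) (negbTE lz) mulr0.
by rewrite -big_split; apply: eq_bigr => l _; rewrite ffunE mulrDr.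
Qed.

Let st_add v (z : 'I_8) : st (v + unitv (e z)) = state_add (st v) (nth [::] fs z).
Proof.
apply: (@eq_from_nth _ 0%N) => [|j]; first by rewrite size_mkseq /state_add size_map size_zip size_mkseq fs_size minnn.
rewrite size_mkseq => jr.
rewrite /state_add (nth_map (0%N, 0%N)) ?size_zip ?size_mkseq ?fs_size ?minnn // nth_zip ?size_mkseq ?fs_size //=.
apply/eqP; rewrite -eqz_nat st_nth // valueD -modz_nat PoszD st_nth //.
by rewrite modzDml.
Qed.

Let st_sub v (z : 'I_8) : state_sub (st (v + unitv (e z))) (nth [::] fs z) = st v.
Proof.
apply: (@eq_from_nth _ 0%N) => [|j]; rewrite /state_sub size_map size_zip size_mkseq fs_size minnn ?size_mkseq // => jr.
rewrite /state_sub (nth_map (0%N, 0%N)) ?size_zip ?size_mkseq ?fs_size ?minnn // nth_zip ?size_mkseq ?fs_size //=.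
apply/eqP; rewrite -eqz_nat -modz_nat PoszD !st_nth // valueD PoszM.
rewrite modzDml -addrA -{1}[_%:Z]mul1r -mulrDl (_ : 1 + 3%:Z = 4) //.
by rewrite [4 * _]mulrC addrC modzMDl.
Qed.

Let ex_q v : exists s : {perm 'I_8}, forall i, rho v (e i) = e (s i).
Proof.
have [e' eK Ke] := L.1.
have inj : injective (fun j => e' (rho v (e j))) by move=> j l /(can_inj Ke)/perm_inj/(can_inj eK).
by exists (perm inj) => i; rewrite permE Ke.
Qed.

Let row_nil (g : {perm 'I_8}) : nilp (perm_row g) = false.
Proof. by rewrite /nilp size_perm_row. Qed.

(** Adding a basis vector is one step of the machine. Going backwards, the
    permutation before the step is unique by [rho_diag_inj]. *)
Lemma state_perm v (g : {perm 'I_8}) : (forall i, rho v (e i) = e (g i)) ->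
  find_state m (st v) = perm_row g.
Proof.
have [q qE] := choice ex_q; move=> gE.
have -> : g = q v by apply/permP => i; apply: eI; rewrite -gE qE.
move: m_ok; rewrite /machine_ok; case: ifP => // /negbFE/row_eqP m0.
case: ifP => // /negbFE; rewrite !forall_inE => /allP mp /allP mz.
have qD u z : q (u + unitv (e z)) = (q u * p (q u z))%g.
  by apply/permP => i; apply: eI; rewrite -qE rho_unitvD // !permM !(qE u) L.2.
have advE h (z : 'I_8) : advance ct (perm_row h) z = perm_row (h * p (h z))%g.
  by rewrite /advance nth_perm_row row_perm_table row_comp_perm.
have step s g' (z : 'I_8) : (s, g') \in m ->
    find_state m (state_add s (nth [::] fs z)) = advance ct g' z /\
    (nilp (find_state m (state_sub s (nth [::] fs z))) = false /\
     advance ct (find_state m (state_sub s (nth [::] fs z))) z = g').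
  move/mz; rewrite forall_inE => /allP/(_ (nat_of_ord z)); rewrite mem_iota ltn_ord => /(_ isT) /=.
  by case: row_eqP => // e1; case: nilP => // n1 /row_eqP e2; do !split=> //; exact/nilP.
move: {g gE} v; apply: vec_ind => [|v x].
  have -> : q 0 = 1%g by apply/permP => i; apply: eI; rewrite -qE rho0 // !perm1.
  rewrite perm_row1 -m0; congr find_state; apply: (@eq_from_nth _ 0%N) => [|j].
    by rewrite size_mkseq size_nseq.
  rewrite size_mkseq => jr; apply/eqP; rewrite -eqz_nat st_nth // nth_nseq jr.
  by rewrite /value big1 // => z _; rewrite ffunE mulr0.
have [e' _ Ke] := L.1; rewrite -(Ke x); move: (e' x) => z {x}.
have mem u : find_state m (st u) = perm_row (q u) -> (st u, perm_row (q u)) \in m.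
  move=> E; rewrite -E; apply: find_state_mem => nil.
  by have := row_nil (q u); rewrite -E nil.
split=> h.
  have [E _] := step _ _ z (mem _ h).
  by rewrite st_add E advE qD.
have [_ [n1 E]] := step _ _ z (mem _ h); rewrite st_sub in n1 E.
have mv : (st v, find_state m (st v)) \in m.
  by apply: find_state_mem => nil; rewrite nil in n1.
have [k kE] : exists k : {perm 'I_8}, find_state m (st v) = perm_row k := perm_row_surj (mp _ mv).
move: E; rewrite kE advE qD => /perm_row_inj kq.
have kz : k z = q v z.
  apply/eI/(rho_diag_inj rhoM) => /=; rewrite !L.2.
  by move/permP/(_ z): kq; rewrite !permM => ->.
by congr perm_row; apply: (mulIg (p (k z))); rewrite kq kz.
Qed.

Lemma state_mem v (g : {perm 'I_8}) : (forall i, rho v (e i) = e (g i)) ->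
  (st v, perm_row g) \in m.
Proof.
move/state_perm => E; rewrite -E; apply: find_state_mem; rewrite E => nil.
by have := row_nil g; rewrite nil.
Qed.

Let lin (c : seq nat) (v : vec X) : int := \sum_(i < 8) (nth 0%N c i)%:Z * v (e i).

Let lin_bump k c (a : 'I_8) v : lin (bump k c a) v = lin c v + k%:Z * v (e a).
Proof.
rewrite /lin /bump (bigD1 a) //= [in RHS](bigD1 a) //= nth_set_nth /= eqxx PoszD mulrDl.
rewrite addrAC; congr (_ + _ + _); apply: eq_bigr => i ia.
by rewrite nth_set_nth /= (inj_eq (@ord_inj _)) (negbTE ia).
Qed.

Let relation (v w : vec X) (A B : {perm 'I_8}) := forall y : 'I_8,
  w (e y) + w (e (B y)) + v (e (B (B y))) + w (e (A (B (B y)))) + w (e (B (A (B (B y))))) = v (e y).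

Let add_equation_inv v w A B k (y : 'I_8) c : relation v w A B ->
  (8 %| lin c.1 v + lin c.2 w)%Z ->
  (8 %| lin (add_equation (perm_row A) (perm_row B) k y c).1 v +
        lin (add_equation (perm_row A) (perm_row B) k y c).2 w)%Z.
Proof.
move=> rel c8; rewrite /add_equation /= !nth_perm_row !lin_bump.
set l1 := lin c.1 v in c8 *; set l2 := lin c.2 w in c8 *.
set v1 := v _; set v2 := v _; set w1 := w _; set w2 := w _; set w3 := w _; set w4 := w _.
have E : w1 + w2 + v1 + w3 + w4 = v2 by exact: rel.
rewrite -E PoszM; set K := k%:Z.
have -> : l1 + K * v1 + 7%:Z * K * (w1 + w2 + v1 + w3 + w4) +
    (l2 + K * w1 + K * w2 + K * w3 + K * w4) =
    (l1 + l2) + (K * (w1 + w2 + v1 + w3 + w4)) * 8 by ring.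
by rewrite rpredD // dvdz_mull.
Qed.

Let combination_inv v w A B t : relation v w A B -> relation w v B A ->
  let c := combination (perm_row A) (perm_row B) t in (8 %| lin c.1 v + lin c.2 w)%Z.
Proof.
move=> E1 E2; rewrite /combination; cbv zeta.
have lin0 u : lin (nseq 8 0%N) u = 0.
  by rewrite /lin big1 // => i _; rewrite nth_nseq ltn_ord mul0r.
have fold v' w' A' B' (k : nat -> nat) s c : relation v' w' A' B' -> all (fun y => y < 8)%N s ->
    (8 %| lin c.1 v' + lin c.2 w')%Z ->
    let c' := foldl (fun c y => add_equation (perm_row A') (perm_row B') (k y) y c) c s in
    (8 %| lin c'.1 v' + lin c'.2 w')%Z.
  move=> E; elim: s c => //= y s IHs c /andP[y8 s8] c8; apply: IHs => //.
  exact: (@add_equation_inv _ _ _ _ _ (Ordinal y8)).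
set c1 := foldl _ (nseq 8 0%N, nseq 8 0%N) _.
have h1 : (8 %| lin c1.1 v + lin c1.2 w)%Z.
  by apply: (fold v w A B (nth 0%N t) (iota 0 8)) => //; rewrite !lin0 addr0 dvdz0.
have h2 : (8 %| lin (swap_pair c1).1 w + lin (swap_pair c1).2 v)%Z by rewrite addrC.
have := fold w v B A (fun y => nth 0%N t (8 + y)) (iota 0 8) (swap_pair c1) E2 isT h2.
by rewrite addrC.
Qed.

Let dot_sum a s : size s = r ->
  (dot a s)%:Z = \sum_(j < r) (nth 0%N a j)%:Z * (nth 0%N s j)%:Z.
Proof.
move=> sr; rewrite dotE sr (big_morph Posz PoszD (erefl _)).
by apply: eq_bigr => j _; rewrite PoszM.
Qed.

Let even_formP c a v : even_form fs c a -> (8 %| lin c v - (2 * dot a (st v))%N%:Z)%Z.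
Proof.
rewrite /even_form forall_inE => /allP h.
have -> : lin c v - (2 * dot a (st v))%N%:Z =
   \sum_(i < 8) ((nth 0%N c i)%:Z - (2 * dot a (nth [::] fs i))%N%:Z) * v (e i)
   + 2 * \sum_(j < r) (nth 0%N a j)%:Z * (value v j - (nth 0%N (st v) j)%:Z).
  under [X in _ = X + _]eq_bigr do rewrite mulrBl.
  under [X in _ = _ + _ * X]eq_bigr do rewrite mulrBr.
  rewrite !sumrB mulrBr PoszM dot_sum ?size_mkseq //.
  suff -> : \sum_(i < 8) (2 * dot a (nth [::] fs i))%N%:Z * v (e i) =
      2 * \sum_(j < r) (nth 0%N a j)%:Z * value v j.
    by rewrite addrA subrK.
  rewrite mulr_sumr /value; under [RHS]eq_bigr do rewrite !mulr_sumr.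
  rewrite exchange_big /=; apply: eq_bigr => i _.
  rewrite PoszM dot_sum ?fs_size // mulr_sumr mulr_suml; apply: eq_bigr => j _.
  by rewrite !mulrA.
rewrite rpredD //.
  apply: rpred_sum => i _; apply: dvdz_mulr; rewrite -eqz_mod_dvd !modz_nat.
  by have := h i; rewrite mem_iota ltn_ord => /(_ isT)/eqnP ->.
rewrite (_ : 8 = 2 * 4) // dvdz_mul // rpred_sum // => j _; apply: dvdz_mull.
by rewrite -eqz_mod_dvd st_nth // modz_mod.
Qed.

Let pair_relation v w (A B : {perm 'I_8}) :
  (forall i, rho v (e i) = e (A i)) -> (forall i, rho w (e i) = e (B i)) ->
  vmul rho (vmul rho (vmul rho (vmul rho w w) v) w) w = v -> relation v w A B.
Proof.
move=> vA wB E y; rewrite -[in RHS]E /vmul !ffunE.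
by rewrite -/(vmul rho w w) -/(vmul rho _ v) -/(vmul rho _ w) !rhoM // !permM !(wB, vA).
Qed.

Lemma refutesP v w (A B : {perm 'I_8}) t :
  (forall i, rho v (e i) = e (A i)) -> (forall i, rho w (e i) = e (B i)) ->
  vec_pair rho v w -> ~~ refutes fs (st v) (st w) (perm_row A) (perm_row B) t.
Proof.
move=> vA wB [e1 e2]; apply/negP.
have E1 := pair_relation vA wB e1; have E2 := pair_relation wB vA e2.
have := combination_inv t E1 E2; rewrite /refutes.
set c := combination _ _ _ => c8 /hasP[a _]; case: ifP => // ea /hasP[b _]; case: ifP => // eb.
move=> /negP; apply; apply/eqnP.
have : (8 %| (2 * (dot a (st v) + dot b (st w)))%N%:Z)%Z.
  have -> : (2 * (dot a (st v) + dot b (st w)))%N%:Z = (lin c.1 v + lin c.2 w) -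
      ((lin c.1 v - (2 * dot a (st v))%N%:Z) + (lin c.2 w - (2 * dot b (st w))%N%:Z)).
    by rewrite mulnDr PoszD; ring.
  by rewrite rpredB // rpredD // even_formP.
by rewrite dvdzE /= => /eqP.
Qed.

Let sum_perm (u : vec X) (g : {perm 'I_8}) : \sum_i u (e (g i)) = \sum_i u (e i).
Proof. by rewrite [RHS](reindex_inj (@perm_inj _ g)). Qed.

(** Summing over all points, permutations drop out and four times the degree
    of [w] remains. *)
Let relation_sum v w (A B : {perm 'I_8}) : relation v w A B -> \sum_i w (e i) = 0.
Proof.
move=> E; have : \sum_y (w (e y) + w (e (B y)) + v (e ((B * B)%g y)) +
    w (e ((B * B * A)%g y)) + w (e ((B * B * A * B)%g y))) = \sum_y v (e y).
  by apply: eq_bigr => y _; rewrite !permM E.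
rewrite !big_split /= !sum_perm; set W := \sum_i w (e i); set V := \sum_i v (e i).
move=> h; have : W * 4 = 0 by rewrite -[RHS](subrr V) -{1}h; ring.
by move/eqP; rewrite mulf_eq0 orbF => /eqP.
Qed.

(** With trivial permutations the relation reads [4 w + v = v]. *)
Let relation_trivial v w : relation v w 1%g 1%g -> w = 0.
Proof.
move=> E; apply/ffunP => x; have [e' _ Ke] := L.1; rewrite -(Ke x) ffunE.
have := E (e' x); rewrite !perm1; set a := w _; set b := v _ => h.
have : a * 4 = 0 by rewrite -[RHS](subrr b) -{1}h; ring.
by move/eqP; rewrite mulf_eq0 orbF => /eqP.
Qed.

(** The degrees of a pair vanish. If both states are 0 the permutations are
    trivial and so is the pair; other states are refuted by a template. *)
Lemma no_promislow templates : const_functional fs -> pairs_ok fs templates m ->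
  ~ has_promislow rho.
Proof.
move=> cf ok [v [w [vw nz]]].
have [A vA] := ex_q v; have [B wB] := ex_q w.
have E1 := pair_relation vA wB vw.1; have E2 := pair_relation wB vA vw.2.
have deg (u : vec X) : \sum_i u (e i) = 0 -> eqn (nth 0%N (st u) 0) 0.
  move=> u0; have [r0|r0] := posnP r; first by rewrite nth_default // size_mkseq r0.
  apply/eqnP/eqP; rewrite -eqz_nat st_nth //.
  suff -> : value u 0 = (nth 0%N (nth [::] fs 0) 0)%:Z * \sum_i u (e i) by rewrite u0 mulr0.
  rewrite /value mulr_sumr.
  apply: eq_bigr => z _; move: cf; rewrite /const_functional forall_inE => /allP/(_ (nat_of_ord z)).
  by rewrite mem_iota ltn_ord => /(_ isT)/eqnP ->.
have mA : (st v, perm_row A) \in [seq sg <- m | eqn (nth 0%N sg.1 0) 0].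
  by rewrite mem_filter (state_mem vA) andbT; exact/deg/(relation_sum E2).
have mB : (st w, perm_row B) \in [seq sg <- m | eqn (nth 0%N sg.1 0) 0].
  by rewrite mem_filter (state_mem wB) andbT; exact/deg/(relation_sum E1).
move: ok; rewrite /pairs_ok forall_inE => /allP/(_ _ mA).
rewrite forall_inE => /allP/(_ _ mB); rewrite [(_, _).1]/= [(_, _).2]/=.
case: ifP => [|_ /hasP[t _]]; last by apply/negP; exact: refutesP.
rewrite [(_, _).1]/= !size_mkseq => /andP[/row_eqP v0 /row_eqP w0] _.
have one (u : vec X) (g : {perm 'I_8}) : (forall i, rho u (e i) = e (g i)) -> st u = nseq r 0%N -> g = 1%g.
  move=> ug u0; apply: perm_row_inj; rewrite -(state_perm ug) u0 perm_row1.
  by move: m_ok; rewrite /machine_ok; case: ifP => // /negbFE/row_eqP.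
rewrite (one _ _ vA v0) (one _ _ wB w0) in E1 E2.
by case: nz; apply; [exact: relation_trivial E2|exact: relation_trivial E1].
Qed.

End Exceptional.

Lemma certificates_tables : [seq u.1.1 | u <- certificates] = exceptional_tables.
Proof. by []. Qed.

Lemma certificates_ok : all certificate_ok certificates.
Proof. by vm_cast_no_check (erefl true). Qed.

Lemma exceptional_no_promislow (X : finType) (rho : vec X -> {perm X}) t :
  brace_map rho -> t \in exceptional_tables -> exceptional rho t -> ~ has_promislow rho.
Proof.
move=> rhoM; rewrite -certificates_tables => /mapP[[[t' fs] templates] cE ->] [e [p [L pt]]].
have := allP certificates_ok _ cE; rewrite /certificate_ok -pt.
case: ifP => // fsz; case: ifP => // /eqnP f8; case: ifP => // cf; case: ifP => // mok ok.
apply: (no_promislow rhoM L _ mok cf ok) => z.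
move: fsz; rewrite forall_inE => /allP/(_ (nth [::] fs z)) h; apply/eqnP/h.
by rewrite mem_nth // f8.
Qed.

Local Close Scope ring_scope.

(** * Rigidity of the exceptional solutions *)

Local Open Scope ring_scope.

Definition row_classes (ct : seq (seq nat)) : seq nat := [seq find (row_eq r) ct | r <- ct].

(** [cls] sends a point to the first one with the same row, so that rows are
    compared through small numbers. *)
Definition row_preserver (cls f : seq nat) : bool :=
  forall_in (fun i =>
    eqn (nth 0 cls (nth 0 f i)) (nth 0 cls (nth 0 f (nth 0 cls i))))%N (iota 0 8).

Definition row_pow f m := iter m (row_comp f) (iota 0 8).

(** A permutation of odd order dividing 24 has order 1 or 3; those whose 24th
    power is not 1 are kept. *)
Definition odd_preservers (perms ct : seq (seq nat)) : seq (seq nat) :=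
  let cls := row_classes ct in
  [seq f <- perms | if row_preserver cls f then
     if row_eq (row_pow f 24) (iota 0 8) then row_eq (row_pow f 3) (iota 0 8) else true
   else false].

(** The permutation [(p_z)^-1 f p_y], with [z] the preimage of [y] under [f]. *)
Definition twist (ct : seq (seq nat)) (f : seq nat) (y : nat) : seq nat :=
  let q := row ct (index y f) in
  [seq nth 0%N (row ct y) (nth 0%N f (index i q)) | i <- iota 0 8].

Definition refine ct (L : seq (seq nat)) :=
  [seq f <- L | forall_in (fun y => has (row_eq (twist ct f y)) L) (iota 0 8)].

Definition rigid : bool :=
  let perms := permutations (iota 0 8) in
  forall_in (fun t => let ct := cycle_table t in
    forall_in (row_eq (iota 0 8)) (refine ct (refine ct (odd_preservers perms ct))))
    exceptional_tables.

Lemma exceptional_rigid : rigid.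
Proof. by vm_cast_no_check (erefl true). Qed.

(** The permutations of the multiples of [1 - k] preserve the classes of equal
    rows of the cabled cycle set, have odd order, and are closed under [twist]. *)
Section Rigid.
Variables (X : finType) (rho : vec X -> {perm X}) (k : int) (M : nat).
Variables (e : 'I_8 -> X) (p : 'I_8 -> {perm 'I_8}) (t : seq cycle_row).
Hypotheses (rhoM : brace_map rho) (L : labelled (cable rho k) e p).
Hypotheses (tE : t \in exceptional_tables) (pt : perm_table p = cycle_table t).
Hypotheses (Modd : odd M) (clM : forall v, rho (v *~ (M%:Z * (1 - k))) = 1%g).
Let ct := cycle_table t.

Let C (s : {perm 'I_8}) := exists v, forall i, rho (v *~ (1 - k)) (e i) = e (s i).

Let eI : injective e. Proof. exact: bij_inj L.1. Qed.

Let rowE (i : 'I_8) : row ct i = perm_row (p i).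
Proof. by rewrite /ct -pt row_perm_table. Qed.

Let row_of_fun (F : nat -> nat) (g : {perm 'I_8}) : (forall i : 'I_8, F i = g i) ->
  [seq F i | i <- iota 0 8] = perm_row g.
Proof.
move=> h; apply: (@eq_from_nth _ 0%N) => [|i]; rewrite size_map size_iota ?size_perm_row // => i8.
rewrite (nth_map 0%N) ?size_iota // nth_iota // add0n.
by rewrite (h (Ordinal i8)) -(nth_perm_row g (Ordinal i8)).
Qed.

Let row_powE (s : {perm 'I_8}) m : row_pow (perm_row s) m = perm_row (s ^+ m)%g.
Proof.
elim: m => [|m IHm]; first by rewrite expg0 perm_row1.
by rewrite /row_pow /= -/(row_pow _ m) IHm row_comp_perm expgS.
Qed.

Let C_pow s m : C s -> C (s ^+ m)%g.
Proof.
case=> v vE; elim: m => [|m [w wE]].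
  by exists 0 => i; rewrite mul0rz rho0 // expg0 !perm1.
exists (vmul (cable rho (1 - k)) v w) => i.
by rewrite vmul_cable rhoM permM vE wE expgS permM.
Qed.

(** By [rho_order], as [M] is odd an element of 2-power order of the group is
    trivial. *)
Let C_odd s : C s -> (s ^+ 24)%g = 1%g -> (s ^+ 3)%g = 1%g.
Proof.
move=> /(C_pow 3)[w]; rewrite (expgM s 3 8); move: (s ^+ 3)%g => s3 wE s24.
have w8 : (rho (w *~ (1 - k)) ^+ 8)%g = 1%g.
  have wX m i : (rho (w *~ (1 - k)) ^+ m)%g (e i) = e ((s3 ^+ m)%g i).
    elim: m i => [|m IHm] i; first by rewrite !expg0 !perm1.
    by rewrite !expgS !permM wE IHm.
  apply/permP => x; have [e' _ Ke] := L.1; rewrite -(Ke x) wX.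
  by rewrite s24 !perm1.
have w1 : rho (w *~ (1 - k)) = 1%g.
  apply: (rho_order rhoM (q := M) (l := 8) _ _ w8); last by rewrite -mulrzA mulrC clM.
  by rewrite -[8%N]/(2 ^ 3)%N coprimeXr // coprimen2.
by apply/permP => i; apply: eI; rewrite -wE w1 !perm1.
Qed.

Let C_rows s i j : C s -> p i = p j -> p (s i) = p (s j).
Proof.
case=> v vE pij; have rows a b : p a = p b <-> rho (unitv (e a) *~ k) = rho (unitv (e b) *~ k).
  split=> h; last by apply/permP => l; apply: eI; rewrite -!L.2 /cable h.
  apply/permP => x; have [e' _ Ke] := L.1; rewrite -(Ke x).
  by have := L.2 a (e' x); rewrite h -(L.2 b) /cable.
by apply/rows; rewrite -!vE; apply: cable_row_stable => //; apply/rows.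
Qed.

Let C_twist s y : C s -> C ((p (s^-1 y))^-1 * s * p y)%g.
Proof.
case=> v vE; set c := v *~ (1 - k) in vE; set u := unitv (e y) *~ k.
pose t1 := vact (rho c) u; pose c' := vact (rho t1)^-1%g c.
have E : (rho c * rho u = rho t1 * rho c')%g := rho_exchange rhoM c u.
have sV : ((rho c)^-1)%g (e y) = e ((s^-1)%g y).
  by apply: (@perm_inj _ (rho c)); rewrite permKV vE permKV.
have t1E : t1 = unitv (e ((s^-1)%g y)) *~ k by rewrite /t1 vact_mulz vact_unitv sV.
exists (vact (rho t1)^-1%g v) => i; rewrite -vact_mulz -/c -/c'.
have -> : rho c' = ((rho t1)^-1 * rho c * rho u)%g by rewrite -mulgA E mulKg.
have pV : ((rho t1)^-1)%g (e i) = e ((p ((s^-1)%g y))^-1%g i).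
  by apply: (@perm_inj _ (rho t1)); rewrite permKV t1E -[rho _]/(cable rho k _) L.2 permKV.
by rewrite !permM pV vE -[rho u]/(cable rho k (unitv (e y))) L.2.
Qed.

Let twistE (s : {perm 'I_8}) (y : 'I_8) : twist ct (perm_row s) (nat_of_ord y) = perm_row ((p (s^-1 y))^-1 * s * p y)%g.
Proof.
apply: row_of_fun => i.
by rewrite index_perm_row !rowE index_perm_row !nth_perm_row !permM.
Qed.

Let C_preserver s : C s -> perm_row s \in odd_preservers (permutations (iota 0 8)) ct.
Proof.
move=> Cs; rewrite mem_filter mem_permutations perm_row_perm andbT.
have -> : row_preserver (row_classes ct) (perm_row s).
  have sz : size ct = 8 by rewrite /ct -pt size_map size_enum_ord.
  rewrite /row_preserver forall_inE; apply/allP => i; rewrite mem_iota /= => i8.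
  have cl (a : 'I_8) : nth 0%N (row_classes ct) a = find (row_eq (row ct a)) ct.
    by rewrite /row_classes (nth_map [::]) ?sz.
  have clt (a : 'I_8) : (find (row_eq (row ct a)) ct < 8)%N.
    by rewrite -[X in (_ < X)%N]sz -has_find; apply/hasP; exists (row ct a); [rewrite mem_nth ?sz|exact/row_eqP].
  have hf (a : 'I_8) : row ct (find (row_eq (row ct a)) ct) = row ct a.
    have : has (row_eq (row ct a)) ct by rewrite has_find sz clt.
    by move/(nth_find [::])/row_eqP => E; exact: esym E.
  rewrite -[i]/(nat_of_ord (Ordinal i8)) cl.
  set j := find _ _; have j8 : (j < 8)%N by exact: clt.
  rewrite -[j]/(nat_of_ord (Ordinal j8)) !nth_perm_row !cl; apply/eqnP.
  congr find; congr row_eq; rewrite !rowE; congr perm_row; apply: C_rows => //.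
  by apply: perm_row_inj; rewrite -!rowE hf.
rewrite !row_powE; case: row_eqP => // s24; apply/row_eqP; rewrite -perm_row1; congr perm_row.
by apply: C_odd => //; apply: perm_row_inj; rewrite s24 perm_row1.
Qed.

Let C_refine (R : seq (seq nat)) : (forall s, C s -> perm_row s \in R) ->
  forall s, C s -> perm_row s \in refine ct R.
Proof.
move=> h s Cs; rewrite mem_filter h // andbT forall_inE; apply/allP => y.
rewrite mem_iota => /andP[_ y8]; rewrite -[y]/(nat_of_ord (Ordinal y8)) twistE.
by apply/hasP; exists (perm_row ((p ((s^-1)%g (Ordinal y8)))^-1 * s * p (Ordinal y8))%g);
  [exact/h/C_twist|exact/row_eqP].
Qed.

Let C_trivial s : C s -> s = 1%g.
Proof.
move=> Cs; have := exceptional_rigid; rewrite /rigid forall_inE => /allP/(_ _ tE).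
rewrite forall_inE => /allP/(_ _ (C_refine (C_refine C_preserver) Cs))/row_eqP E.
by apply: perm_row_inj; rewrite perm_row1.
Qed.

(** The rows of the two cycle sets differ by permutations of multiples of
    [1 - k], and the closure properties leave only the identity for these. *)
Lemma exceptional_uncable : exceptional rho t.
Proof.
exists e, p; split=> //; split=> [|i j]; first exact: L.1.
rewrite -L.2 /cable; set u := unitv (e i).
pose c := vact (rho (u *~ k))^-1%g u.
have uE : u = vmul rho (u *~ k) (c *~ (1 - k)).
  rewrite /vmul -vact_mulz -vactM mulgV vact1.
  by rewrite -mulrzDr addrC subrK.
have [s sE] : exists s : {perm 'I_8}, forall i, rho (c *~ (1 - k)) (e i) = e (s i).
  have [e' eK Ke] := L.1; set g := rho _.
  have inj : injective (fun j => e' (g (e j))) by move=> a b /(can_inj Ke)/perm_inj/(can_inj eK).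
  by exists (perm inj) => l; rewrite permE Ke.
have s1 : s = 1%g by apply: C_trivial; exists c.
have [e' _ Ke] := L.1.
by rewrite {1}uE rhoM permM -(Ke (rho (u *~ k) (e j))) sE s1 perm1.
Qed.

End Rigid.

Local Close Scope ring_scope.

(** * The theorem *)

Local Open Scope ring_scope.

Definition sigma_row (t : seq cycle_row) (i : nat) : seq nat :=
  [seq (nat_sigma t i.+1 z.+1).-1 | z <- iota 0 8].

Lemma sigma_row_perm t (i : 'I_8) : t \in exceptional_tables -> perm_eq (sigma_row t i) (iota 0 8).
Proof.
have : all (fun t => all (fun i => perm_eq (sigma_row t i) (iota 0 8)) (iota 0 8)) exceptional_tables.
  by vm_compute.
by move=> /allP/(_ t) h tE; apply: (allP (h tE)); rewrite mem_iota ltn_ord.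
Qed.

Lemma nat_tauE t (i j : 'I_8) : t \in exceptional_tables ->
  (nat_tau t j.+1 i.+1).-1 = index (nat_of_ord i) (sigma_row t (nth 0 (sigma_row t i) j)%N).
Proof.
have : all (fun t => all (fun i => all (fun j => (nat_tau t j.+1 i.+1).-1 ==
    index i (sigma_row t (nth 0 (sigma_row t i) j)%N)) (iota 0 8)) (iota 0 8)) exceptional_tables.
  by vm_compute.
move=> /allP/(_ t) h tE; have := h tE => /allP/(_ (nat_of_ord i)).
rewrite mem_iota ltn_ord => /(_ isT)/allP/(_ (nat_of_ord j)); rewrite mem_iota ltn_ord.
by move/(_ isT)/eqP.
Qed.

Lemma cycle_table_row t (i : 'I_8) (p : 'I_8 -> {perm 'I_8}) (j : 'I_8) :
  perm_table p = cycle_table t -> nat_of_ord (p i j) = index (nat_of_ord j) (sigma_row t i).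
Proof.
move=> pt; rewrite -nth_perm_row -row_perm_table pt /row (nth_map 0%N) ?size_iota //.
by rewrite (nth_map 0%N) ?size_iota // !nth_iota.
Qed.

Section Isomorphic.
Variables (X : finType) (r : X * X -> X * X) (t : seq cycle_row).
Hypotheses (rP : is_solution r) (rK : involutive r) (tE : t \in exceptional_tables).
Variable rho : vec X -> {perm X}.
Hypothesis rhoE : forall x, rho (unitv x) = sol_perm rP x.

Lemma isomorphic_exceptional : isomorphic r (table_map t) -> exceptional rho t.
Proof.
case=> f [e fK Kf] fr; have [p pt _] := cycle_table_brace tE.
exists e, p; split=> //; split=> [|i j]; first by exists f.
rewrite rhoE; apply: (bij_inj (sol_sigma_bij rP (e i))); rewrite sol_permK.
apply: (can_inj fK); rewrite Kf.
have := fr (e i) (e (p i j)); rewrite /table_map !Kf => -[-> _] /=.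
have jE := cycle_table_row i j pt.
have js : nat_of_ord j \in sigma_row t i by rewrite (perm_mem (sigma_row_perm i tE)) mem_iota ltn_ord.
have : nth 0%N (sigma_row t i) (p i j) = j by rewrite jE nth_index.
by rewrite /sigma_row (nth_map 0%N) ?size_iota // nth_iota // add0n => ->; rewrite inord_val.
Qed.

(** The second component of the solution is determined by the first, so the
    [tau] part of a table only has to agree with the value computed from its
    [sigma] part. *)
Lemma exceptional_isomorphic : exceptional rho t -> isomorphic r (table_map t).
Proof.
case=> e [p [[[f eK Ke] L] pt]]; exists f; first by exists e.
have pE i j : sol_perm rP (e i) (e j) = e (p i j) by rewrite -rhoE L.
have sE i j : nat_of_ord ((p i)^-1%g j) = nth 0%N (sigma_row t i) j.
  have sz : size (sigma_row t i) = 8 by rewrite /sigma_row size_map size_iota.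
  have lt : (nth 0%N (sigma_row t i) j < 8)%N.
    have : nth 0%N (sigma_row t i) j \in sigma_row t i by rewrite mem_nth ?sz.
    by rewrite (perm_mem (sigma_row_perm i tE)) mem_iota.
  suff -> : (p i)^-1%g j = Ordinal lt by [].
  apply: (@perm_inj _ (p i)); rewrite permKV; apply: ord_inj; rewrite (cycle_table_row _ _ pt) -[nat_of_ord (Ordinal lt)]/(nth 0%N (sigma_row t i) j).
  by rewrite index_uniq ?sz // (perm_uniq (sigma_row_perm i tE)) iota_uniq.
move=> x y; rewrite -(Ke x) -(Ke y); move: (f x) (f y) => i j.
have rE : r (e i, e j) = (e ((p i)^-1%g j), e (p ((p i)^-1%g j) i)).
  have ej : e j = sol_perm rP (e i) (e ((p i)^-1%g j)) by rewrite pE permKV.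
  by rewrite {1}ej sol_permE // pE.
rewrite rE /= !eK /table_map /=; congr (_, _); apply: ord_inj.
  have := sE i j; rewrite /sigma_row (nth_map 0%N) ?size_iota // nth_iota // add0n => <-.
  by rewrite inord_val.
have := cycle_table_row ((p i)^-1%g j) i pt; rewrite sE -nat_tauE // => <-.
by rewrite inord_val.
Qed.

End Isomorphic.

Local Close Scope ring_scope.

Theorem theorem4p7 (X : finType) (r : X * X -> X * X)
    (r_sol : is_solution r) (r_inv : involutive r)
    (X_le8 : #|X| <= 8) (r_nmp : ~ multipermutation r) :
  contains_copy (structure_group r) promislow <->
  (forall t, t \in exceptional_tables -> ~ isomorphic r (table_map t)).
Proof.
have [rho rhoM rhoev] := cycle_set_brace (sol_cycle_set r_sol r_inv).
have rhoE x : rho (unitv x) = sol_perm r_sol x.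
  by have := rhoev [:: (x, false)]; rewrite /ev /= /sdmul /= vact0 addr0 mulg1.
rewrite (structure_group_promislow r_inv rhoM rhoev); split=> [P t tE iso|noiso].
  exact: (exceptional_no_promislow rhoM tE (isomorphic_exceptional tE rhoE iso) P).
have [Z [rhoZ [f [ZM Zirr Znt [fM fS fJ]]]]] := irretractable_image r_inv rhoM rhoE r_nmp.
have [d d0 Zd] := brace_class ZM.
have red : reduction rho 1 d rhoZ f by split.
have [k [j [M [W [rhoW [g [redW k0 Modd clM]]]]]]] := reduction_exists rhoM X_le8 red d0.
have [h hK] := choice (red_surj redW).
have W8 : #|W| <= 8.
  by apply: leq_trans X_le8; apply: (@leq_card _ _ h); exact: can_inj hK.
have k_neq0 : k != 0%R by rewrite gt_eqF.
apply: (promislow_cable k_neq0).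
have kM := cableM rhoM k.
have table s : s = tableA \/ s = tableB -> contains_table rhoW s -> has_promislow (cable rho k).
  move=> sAB [g' g'I g'E].
  case: (double_cover kM X_le8 (red_morph redW) (red_surj redW) sAB (red_fibre redW) g'I g'E) => //.
  case=> t tE [e [p [L pt]]]; case: (noiso t tE); apply: (exceptional_isomorphic r_inv tE rhoE).
  exact: (exceptional_uncable rhoM L tE pt Modd clM).
case: (small_irretractable (red_brace redW) (red_class redW) W8 (red_irr redW) (red_nontriv redW)).
- case=> W8' P; have hI : injective h := can_inj hK.
  have [h' h'K Kh'] : bijective h by apply: inj_card_bij hI _; rewrite W8'.
  have gI : injective g.
    by move=> x y gxy; rewrite -(Kh' x) -(Kh' y) -[h' x]hK -[h' y]hK !Kh' gxy.
  apply: (promislow_push (red_brace redW) kM (f := h)) P => // x y.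
  by apply: gI; rewrite hK (red_morph redW) !hK.
- by apply: table; left.
- by apply: table; right.
Qed.
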